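(* Let $(G,K)$ be a Gelfand pair with $L^2(G//K)$ separable, and let $\alpha$ be a topological automorphism of $G$. Let $\theta\in L^2(G//K)$ be such that $\|\theta\|_{L^2(G//K)}=1$. If $u\in L^p(G\times\mathcal{S}^+)$, $1\leq p\leq\infty$, then the localization operator $\mathcal{L}_{\theta,\alpha}^{u}:L^2(G//K)\to L^2(G//K)$ is in the Schatten-von Neumann class $S_p(L^2(G//K))$ and $$\|\mathcal{L}_{\theta,\alpha}^{u}\|_{S_p(L^2(G//K))}\leq\|u\|_{L^p(G\times\mathcal{S}^+)}.$$
   Context: $G$ is a locally compact Hausdorff group with left Haar measure $dx$, and $K$ is a compact subgroup. A function $f$ on $G$ is $K$-bi-invariant if $f(kxk')=f(x)$ for all $x\in G$, $k,k'\in K$. $\mathcal{C}_c(G//K)$ is the space of continuous compactly supported $K$-bi-invariant complex functions, and $L^p(G//K)$ is the space of $K$-bi-invariant elements of $L^p(G)$, with the norm of $L^p(G)$; the inner product $\langle f,g\rangle_{L^2(G//K)}$ means $\int_G f\overline{g}\,dx$. $(G,K)$ is a Gelfand pair if $\mathcal{C}_c(G//K)$ is commutative under convolution $(f\ast g)(x)=\int_G f(y)g(y^{-1}x)dy$ (then $G$ is unimodular). A spherical function is a continuous $K$-bi-invariant function $\varphi$ on $G$ such that $f\mapsto\int_G f(x)\varphi(x)dx$ is a nontrivial character of the convolution algebra $\mathcal{C}_c(G//K)$. $\mathcal{S}_b(G,K)$ is the set of bounded spherical functions, and $\mathcal{S}^+\subset\mathcal{S}_b(G,K)$ is the set of positive-definite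 spherical functions. The spherical Fourier transform of $f\in L^1(G//K)$ is $\widehat f(\varphi)=\int_G f(x)\varphi(x^{-1})dx$. $\mathcal{S}_b(G,K)$ has the weak topology generated by the maps $\widehat f$, $f\in L^1(G//K)$. $\mathcal{S}^+$ carries the Plancherel measure, denoted $d\varphi$: the positive Radon measure such that, whenever $f\in L^1(G//K)$ is a linear combination of positive-definite $K$-bi-invariant functions, $\widehat f\in L^1(\mathcal{S}^+)$ and $f(x)=\int_{\mathcal{S}^+}\widehat f(\varphi)\varphi(x)\,d\varphi$; the map $f\mapsto \widehat f$ on $L^1(G//K)\cap L^2(G//K)$ extends to an isometry of $L^2(G//K)$ onto $L^2(\mathcal{S}^+)$. $L^p(G\times\mathcal{S}^+)$ is taken with respect to $dt\,d\varphi$. For a topological automorphism $\alpha$ of $G$, $\delta_\alpha>0$ is the constant with $d(\alpha(x))=\delta_\alpha dx$, i.e. $\int_G f(\alpha(x))dx=\delta_\alpha^{-1}\int_G f(x)dx$. For $\theta\in L^2(G//K)$, $t\in G$, $\varphi\in\mathcal{S}_b(G,K)$, put $\theta_{\alpha,\varphi,t}(x)=\delta_\alpha^{1/2}\varphi(x)\theta(\alpha(t^{-1}x))$. The Stockwell transform is $S_{\theta,\alpha}f(t,\varphi)=\langle f,\theta_{\alpha,\varphi,t}\rangle_{L^2(G//K)}=\delta_\alpha^{1/2}\int_G f(x)\overline{\varphi(x)\theta(\alpha(t^{-1}x))}\,dx$ for $f\in L^2(G//K)$. For a measurable $u:G\times\mathcal{S}^+\to\mathbb{C}$, the localization operator is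 defined for $f\in L^2(G//K)$ by $$\mathcal{L}_{\theta,\alpha}^{u}f(x)=\int_{\mathcal{S}^+}\int_G u(t,\varphi)\,S_{\theta,\alpha}f(t,\varphi)\,\theta_{\alpha,\varphi,t}(x)\,dt\,d\varphi,\quad x\in G.$$ Schatten-von Neumann classes: for a separable complex Hilbert space $H$ and a compact operator $T$ on $H$, the singular values $s_k(T)$, $k=1,2,\dots$, are the eigenvalues of $|T|=\sqrt{T^*T}$ (counted with multiplicity). For $1\le p<\infty$, $S_p(H)$ is the set of compact $T$ with $\|T\|_{S_p(H)}=\left(\sum_{k}s_k(T)^p\right)^{1/p}<\infty$. By definition $S_\infty(H)=\mathcal{B}(H)$, the bounded linear operators on $H$ with the operator norm.
   Formalization: The localization operator is taken in the weak sense, via its inner products with every g in L^2(G//K), because the pointwise integral need not converge for p>1 and need not be K-bi-invariant; the two agree whenever the pointwise formula gives an element of L^2(G//K). *)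

(* Defs.v *)
From HB Require Import structures.
From mathcomp Require Import all_boot all_order all_algebra.
From mathcomp Require Import all_classical all_reals all_analysis measurable_realfun.
From mathcomp Require Import generic_quotient complex ring_quotient.

Set Implicit Arguments.
Unset Strict Implicit.
Unset Printing Implicit Defensive.
Import Order.TTheory GRing.Theory Num.Theory numFieldNormedType.Exports.
Import Normc.

Local Open Scope quotient_scope.
Local Open Scope classical_set_scope.
Local Open Scope ring_scope.

(* Pointed only because every measurableType is pointed. *)
HB.mixin Record isTopologicalGroup G of Group G & Topological G := {
  mulg_continuous : continuous (fun z : G * G => (z.1 * z.2)%g) ;
  invg_continuous : continuous (fun x : G => x^-1%g)
}.

#[short(type="topologicalGroupType")]
HB.structure Definition TopologicalGroup :=
  {G of Group G & PointedTopological G & isTopologicalGroup G}.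

Notation borel T := (g_sigma_algebraType (@open T)).

Section Radon.
Context (R : realType) (T : ptopologicalType).
Implicit Type mu : {measure set (borel T) -> \bar R}.

Definition radon mu :=
  [/\ forall A : set T, compact A -> (mu A < +oo)%E,
      forall A : set (borel T), measurable A ->
        mu A = ereal_inf [set mu U | U in [set U : set T | open U /\ A `<=` U]] &
      forall U : set T, open U ->
        mu U = ereal_sup [set mu A | A in [set A : set T | compact A /\ A `<=` U]]].

End Radon.

Section ComplexFunctions.
Context (R : realType).

Definition ccontinuous (T : topologicalType) (f : T -> R[i]) :=
  continuous (f : T -> (R[i] : numFieldType)).

Context d (T : measurableType d) (mu : {measure set T -> \bar R}).
Implicit Types f g : T -> R[i].

Definition cmeasurable f :=
  measurable_fun setT (fun x => complex.Re (f x)) /\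
  measurable_fun setT (fun x => complex.Im (f x)).

Definition cintegrable f :=
  mu.-integrable setT (fun x => (complex.Re (f x))%:E) /\
  mu.-integrable setT (fun x => (complex.Im (f x))%:E).

Definition cintegral f : R[i] :=
  Complex (\int[mu]_x complex.Re (f x)) (\int[mu]_x complex.Im (f x)).

Definition clnorm (p : \bar R) f : \bar R := Lnorm mu p (fun x => (normc (f x))%:E).

Definition cLp (p : \bar R) f := cmeasurable f /\ (clnorm p f < +oo)%E.

Definition cprod f g : R[i] := cintegral (fun x => f x * (g x)^*).

End ComplexFunctions.

Section Group.
Context (R : realType) (G : topologicalGroupType).
Local Open Scope group_scope.

Definition left_haar (mu : {measure set (borel G) -> \bar R}) :=
  [/\ radon mu, mu setT <> 0%E &
      forall (a : G) (A : set (borel G)), measurable A ->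
        mu [set a * x | x in A] = mu A].

Definition compact_subgroup (K : set G) :=
  [/\ compact K, K 1, (forall x y, K x -> K y -> K (x * y)) &
      (forall x, K x -> K x^-1)].

Definition biinvariant (K : set G) (f : G -> R[i]) :=
  forall x k k', K k -> K k' -> f (k * x * k') = f x.

Definition positive_definite (phi : G -> R[i]) :=
  forall n (c : 'I_n -> R[i]) (x : 'I_n -> G),
    (0 <= \sum_(i < n) \sum_(j < n) c i * (c j)^* * phi ((x j)^-1 * x i)%g)%R.

Definition topological_automorphism (alpha : G -> G) :=
  [/\ forall x y, alpha (x * y) = alpha x * alpha y, continuous alpha &
      exists beta : G -> G,
        [/\ cancel alpha beta, cancel beta alpha & continuous beta]].

Definition modulus (mu : {measure set (borel G) -> \bar R}) (alpha : G -> G)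
    (delta : R) :=
  (0 < delta)%R /\
  forall f : borel G -> \bar R, measurable_fun setT f -> (forall x, (0 <= f x)%E) ->
    (\int[mu]_x f (alpha x) = (delta^-1%R)%:E * \int[mu]_x f x)%E.

End Group.

Section Gelfand.
Context (R : realType) (G : topologicalGroupType).
Context (mu : {measure set (borel G) -> \bar R}) (K : set G).
Implicit Types f g : G -> R[i].

Definition Cc_biinv f :=
  [/\ ccontinuous f, compact (closure [set x | f x != 0]) & biinvariant K f].

Definition Lp_biinv (p : \bar R) f := cLp mu p f /\ biinvariant K f.

Definition convolution f g (x : G) : R[i] :=
  cintegral mu (fun y => f y * g (y^-1 * x)%g).

Definition gelfand_pair :=
  compact_subgroup K /\
  forall f g, Cc_biinv f -> Cc_biinv g -> convolution f g = convolution g f.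

Definition spherical (phi : G -> R[i]) :=
  let chi f := cintegral mu (fun x => f x * phi x) in
  [/\ ccontinuous phi, biinvariant K phi,
      (forall f g, Cc_biinv f -> Cc_biinv g ->
         chi (convolution f g) = chi f * chi g) &
      (exists2 f, Cc_biinv f & chi f != 0)].

Definition bounded_spherical (phi : G -> R[i]) :=
  spherical phi /\ exists M : R, forall x, normc (phi x) <= M.

Definition splus := {phi : G -> R[i] | bounded_spherical phi /\ positive_definite phi}.

Definition fourier f (phi : G -> R[i]) : R[i] := cintegral mu (fun x => f x * phi (x^-1)%g).

Definition fourier_family (phi : splus) :
    {ptws {f | Lp_biinv 1%E f} -> (R[i] : numFieldType)} :=
  fun s => fourier (sval s) (sval phi).

HB.instance Definition _ := gen_eqMixin splus.
HB.instance Definition _ := gen_choiceMixin splus.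

(* [splus] with the topology induced by the weak topology of the bounded      *)
(* spherical functions. The point [phi0] is irrelevant: it only makes the type *)
(* pointed, so that it carries a Borel sigma-algebra. For a Gelfand pair one   *)
(* may take the constant function 1.                                           *)
Definition splus_at (phi0 : splus) : Type := initial_topology fourier_family.

HB.instance Definition _ (phi0 : splus) :=
  Topological.copy (splus_at phi0) (initial_topology fourier_family).
HB.instance Definition _ (phi0 : splus) :=
  isPointed.Build (splus_at phi0) phi0.

(* In the inversion formula the positive-definite functions are continuous,   *)
(* as the formula holds at every point.                                       *)
Definition positive_definite_span f :=
  exists n (c : 'I_n -> R[i]) (psi : 'I_n -> G -> R[i]),
    (forall i, [/\ ccontinuous (psi i), biinvariant K (psi i) &
                   positive_definite (psi i)]) /\
    (forall x, f x = \sum_(i < n) c i * psi i x).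

Definition plancherel_measure (phi0 : splus)
    (nu : {measure set (borel (splus_at phi0)) -> \bar R}) :=
  let hat f := (fun phi => fourier f (sval phi)) : borel (splus_at phi0) -> R[i] in
  [/\ radon nu,
      (forall f, Lp_biinv 1%E f -> positive_definite_span f ->
         cLp nu 1%E (hat f) /\
         forall x, f x = cintegral nu (fun phi => hat f phi * sval phi x)) &
      exists F : (G -> R[i]) -> (borel (splus_at phi0) -> R[i]),
      [/\ (forall f, Lp_biinv 2%:E f ->
             cLp nu 2%:E (F f) /\ clnorm nu 2%:E (F f) = clnorm mu 2%:E f),
          (forall a f g, Lp_biinv 2%:E f -> Lp_biinv 2%:E g ->
             {ae nu, forall phi, F (fun x => a * f x + g x) phi
                                 = a * F f phi + F g phi}),
          (forall f, Lp_biinv 1%E f -> Lp_biinv 2%:E f ->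
             {ae nu, forall phi, F f phi = hat f phi}) &
          (forall h, cLp nu 2%:E h ->
             exists2 f, Lp_biinv 2%:E f & {ae nu, forall phi, F f phi = h phi})]].

End Gelfand.

Section ComplexL2.
Context (R : realType) d (T : measurableType d) (mu : {measure set T -> \bar R}).
Implicit Types f g : T -> R[i].

Lemma cmeasurable_lin (a : R[i]) f g :
  cmeasurable f -> cmeasurable g -> cmeasurable (fun x => a * f x + g x).
Proof.
case: a => a b [mf1 mf2] [mg1 mg2]; split.
- rewrite [X in measurable_fun _ X](_ : _ = fun x =>
    a * complex.Re (f x) - b * complex.Im (f x) + complex.Re (g x)).
    by apply: measurable_funD => //; apply: measurable_funB;
      exact: measurable_funM.
  by apply/funext => x; case: (f x) => ? ?; case: (g x).
- rewrite [X in measurable_fun _ X](_ : _ = fun x =>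
    a * complex.Im (f x) + b * complex.Re (f x) + complex.Im (g x)).
    by apply: measurable_funD => //; apply: measurable_funD;
      exact: measurable_funM.
  by apply/funext => x; case: (f x) => ? ?; case: (g x).
Qed.

Lemma measurable_normc f :
  cmeasurable f -> measurable_fun setT (fun x => normc (f x)).
Proof.
move=> [mf1 mf2]; rewrite [X in measurable_fun _ X](_ : _ = Num.sqrt \o
  (fun x => complex.Re (f x) ^+ 2 + complex.Im (f x) ^+ 2)).
  apply: measurableT_comp; first exact: (continuous_measurable_fun (@sqrt_continuous R)).
  by apply: measurable_funD; exact: measurable_funX.
by apply/funext => x /=; case: (f x) => ? ?.
Qed.

Lemma normc_ge0 (z : R[i]) : 0 <= normc z.
Proof. by case: z => ? ?; exact: sqrtr_ge0. Qed.

Lemma cLp2_lin (a : R[i]) f g :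
  cLp mu 2%:E f -> cLp mu 2%:E g -> cLp mu 2%:E (fun x => a * f x + g x).
Proof.
move=> [mf lf] [mg lg]; have mafg := cmeasurable_lin a mf mg; split=> //.
have p1 : (1 <= 2%:E :> \bar R)%E by rewrite lee_fin ler1n.
pose F x := normc (f x); pose H x := normc (g x).
have FL : F \in Lfun mu 2%:E.
  by apply/andP; split; rewrite inE //; exact: measurable_normc.
have HL : H \in Lfun mu 2%:E.
  by apply/andP; split; rewrite inE //; exact: measurable_normc.
have [_ /(_ (normc a) F H FL HL)] := Lfun_submod_closed mu p1.
rewrite /Lfun => /andP[]; rewrite !inE/= => mN.
rewrite /finite_norm /clnorm unlock => lN.
apply: poweR_lty; apply: le_lt_trans (lty_poweRy _ lN); last first.
  by rewrite invr_eq0 pnatr_eq0.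
have mpow (h : T -> R) : measurable_fun setT h ->
    measurable_fun setT (fun x => `|(h x)%:E| `^ 2)%E.
  move=> mh; apply: (@measurableT_comp _ _ _ _ _ _ (fun x => x `^ 2)%E).
    exact: measurable_poweR.
  by apply: measurableT_comp => //; exact/measurable_EFinP.
apply: ge0_le_integral => //.
- by move=> x _; exact: poweR_ge0.
- by apply: mpow; exact: measurable_normc.
- exact: mpow.
- move=> x _; rewrite !abse_EFin/= !lee_fin.
  rewrite ge0_ler_powR ?nnegrE ?normr_ge0 // !ger0_norm ?normc_ge0 //.
    by rewrite (le_trans (le_normcD _ _))// normcM.
  by rewrite addr_ge0 ?mulr_ge0 ?normc_ge0.
Qed.

Lemma cLp2_0 : cLp mu 2%:E (fun=> 0 : R[i]).
Proof.
split; first by split; exact: measurable_cst.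
rewrite /clnorm.
have -> : (fun _ : T => (normc (0 : R[i]))%:E) = cst 0%E.
  by apply/funext => x; rewrite normc0.
by rewrite Lnorm0 ?ltry// eqe pnatr_eq0.
Qed.

End ComplexL2.

Section L2.
Context (R : realType) (G : topologicalGroupType).
Context (mu : {measure set (borel G) -> \bar R}) (K : set G).

Definition L2_pred : {pred (G -> (R[i])^o)} := mem [set f | Lp_biinv mu K 2%:E f].

Lemma L2_submod_closed : submod_closed L2_pred.
Proof.
split; first by rewrite inE; split; [exact: cLp2_0 | move=> ?].
move=> a f g; rewrite !inE => -[lf kf] [lg kg]; split; first exact: cLp2_lin.
by move=> x k k' Kk Kk'; rewrite !fctE kf ?kg.
Qed.

HB.instance Definition _ :=
  GRing.isSubmodClosed.Build _ _ L2_pred L2_submod_closed.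

Record L2fun := MkL2fun { L2val :> G -> (R[i])^o ; _ : L2val \in L2_pred }.

HB.instance Definition _ := [isSub for L2val].
HB.instance Definition _ := [Choice of L2fun by <:].
HB.instance Definition _ := [SubChoice_isSubLmodule of L2fun by <:].

Definition L2_null : {pred L2fun} :=
  mem [set f : L2fun | {ae mu, forall x, f x = 0}].

Lemma L2_null_zmod_closed : zmod_closed L2_null.
Proof.
split; first by rewrite inE; exact: aeW.
move=> f g; rewrite !inE => f0 g0.
by apply: (@filterS2 _ _ (ae_filter_ringOfSetsType mu)) f0 g0 => x /= fx gx; rewrite fctE/= opprfctE fx gx subr0.
Qed.

HB.instance Definition _ :=
  GRing.isZmodClosed.Build _ L2_null L2_null_zmod_closed.

(* L^2(G//K): bi-invariant square-integrable functions up to null sets. *)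
Definition L2 := Quotient.quot L2_null.

HB.instance Definition _ := Choice.on L2.
HB.instance Definition _ := GRing.Zmodule.on L2.
HB.instance Definition _ := EqQuotient.on L2.

Definition L2_class (f : L2fun) : L2 := \pi_L2 f.

Definition L2_scale (a : R[i]) (u : L2) : L2 := L2_class (a *: repr u).

Lemma L2_class_eq (f g : L2fun) :
  (L2_class f == L2_class g) = (f - g \in L2_null).
Proof. by rewrite (Quotient.idealrBE L2_null). Qed.

Lemma L2_null_scale a f : f \in L2_null -> a *: f \in L2_null.
Proof.
rewrite !inE => f0; apply: (@filterS _ _ (ae_filter_ringOfSetsType mu)) f0 => x.
by rewrite /= !fctE => ->; rewrite scaler0.
Qed.

Lemma L2_scaleE a f : L2_scale a (L2_class f) = L2_class (a *: f).
Proof.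
apply/eqP; rewrite L2_class_eq -scalerBr; apply: L2_null_scale.
by rewrite -L2_class_eq /L2_class reprK.
Qed.

Lemma L2_addE f g : L2_class f + L2_class g = L2_class (f + g).
Proof. by rewrite /L2_class !piE. Qed.

Lemma L2_repr (u : L2) : u = L2_class (repr u).
Proof. by rewrite /L2_class reprK. Qed.

Lemma L2_scalerA a b u : L2_scale a (L2_scale b u) = L2_scale (a * b) u.
Proof. by rewrite (L2_repr u) !L2_scaleE scalerA. Qed.

Lemma L2_scale1r : left_id 1 L2_scale.
Proof. by move=> u; rewrite {1}(L2_repr u) L2_scaleE scale1r -L2_repr. Qed.

Lemma L2_scalerDr : right_distributive L2_scale +%R.
Proof.
move=> a u v; rewrite (L2_repr u) (L2_repr v) L2_addE !L2_scaleE L2_addE.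
by rewrite scalerDr.
Qed.

Lemma L2_scalerDl u : {morph L2_scale^~ u : a b / a + b}.
Proof.
by move=> a b; rewrite (L2_repr u) !L2_scaleE L2_addE scalerDl.
Qed.

HB.instance Definition _ := GRing.Zmodule_isLmodule.Build R[i] L2
  L2_scalerA L2_scale1r L2_scalerDr L2_scalerDl.

Definition L2_fun (u : L2) : borel G -> R[i] := L2val (repr u).

Definition L2_dot (u v : L2) : R[i] := cprod mu (L2_fun u) (L2_fun v).

End L2.

Section Hilbert.
Context (R : realType) (H : lmodType R[i]) (dot : H -> H -> R[i]).
Implicit Types (T A S : H -> H) (v : H).

Definition hnorm v : R := Num.sqrt (complex.Re (dot v v)).

Definition hilbert_separable :=
  exists s : nat -> H, forall v (e : R), 0 < e -> exists n, hnorm (v - s n) < e.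

Definition bounded_op T := exists M : R, forall v, hnorm (T v) <= M * hnorm v.

Definition op_norm T : \bar R :=
  ereal_sup [set (hnorm (T v))%:E | v in [set v | hnorm v <= 1]].

Definition compact_op T :=
  forall x : nat -> H, (exists M : R, forall n, hnorm (x n) <= M) ->
  exists (k : nat -> nat) (y : H), {homo k : m n / (m < n)%N} /\
    hnorm (T (x (k n)) - y) @[n --> \oo] --> (0 : R).

Definition is_adjoint T S := forall u v, dot (T u) v = dot u (S v).

(* A = sqrt (T^* T) *)
Definition is_absolute_value T A :=
  [/\ linear A, bounded_op A, (forall v, 0 <= dot (A v) v) &
      exists S, is_adjoint T S /\ forall v, A (A v) = S (T v)].

Definition absolute_value T : H -> H := xget (idfun : H -> H) [set A | is_absolute_value T A].

Definition multiplicity A (l : R) : \bar R :=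
  ereal_sup [set (n%:R)%:E | n in [set n : nat | exists v : 'I_n -> H,
    (forall c : 'I_n -> R[i], \sum_(i < n) c i *: v i = 0 -> forall i, c i = 0) /\
    (forall i, A (v i) = (l%:C)%C *: v i)]].

(* The sum over the singular values runs over the positive eigenvalues of |T|, *)
(* each repeated according to its multiplicity.                                *)
Definition schatten_norm (p : \bar R) T : \bar R :=
  match p with
  | r%:E => (\esum_(l in [set l : R | (0 < l)%R])
               (multiplicity (absolute_value T) l * (l `^ r)%:E)) `^ r^-1
  | _ => op_norm T
  end%E.

Definition schatten_class (p : \bar R) T :=
  match p with
  | r%:E => compact_op T /\ (schatten_norm r%:E T < +oo)%E
  | _ => bounded_op T
  end.

End Hilbert.

Section Localization.
Context (R : realType) (G : topologicalGroupType).
Context (mu : {measure set (borel G) -> \bar R}) (K : set G).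
Context (phi0 : splus mu K).
Context (alpha : G -> G) (delta : R) (theta : L2 mu K).
Implicit Types f g : L2 mu K.

Definition stockwell_atom (t : G) (phi : splus_at phi0) (x : G) : R[i] :=
  ((Num.sqrt delta)%:C)%C * sval phi x * L2_fun theta (alpha (t^-1 * x)%g).

Definition stockwell f (t : G) (phi : splus_at phi0) : R[i] :=
  cprod mu (L2_fun f) (stockwell_atom t phi).

(* When L^2(G//K) is separable, mu and a Plancherel measure nu are             *)
(* sigma-finite, hence pi is the unique product measure; sigma-finiteness is   *)
(* not part of their types, so the library's [\x] does not apply directly.     *)
Definition product_measure (nu : {measure set (borel (splus_at phi0)) -> \bar R})
    (pi : {measure set (borel G * borel (splus_at phi0))%type -> \bar R}) :=
  forall (A : set (borel G)) (B : set (borel (splus_at phi0))),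
    measurable A -> measurable B -> pi (A `*` B) = (mu A * nu B)%E.

(* [T f] is the integral of u(t,phi) * S f(t,phi) * theta_(t,phi) against     *)
(* dt dphi in the weak sense, i.e. tested against each g in L^2(G//K).        *)
(* For p > 1 the integral need not converge pointwise in x, and the single    *)
(* atoms theta_(t,phi) need not be K-bi-invariant.                            *)
Definition is_localization
    (pi : {measure set (borel G * borel (splus_at phi0))%type -> \bar R})
    (u : borel G * borel (splus_at phi0) -> R[i]) (T : L2 mu K -> L2 mu K) :=
  forall f g,
    let h z := u z * stockwell f z.1 z.2 *
               cprod mu (stockwell_atom z.1 z.2) (L2_fun g) in
    cintegrable pi h /\ L2_dot (T f) g = cintegral pi h.

End Localization.

(* Main.v *)
Require Import Defs.
From HB Require Import structures.
From mathcomp Require Import all_boot all_order all_algebra.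
From mathcomp Require Import all_classical all_reals all_analysis measurable_realfun.
From mathcomp Require Import ess_sup_inf generic_quotient complex ring_quotient.
From mathcomp Require Import ring lra.

(** Write S f(t, phi) for the transform of f and H for L^2(G//K). Two estimates
    make the localization operator a Schatten operator: for each (t, phi) the
    functional f |-> S f(t, phi) has norm at most 1, and the integral of |S f|^2
    over G x S^+ is at most ||f||^2. Any linear map S from a separable Hilbert
    space to functions on a measure space Z with these two properties gives the
    conclusion; this is [frame_operator_schatten].

    For such an S and unit vectors f, g, the function w = |S f| |S g| is bounded
    by 1 and has integral at most 1, so Jensen's inequality for the weight w
    bounds the integral of |u| w by ||u||_p. Hence the form sending (f, g) to the
    integral of u (S f) (S g)^* is bounded, and the Riesz theorem turns it into an
    operator T. For p finite, T is compact by dominated convergence, because a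
    weakly null sequence f_n has S f_n -> 0 pointwise. The singular values are
    l_i = <T e_i, f_i> for eigenvectors e_i of |T| and f_i = T e_i / l_i, two
    orthonormal families; Jensen gives l_i^p <= \int |u|^p w_i with
    w_i = |S e_i| |S f_i|, and Bessel's inequality for the functional
    f |-> S f(z) gives \sum_i w_i(z) <= 1. Summing yields
    \sum_i l_i^p <= \int |u|^p ([singular_sum]). The same argument bounds the
    multiplicities, and |T| exists as a norm limit of polynomials in T^*T
    ([absolute_value_exists]).

    It remains to prove the two estimates. The first needs |phi| <= 1 for phi in
    S^+, as ||theta|| = 1: a positive-definite phi satisfies |phi| <= phi(1), and
    testing the character of phi on f * f with f >= 0 concentrated near K shows
    phi(1) <= 1 ([spherical_at1]). For the second, take f and theta bi-invariant,
    continuous and compactly supported. For fixed t the translated window enters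
    only through its orthogonal projection w on H, so S f(t, .) is the Fourier
    transform of f w^*; by the Plancherel theorem its square integral is at most
    that of f times the translated window ([windowed_section_sqint]). Integrating
    over t by Tonelli leaves \int |theta(alpha(t^-1 x))|^2 dt, which equals
    delta^-1 \int |theta|^2 because the Haar integral of a Gelfand pair is
    invariant under inversion on bi-invariant functions ([gelfand_inverse]); the
    factor delta^(1/2) of the window compensates. Density of these functions in H
    ([Cc_biinv_dense]) and Fatou's lemma give the general case ([windowed_sqint]).

    Measurability needs care, since the sigma-algebra on G x S^+ is generated by
    Borel rectangles and pi is only known on them. Expanding in an orthonormal
    basis writes S f(t, phi) as a series of products a_i(phi) b_i(t)
    ([windowed_expansion]); for compactly supported f and theta the transform then
    vanishes off a countable union of rectangles of finite measure, on which
    Tonelli's theorem applies ([product_rectangle]). *)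

Set Implicit Arguments.
Unset Strict Implicit.
Unset Printing Implicit Defensive.
Import Order.TTheory GRing.Theory Num.Theory numFieldNormedType.Exports.
Import Normc.
Local Open Scope classical_set_scope.
Local Open Scope ring_scope.

(** * Complex numbers *)

Section ComplexNumbers.
Context {R : realType}.
Implicit Types (z w : R[i]) (x y : R).

Lemma ReD z w : complex.Re (z + w) = complex.Re z + complex.Re w.
Proof. by case: z; case: w. Qed.

Lemma ImD z w : complex.Im (z + w) = complex.Im z + complex.Im w.
Proof. by case: z; case: w. Qed.

Lemma ReN z : complex.Re (- z) = - complex.Re z.
Proof. by case: z. Qed.

Lemma ImN z : complex.Im (- z) = - complex.Im z.
Proof. by case: z. Qed.

Lemma ReM z w : complex.Re (z * w) =
  complex.Re z * complex.Re w - complex.Im z * complex.Im w.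
Proof. by case: z; case: w. Qed.

Lemma ImM z w : complex.Im (z * w) =
  complex.Re z * complex.Im w + complex.Im z * complex.Re w.
Proof. by case: z; case: w. Qed.

Lemma ReJ z : complex.Re z^* = complex.Re z.
Proof. by case: z. Qed.

Lemma ImJ z : complex.Im z^* = - complex.Im z.
Proof. by case: z. Qed.

Lemma conjCD z w : (z + w)^* = z^* + w^*.
Proof. exact: rmorphD. Qed.

Lemma conjCN z : (- z)^* = - z^*.
Proof. exact: rmorphN. Qed.

Lemma conjCB z w : (z - w)^* = z^* - w^*.
Proof. exact: rmorphB. Qed.

Lemma conjCM z w : (z * w)^* = z^* * w^*.
Proof. exact: rmorphM. Qed.

Lemma conjCR x : ((x%:C)%C)^* = (x%:C)%C.
Proof. exact: conjc_real. Qed.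

Lemma conjC_sum I (r : seq I) (P : pred I) (F : I -> R[i]) :
  (\sum_(i <- r | P i) F i)^* = \sum_(i <- r | P i) (F i)^*.
Proof. exact: rmorph_sum. Qed.

Lemma conj_complex0 : (0 : R[i])^* = 0.
Proof. exact: rmorph0. Qed.

Lemma realCD x y : ((x + y)%:C)%C = (x%:C + y%:C)%C.
Proof. exact: rmorphD. Qed.

Lemma realCB x y : ((x - y)%:C)%C = (x%:C - y%:C)%C.
Proof. exact: rmorphB. Qed.

Lemma realCM x y : ((x * y)%:C)%C = (x%:C * y%:C)%C.
Proof. exact: rmorphM. Qed.

Lemma halfC : (2^-1 : R[i]) = ((2^-1 : R)%:C)%C.
Proof. by rewrite fmorphV rmorph_nat. Qed.

Lemma complex_eqP z w :
  complex.Re z = complex.Re w -> complex.Im z = complex.Im w -> z = w.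
Proof. by case: z w => a b [c d] /= -> ->. Qed.

Lemma normc_sq z : normc z ^+ 2 = complex.Re z ^+ 2 + complex.Im z ^+ 2.
Proof. by case: z => a b; rewrite /= sqr_sqrtr// addr_ge0// sqr_ge0. Qed.

Lemma normc_conj z : normc z^* = normc z.
Proof. by case: z => a b; rewrite /= sqrrN. Qed.

Lemma normc_real x : normc (x%:C)%C = `|x|.
Proof. by rewrite /= expr0n/= addr0 sqrtr_sqr. Qed.

Lemma mulcJ z : z * z^* = ((normc z ^+ 2)%:C)%C.
Proof.
rewrite normc_sq; apply: complex_eqP; rewrite ?ReM ?ImM ?ReJ ?ImJ/=; ring.
Qed.

Lemma ler_Re_normc z : `|complex.Re z| <= normc z.
Proof.
by case: z => a b; rewrite -sqrtr_sqr/= ler_wsqrtr// lerDl sqr_ge0.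
Qed.

Lemma ler_Im_normc z : `|complex.Im z| <= normc z.
Proof.
by case: z => a b; rewrite -sqrtr_sqr/= ler_wsqrtr// lerDr sqr_ge0.
Qed.

Lemma normc_le_ReIm z : normc z <= `|complex.Re z| + `|complex.Im z|.
Proof.
rewrite -(ler_pXn2r (n := 2))// ?nnegrE ?normc_ge0 ?addr_ge0//.
rewrite normc_sq sqrrD !real_normK ?num_real// -addrA lerD2l.
by rewrite lerDr mulrn_wge0// mulr_ge0.
Qed.

Lemma ler_normc_dist z w : `|normc z - normc w| <= normc (z - w).
Proof.
have h (a b : R[i]) : normc a - normc b <= normc (a - b).
  by rewrite lerBlDr -{1}(subrK b a) le_normcD.
rewrite ler_norml h andbT lerNl opprB -[leRHS]normcN opprB.
exact: h.
Qed.

Lemma normc_sum I (r : seq I) (P : pred I) (F : I -> R[i]) :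
  normc (\sum_(i <- r | P i) F i) <= \sum_(i <- r | P i) normc (F i).
Proof.
elim/big_ind2 : _ => [|a x b y ax bY|]; rewrite ?normc0//.
by rewrite (le_trans (le_normcD _ _))// lerD.
Qed.

Lemma ReZ x z : complex.Re ((x%:C)%C * z) = x * complex.Re z.
Proof. by rewrite ReM/= mul0r subr0. Qed.

Lemma Re_sum I (r : seq I) (P : pred I) (F : I -> R[i]) :
  complex.Re (\sum_(i <- r | P i) F i) = \sum_(i <- r | P i) complex.Re (F i).
Proof. by apply: (big_morph _ ReD). Qed.

Lemma cvg_sumr (I : Type) (r : seq I) (f : I -> nat -> R) (l : I -> R) :
  (forall i, f i n @[n --> \oo] --> l i) ->
  (\sum_(i <- r) f i n) @[n --> \oo] --> \sum_(i <- r) l i.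
Proof.
move=> fl; elim: r => [|i r IHr].
  by under eq_fun do rewrite big_nil; rewrite big_nil; exact: cvg_cst.
by under eq_fun do rewrite big_cons; rewrite big_cons; apply: cvgD.
Qed.

End ComplexNumbers.

(** * Hilbert spaces *)

Record hilbert_axioms (R : realType) (H : lmodType R[i]) (dot : H -> H -> R[i])
    : Prop := HilbertAxioms {
  dot_linear : forall a u v w, dot (a *: u + v) w = a * dot u w + dot v w ;
  dotC : forall u v, dot v u = (dot u v)^* ;
  dot_ge0 : forall v, 0 <= dot v v ;
  dot_eq0 : forall v, dot v v = 0 -> v = 0 ;
  dot_complete : forall x : nat -> H,
    (forall e : R, 0 < e -> exists N, forall m n, (N <= m)%N -> (N <= n)%N ->
       hnorm dot (x m - x n) < e) ->
    exists y, hnorm dot (x n - y) @[n --> \oo] --> (0 : R) ;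
  dot_separable : hilbert_separable dot }.

Section InnerProduct.
Context (R : realType) (H : lmodType R[i]) (dot : H -> H -> R[i]).
Hypothesis hH : hilbert_axioms dot.
Local Notation nrm := (hnorm dot).
Local Notation "x %:C" := ((x%:C)%C).
Implicit Types (u v w : H) (a : R[i]).

Lemma dot0l w : dot 0 w = 0.
Proof.
by have := dot_linear hH (-1) 0 0 w; rewrite scaler0 addr0 mulN1r addNr.
Qed.

Lemma dotDl u v w : dot (u + v) w = dot u w + dot v w.
Proof. by have := dot_linear hH 1 u v w; rewrite scale1r mul1r. Qed.

Lemma dotZl a u w : dot (a *: u) w = a * dot u w.
Proof. by have := dot_linear hH a u 0 w; rewrite addr0 dot0l addr0. Qed.

Lemma dotNl u w : dot (- u) w = - dot u w.
Proof. by rewrite -scaleN1r dotZl mulN1r. Qed.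

Lemma dotBl u v w : dot (u - v) w = dot u w - dot v w.
Proof. by rewrite dotDl dotNl. Qed.

Lemma dot_suml I (r : seq I) (P : pred I) (F : I -> H) w :
  dot (\sum_(i <- r | P i) F i) w = \sum_(i <- r | P i) dot (F i) w.
Proof. by apply: (big_morph (dot^~ w)) => [u v|]; rewrite ?dotDl ?dot0l. Qed.

Lemma dotZr a u w : dot u (a *: w) = a^* * dot u w.
Proof. by rewrite (dotC hH) dotZl conjCM -(dotC hH). Qed.

Lemma dotDr u v w : dot u (v + w) = dot u v + dot u w.
Proof. by rewrite (dotC hH) dotDl conjCD -!(dotC hH). Qed.

Lemma dotNr u w : dot u (- w) = - dot u w.
Proof. by rewrite (dotC hH) dotNl conjCN -(dotC hH). Qed.

Lemma dotBr u v w : dot u (v - w) = dot u v - dot u w.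
Proof. by rewrite dotDr dotNr. Qed.

Lemma dot_sumr I (r : seq I) (P : pred I) (F : I -> H) w :
  dot w (\sum_(i <- r | P i) F i) = \sum_(i <- r | P i) dot w (F i).
Proof.
rewrite (dotC hH) dot_suml conjC_sum; apply: eq_bigr => i _.
by rewrite -(dotC hH).
Qed.

Lemma dot0r w : dot w 0 = 0.
Proof. by rewrite (dotC hH) dot0l conj_complex0. Qed.

Lemma nrm_ge0 v : 0 <= nrm v.
Proof. exact: sqrtr_ge0. Qed.

Lemma Re_dot_ge0 v : 0 <= complex.Re (dot v v).
Proof. by have := dot_ge0 hH v; rewrite lecE => /andP[]. Qed.

Lemma nrm_sq v : nrm v ^+ 2 = complex.Re (dot v v).
Proof. by rewrite sqr_sqrtr// Re_dot_ge0. Qed.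

Lemma dot_nrm v : dot v v = (nrm v ^+ 2)%:C.
Proof.
rewrite nrm_sq; apply: complex_eqP => //=.
by have := dot_ge0 hH v; rewrite lecE => /andP[/eqP].
Qed.

Lemma nrm_eq0 v : nrm v = 0 -> v = 0.
Proof. by move=> v0; apply: (dot_eq0 hH); rewrite dot_nrm v0 expr0n. Qed.

Lemma nrm0 : nrm 0 = 0.
Proof. by rewrite /hnorm dot0l sqrtr0. Qed.

Lemma nrmZ a v : nrm (a *: v) = normc a * nrm v.
Proof.
apply/eqP; rewrite -(eqrXn2 (n := 2))// ?nrm_ge0 ?mulr_ge0 ?normc_ge0 ?nrm_ge0//.
by rewrite nrm_sq dotZl dotZr mulrA mulcJ dot_nrm ReZ/= exprMn eqxx.
Qed.

Lemma nrmN v : nrm (- v) = nrm v.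
Proof. by rewrite /hnorm dotNl dotNr opprK. Qed.

Lemma nrmBC u v : nrm (u - v) = nrm (v - u).
Proof. by rewrite -nrmN opprB. Qed.

(** Expanding the square norm of |v|^2 u - <u, v> v, which is non-negative. *)
Lemma cauchy_schwarz u v : normc (dot u v) <= nrm u * nrm v.
Proof.
have [v0|vN0] := eqVneq (nrm v) 0.
  by rewrite (nrm_eq0 v0) dot0r nrm0 mulr0 normc0.
have v0 : 0 < nrm v by rewrite lt_def vN0 nrm_ge0.
pose w := (nrm v ^+ 2)%:C *: u - dot u v *: v.
have : 0 <= complex.Re (dot w w) by exact: Re_dot_ge0.
have -> : dot w w = ((nrm v ^+ 2) * (nrm v ^+ 2 * nrm u ^+ 2 - normc (dot u v) ^+ 2))%:C.
  rewrite /w dotBl !dotBr !dotZl !dotZr (dotC hH u v) (dot_nrm u) (dot_nrm v).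
  rewrite conjCR [in RHS]realCM realCB realCM -mulcJ.
  ring.
rewrite pmulr_rge0 ?exprn_gt0// subr_ge0 -exprMn => h.
by rewrite -(ler_pXn2r (n := 2))// ?nnegrE ?normc_ge0 ?mulr_ge0 ?nrm_ge0// mulrC.
Qed.

Lemma nrm_sqD u v : nrm (u + v) ^+ 2 =
  nrm u ^+ 2 + 2 * complex.Re (dot u v) + nrm v ^+ 2.
Proof.
by rewrite !nrm_sq dotDl !dotDr !ReD (dotC hH u v) ReJ; ring.
Qed.

Lemma ler_nrmD u v : nrm (u + v) <= nrm u + nrm v.
Proof.
rewrite -(ler_pXn2r (n := 2))// ?nnegrE ?addr_ge0 ?nrm_ge0// nrm_sqD sqrrD.
rewrite lerD2r lerD2l mulrC mulr_natr lerMn2r/=.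
apply: le_trans (cauchy_schwarz u v); apply: le_trans (ler_Re_normc _).
exact: ler_norm.
Qed.

Lemma ler_nrmB u v w : nrm (u - w) <= nrm (u - v) + nrm (v - w).
Proof. by rewrite (le_trans _ (ler_nrmD _ _))// addrA subrK. Qed.

Lemma dot_ext u v : (forall w, dot u w = dot v w) -> u = v.
Proof.
move=> uv; apply/eqP; rewrite -subr_eq0; apply/eqP/(dot_eq0 hH).
by rewrite dotBl uv subrr.
Qed.

End InnerProduct.

(** * Orthonormal sequences *)

Section Orthonormal.
Context (R : realType) (H : lmodType R[i]) (dot : H -> H -> R[i]).
Hypothesis hH : hilbert_axioms dot.
Local Notation nrm := (hnorm dot).
Local Notation "x %:C" := ((x%:C)%C).
Implicit Types (u v w : H) (a : R[i]).

(** Zero vectors are allowed, so that Gram-Schmidt never has to reindex and a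
    finite-dimensional space also has an orthonormal sequence. *)
Definition orthonormal0 (I : eqType) (e : I -> H) :=
  forall i j, dot (e i) (e j) = ((i == j) && (e i != 0))%:R.

Definition partial_proj (e : nat -> H) n v := \sum_(k < n) dot v (e k) *: e k.

Lemma dot_lin_comb (I : finType) (e : I -> H) (c : I -> R[i]) i :
  orthonormal0 e -> dot (\sum_j c j *: e j) (e i) = c i * (e i != 0)%:R.
Proof.
move=> eo; rewrite dot_suml// (bigD1 i)//= dotZl// eo eqxx andTb big1 ?addr0//.
by move=> j ji; rewrite dotZl// eo (negbTE ji) mulr0.
Qed.

Lemma nrm_lin_comb (I : finType) (e : I -> H) (c : I -> R[i]) :
  orthonormal0 e ->
  nrm (\sum_j c j *: e j) ^+ 2 = \sum_j normc (c j) ^+ 2 * (e j != 0)%:R.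
Proof.
move=> eo; rewrite nrm_sq// dot_sumr// Re_sum; apply: eq_bigr => i _.
rewrite dotZr// dot_lin_comb// mulrA [X in complex.Re (X * _)]mulrC mulcJ.
by rewrite ReZ; case: (e i == 0).
Qed.

Lemma orthonormal0_ord (e : nat -> H) n :
  orthonormal0 e -> orthonormal0 (fun i : 'I_n => e i).
Proof. by move=> eo i j; rewrite eo. Qed.

(** For w the combination of the e_i with coefficients (l e_i)^*, both l w and
    |w|^2 are the sum of squares on the left. *)
Lemma bessel (I : finType) (e : I -> H) (l : H -> R[i]) (M : R) :
  orthonormal0 e -> 0 <= M -> linear l ->
  (forall v, normc (l v) <= M * nrm v) ->
  \sum_i normc (l (e i)) ^+ 2 <= M ^+ 2.
Proof.
move=> eo M0 lin lM; set s := \sum_i _.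
have s0 : 0 <= s by apply: sumr_ge0 => i _; exact: sqr_ge0.
have l0 : l 0 = 0.
  by have := lin (-1) 0 0; rewrite !scaler0 addr0 scaleN1r addNr.
pose w := \sum_i (l (e i))^* *: e i.
have lw : l w = s%:C.
  have -> : l w = \sum_i l ((l (e i))^* *: e i).
    rewrite /w; apply: (big_morph l) => // x y.
    by have := lin 1 x y; rewrite !scale1r.
  rewrite rmorph_sum/=; apply: eq_bigr => i _.
  have := lin (l (e i))^* (e i) 0; rewrite addr0 l0 addr0 => ->.
  exact: etrans (mulrC _ _) (mulcJ _).
have nw : nrm w ^+ 2 = s.
  rewrite nrm_lin_comb//; apply: eq_bigr => i _; rewrite normc_conj.
  by case: eqVneq => [->|_]; rewrite ?l0 ?normc0 ?expr0n ?mulr1 ?mulr0.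
have := lM w; rewrite lw normc_real ger0_norm// -nw => h.
have := nrm_ge0 dot w; rewrite le_eqVlt => /orP[/eqP<-|w0].
  by rewrite expr0n sqr_ge0.
by move: h; rewrite [X in X <= _]expr2 ler_pM2r// => h; rewrite lerXn2r ?nnegrE// ltW.
Qed.

Lemma linear_dot w : linear (fun v => dot v w : R[i]^o).
Proof. by move=> a u v; rewrite (dot_linear hH). Qed.

Lemma bessel_dot (I : finType) (e : I -> H) w : orthonormal0 e ->
  \sum_i normc (dot (e i) w) ^+ 2 <= nrm w ^+ 2.
Proof.
move=> eo; apply: (bessel (l := fun v => dot v w) eo (nrm_ge0 dot w)) => [|v].
  exact: linear_dot.
by rewrite mulrC cauchy_schwarz.
Qed.

Section Projection.
Context (e : nat -> H).
Hypothesis eo : orthonormal0 e.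

Lemma proj_is_linear n a u v : partial_proj e n (a *: u + v) = a *: partial_proj e n u + partial_proj e n v.
Proof.
rewrite /partial_proj scaler_sumr -big_split; apply: eq_bigr => i _.
by rewrite (dot_linear hH) scalerDl scalerA.
Qed.

Lemma dot_proj n v k : (k < n)%N -> dot (v - partial_proj e n v) (e k) = 0.
Proof.
move=> kn; rewrite dotBl//.
rewrite (dot_lin_comb (fun j : 'I_n => dot v (e j)) (Ordinal kn) (orthonormal0_ord eo)).
by case: eqVneq => [->|_] /=; rewrite ?(dot0r hH) ?mul0r ?mulr1 subrr.
Qed.

Lemma dot_proj_proj n v w : dot (v - partial_proj e n v) (partial_proj e n w) = 0.
Proof.
rewrite dot_sumr// big1// => i _; rewrite dotZr// dot_proj ?mulr0//.
Qed.

Lemma pythagoras n v :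
  nrm v ^+ 2 = nrm (partial_proj e n v) ^+ 2 + nrm (v - partial_proj e n v) ^+ 2.
Proof.
have := nrm_sqD hH (v - partial_proj e n v) (partial_proj e n v).
by rewrite subrK dot_proj_proj mulr0 addr0 addrC.
Qed.

Lemma proj_contraction n v : nrm (v - partial_proj e n v) <= nrm v.
Proof.
rewrite -(ler_pXn2r (n := 2))// ?nnegrE ?nrm_ge0//.
by rewrite [leRHS](pythagoras n v) lerDr sqr_ge0.
Qed.

(** Completeness: the norm of a block of the series is a block of the
    convergent series of squares. *)
Lemma orthonormal_series (c : nat -> R[i]) (B : R) :
  (forall n, \sum_(k < n) normc (c k) ^+ 2 <= B) ->
  exists y, nrm (\sum_(k < n) c k *: e k - y) @[n --> \oo] --> (0 : R).
Proof.
move=> cB; apply: (dot_complete hH) => eps eps0.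
pose S n := \sum_(k < n) normc (c k) ^+ 2.
have ndS : nondecreasing_seq S.
  apply/nondecreasing_seqP => n; rewrite /S big_ord_recr/= lerDl; exact: sqr_ge0.
have cS : cvgn S.
  by apply: nondecreasing_is_cvgn => //; exists B => _ [n _ <-]; exact: cB.
have e20 : 0 < eps ^+ 2 by rewrite exprn_gt0.
have /cvgrPdist_lt/(_ (eps ^+ 2) e20) [N _ hN] := cS.
exists N.
have key m n : (N <= m)%N -> (m <= n)%N ->
    nrm (\sum_(k < n) c k *: e k - \sum_(k < m) c k *: e k) < eps.
  move=> Nm mn.
  rewrite -(ltr_pXn2r (n := 2))// ?nnegrE ?nrm_ge0// ?(ltW eps0)//.
  have -> : \sum_(k < n) c k *: e k - \sum_(k < m) c k *: e k =
      \sum_(k < n) (if (k < m)%N then 0 else c k) *: e k.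
    rewrite -(subnKC mn) !big_split_ord/= addrAC subrr add0r.
    rewrite [X in _ = X + _]big1 ?add0r => [|i _]; last first.
      by rewrite ltn_ord scale0r.
    by apply: eq_bigr => i _; rewrite ltnNge leq_addr.
  rewrite nrm_lin_comb; last exact: orthonormal0_ord.
  apply: (@le_lt_trans _ _ (S n - S m)); last first.
    apply: (@le_lt_trans _ _ (limn S - S m)).
      by rewrite lerD2r; exact: nondecreasing_cvgn_le.
    by apply: le_lt_trans (hN m Nm); rewrite ler_norm.
  rewrite /S -(subnKC mn) !big_split_ord/= addrAC subrr add0r.
  rewrite [X in X + _]big1 ?add0r => [|i _]; last first.
    by rewrite ltn_ord normc0 expr0n mul0r.
  apply: ler_sum => i _; rewrite ltnNge leq_addr/=.
  by rewrite ler_piMr ?sqr_ge0//; case: (_ == _).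
move=> m n Nm Nn; case: (leqP m n) => [mn|/ltnW nm]; last exact: key.
by rewrite nrmBC//; exact: key.
Qed.

End Projection.

End Orthonormal.

(** * Orthonormal bases *)

Section Basis.
Context (R : realType) (H : lmodType R[i]) (dot : H -> H -> R[i]).
Hypothesis hH : hilbert_axioms dot.
Local Notation nrm := (hnorm dot).
Local Notation "x %:C" := ((x%:C)%C).
Implicit Types (u v w : H) (a : R[i]).

Lemma nrm_cvg_dot (x : nat -> H) y w :
  nrm (x n - y) @[n --> \oo] --> (0 : R) ->
  normc (dot (x n) w - dot y w) @[n --> \oo] --> (0 : R).
Proof.
move=> xy; apply: (@squeeze_cvgr _ _ _ _ (cst 0) (fun n => nrm (x n - y) * nrm w)).
- by apply: nearW => n; rewrite normc_ge0/= -(dotBl hH) cauchy_schwarz.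
- exact: cvg_cst.
- by rewrite -(mul0r (nrm w)); apply: cvgMl.
Qed.

Lemma cvg_normc_unique (z : nat -> R[i]) (a b : R[i]) :
  normc (z n - a) @[n --> \oo] --> (0 : R) ->
  normc (z n - b) @[n --> \oo] --> (0 : R) -> a = b.
Proof.
move=> za zb; apply/eqP; rewrite -subr_eq0; apply/eqP/eq0_normc.
apply/eqP; rewrite eq_le normc_ge0 andbT.
have h : (normc (z n - a) + normc (z n - b)) @[n --> \oo] --> (0 : R).
  by rewrite -[X in _ --> X](addr0 0); exact: cvgD.
apply: (ler_cvg_to (cvg_cst _) h); apply: nearW => n /=.
rewrite (_ : a - b = (z n - b) - (z n - a)); last by ring.
by rewrite (le_trans (le_normcD _ _))// [leRHS]addrC lerD2l normcN.
Qed.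

Section GramSchmidt.
Context (s : nat -> H).

Definition normalize v := ((nrm v)^-1)%:C *: v.

(** [gs n] holds the first n vectors and is 0 afterwards, so that each new vector
    can refer to all previous ones. *)
Fixpoint gs n : nat -> H :=
  if n isn't n'.+1 then fun=> 0 else
  fun k => if k == n' then normalize (s n' - partial_proj dot (gs n') n' (s n')) else gs n' k.

Definition gram_schmidt n := gs n.+1 n.

Lemma gsE n k : (k < n)%N -> gs n k = gram_schmidt k.
Proof.
elim: n k => // n IHn k; rewrite ltnS leq_eqVlt => /orP[/eqP->//|kn].
by rewrite /= ltn_eqF// IHn.
Qed.

Lemma gram_schmidtE n : gram_schmidt n =
  normalize (s n - partial_proj dot gram_schmidt n (s n)).
Proof.
rewrite {1}/gram_schmidt /= eqxx; congr (normalize (_ - _)).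
by apply: eq_bigr => i _; rewrite gsE.
Qed.

Lemma normalize0 : normalize 0 = 0.
Proof. by rewrite /normalize scaler0. Qed.

Lemma dot_normalize v : dot (normalize v) (normalize v) = (normalize v != 0)%:R.
Proof.
have [->|v0] := eqVneq v 0; first by rewrite normalize0 (dot0l hH) eqxx.
have n0 : nrm v != 0 by apply: contra_neq v0; exact: nrm_eq0.
rewrite (_ : normalize v != 0); last first.
  by rewrite scaler_eq0 negb_or v0 andbT (inj_eq (@complexI R) _ 0) invr_eq0.
rewrite (dot_nrm hH) (nrmZ hH) normc_real ger0_norm ?invr_ge0 ?nrm_ge0//.
by rewrite mulVf// expr1n.
Qed.

Lemma gram_schmidt_orthonormal : orthonormal0 dot gram_schmidt.
Proof.
have main n : forall i j, (i < n)%N -> (j < n)%N ->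
    dot (gram_schmidt i) (gram_schmidt j) = ((i == j) && (gram_schmidt i != 0))%:R.
  elim: n => // n IHn.
  have key i : (i < n)%N -> dot (gram_schmidt n) (gram_schmidt i) = 0.
    move=> ni; rewrite gram_schmidtE (dotZl hH).
    rewrite (dotBl hH) (dot_suml hH) (bigD1 (Ordinal ni))//= (dotZl hH) IHn//.
    rewrite eqxx/= big1 ?addr0; last first.
      move=> j jni; rewrite (dotZl hH) IHn// (_ : (j == i :> nat) = false) ?mulr0//.
      by apply: contraNF jni => /eqP ji; apply/eqP/val_inj.
    by have [->|_] := eqVneq (gram_schmidt i) 0;
      rewrite ?(dot0r hH) ?mulr1 ?mul0r subrr mulr0.
  move=> i j; rewrite !ltnS leq_eqVlt [(j <= n)%N]leq_eqVlt.
  move=> /orP[/eqP->|ni] /orP[/eqP->|nj].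
  - by rewrite eqxx [in LHS]gram_schmidtE dot_normalize -gram_schmidtE.
  - by rewrite key// gtn_eqF.
  - by rewrite (dotC hH) key// conj_complex0 ltn_eqF.
  - exact: IHn.
move=> i j; apply: (main (maxn i j).+1); rewrite ltnS ?leq_maxl ?leq_maxr//.
Qed.

(** The n.+1-st projection fixes s n by construction; later ones are only closer
    by Pythagoras, hence fix it too. *)
Lemma gram_schmidt_span n m : (n < m)%N -> partial_proj dot gram_schmidt m (s n) = s n.
Proof.
have eo := gram_schmidt_orthonormal.
have key : partial_proj dot gram_schmidt n.+1 (s n) = s n.
  have [h|h] := eqVneq (s n - partial_proj dot gram_schmidt n (s n)) 0.
    rewrite /partial_proj big_ord_recr/= -/(partial_proj _ _ _ _) gram_schmidtE h normalize0.
    by rewrite scaler0 addr0; apply/esym/eqP; rewrite -subr_eq0 h.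
  set v := s n - partial_proj dot gram_schmidt n (s n) in h.
  have nv : nrm v != 0 by apply: contra_neq h; exact: nrm_eq0.
  rewrite /partial_proj big_ord_recr/= -/(partial_proj _ _ _ _).
  have -> : dot (s n) (gram_schmidt n) = (nrm v)%:C.
    have -> : s n = v + partial_proj dot gram_schmidt n (s n) by rewrite subrK.
    rewrite (dotDl hH) [X in _ + X](_ : _ = 0) ?addr0.
      rewrite gram_schmidtE -/v (dotZr hH) conjCR (dot_nrm hH) -realCM.
      by rewrite expr2 mulKf.
    rewrite (dot_suml hH) big1// => i _.
    by rewrite (dotZl hH) eo ltn_eqF// mulr0.
  rewrite gram_schmidtE -/v scalerA -realCM divff// scale1r.
  by rewrite addrC subrK.
move=> nm; have := pythagoras hH eo n.+1 (s n).
have : nrm (s n - partial_proj dot gram_schmidt m (s n)) ^+ 2 <=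
       nrm (s n - partial_proj dot gram_schmidt n.+1 (s n)) ^+ 2.
  have hm := pythagoras hH eo m (s n); have hn := pythagoras hH eo n.+1 (s n).
  rewrite -(lerD2l (nrm (partial_proj dot gram_schmidt m (s n)) ^+ 2)) -hm hn lerD2r.
  rewrite !(nrm_lin_comb hH); [|exact: orthonormal0_ord..].
  rewrite -(subnKC nm) [leRHS]big_split_ord/= lerDl; apply: sumr_ge0 => i _.
  by rewrite mulr_ge0 ?sqr_ge0.
rewrite key subrr (nrm0 hH) expr0n/= => h _.
apply/esym/eqP; rewrite -subr_eq0; apply/eqP/(nrm_eq0 hH)/eqP.
by rewrite -sqrf_eq0 eq_le h sqr_ge0.
Qed.

End GramSchmidt.

(** Gram-Schmidt on a dense sequence: projections are contractions that
    eventually fix each member of the dense sequence. *)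
Lemma orthonormal_basis : exists e : nat -> H, orthonormal0 dot e /\
  forall v, nrm (v - partial_proj dot e n v) @[n --> \oo] --> (0 : R).
Proof.
have [s sd] := dot_separable hH.
exists (gram_schmidt s); split; first exact: gram_schmidt_orthonormal.
move=> v; apply/cvgr0Pnorm_lt => eps eps0; have [n hn] := sd v eps eps0.
exists n.+1 => // m /= nm; rewrite ger0_norm ?nrm_ge0//.
apply: le_lt_trans hn; rewrite -[in leLHS](subrK (s n) v).
have -> : v - s n + s n - partial_proj dot (gram_schmidt s) m (v - s n + s n) =
   (v - s n) - partial_proj dot (gram_schmidt s) m (v - s n).
  have -> : v - s n + s n = 1 *: (v - s n) + s n by rewrite scale1r.
  rewrite (proj_is_linear hH) gram_schmidt_span// !scale1r opprD.
  by rewrite [- _ - _]addrC addrA addrK.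
by apply: (proj_contraction hH); exact: gram_schmidt_orthonormal.
Qed.

End Basis.

(** * Riesz representation and weak compactness *)

Section Riesz.
Context (R : realType) (H : lmodType R[i]) (dot : H -> H -> R[i]).
Hypothesis hH : hilbert_axioms dot.
Local Notation nrm := (hnorm dot).
Implicit Types (u v w : H) (a : R[i]).

(** The representing vector is the series of the (l e_k)^* e_k over an
    orthonormal basis; Bessel's inequality makes it converge. *)
Lemma riesz (l : H -> R[i]) (M : R) : linear l -> 0 <= M ->
  (forall v, normc (l v) <= M * nrm v) -> exists w, forall v, l v = dot v w.
Proof.
move=> lin M0 lM; have [e [eo eb]] := orthonormal_basis hH.
have [w ww] : exists w, nrm (\sum_(k < n) (l (e k))^* *: e k - w) @[n --> \oo] --> (0 : R).
  apply: (orthonormal_series hH eo (c := fun k => (l (e k))^*) (B := M ^+ 2)) => n.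
  under eq_bigr do rewrite normc_conj.
  exact: (bessel hH (orthonormal0_ord (n := n) eo) M0 lin lM).
exists w => v; have lB x y : l (x - y) = l x - l y.
  by rewrite [x - y]addrC -(scaleN1r y) lin scaleN1r addrC.
have lp n : l (partial_proj dot e n v) = dot v (\sum_(k < n) (l (e k))^* *: e k).
  rewrite (dot_sumr hH); rewrite /partial_proj.
  have l0 : l 0 = 0 by have := lB 0 0; rewrite !subrr.
  rewrite (big_morph l (op1 := +%R) (id1 := 0)) => [||//].
    apply: eq_bigr => i _; rewrite (dotZr hH) conjCK.
    by have := lin (dot v (e i)) (e i) 0; rewrite addr0 l0 addr0 => ->; rewrite mulrC.
  by move=> x y; have := lin 1 x y; rewrite !scale1r.
apply: (@cvg_normc_unique _ (fun n => l (partial_proj dot e n v))).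
- apply: (@squeeze_cvgr _ _ _ _ (cst 0) (fun n => M * nrm (v - partial_proj dot e n v))).
  + by apply: nearW => n; rewrite normc_ge0/= -lB (le_trans (lM _))// nrmBC.
  + exact: cvg_cst.
  + by rewrite -(mulr0 M); apply: cvgMr; exact: eb.
- have := nrm_cvg_dot hH v ww; apply: cvg_trans; apply: near_eq_cvg.
  apply: nearW => n; rewrite lp -(dotBr hH) -(dotBl hH).
  by rewrite [dot v _](dotC hH) normc_conj.
Qed.

(** Truncate v to finitely many coordinates; boundedness of the sequence
    controls the rest. *)
Lemma weak_cvg_basis (e : nat -> H) (x : nat -> H) (M : R) :
  (forall v, nrm (v - partial_proj dot e n v) @[n --> \oo] --> (0 : R)) ->
  (forall n, nrm (x n) <= M) ->
  (forall i, normc (dot (x n) (e i)) @[n --> \oo] --> (0 : R)) ->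
  forall v, normc (dot (x n) v) @[n --> \oo] --> (0 : R).
Proof.
move=> eb xM xe v; apply/cvgr0Pnorm_lt => eps eps0.
have M0 : 0 <= M by apply: le_trans (xM 0%N); exact: nrm_ge0.
have M1 : 0 < M + 1 by rewrite ltr_wpDl.
have d0 : 0 < eps / 2 / (M + 1) by rewrite divr_gt0// divr_gt0.
have /cvgr0Pnorm_lt/(_ _ d0)[N _ hN] := eb v.
have := hN N (leqnn N); rewrite ger0_norm ?nrm_ge0// => vN.
have : (\sum_(k < N) normc (dot v (e k)) * normc (dot (x n) (e k))) @[n --> \oo]
    --> (0 : R).
  rewrite [X in _ --> X](_ : _ = \sum_(k < N) (normc (dot v (e k)) * 0)); last first.
    by rewrite big1// => i _; rewrite mulr0.
  by apply: cvg_sumr => i; apply: cvgMr; exact: xe.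
move=> /cvgr0Pnorm_lt/(_ (eps / 2)); rewrite divr_gt0// => /(_ isT) [N' _ hN'].
exists N' => // n /= Nn; rewrite ger0_norm ?normc_ge0//.
have := hN' n Nn; rewrite ger0_norm; last first.
  by apply: sumr_ge0 => i _; rewrite mulr_ge0 ?normc_ge0.
move=> h; rewrite -(subrK (partial_proj dot e N v) v) (dotDr hH).
apply: le_lt_trans (le_normcD _ _) _; rewrite [ltRHS]splitr.
apply: ltr_leD; last first.
  apply: le_trans (ltW h); rewrite /partial_proj (dot_sumr hH).
  apply: le_trans (normc_sum _ _ _) _; apply: ler_sum => i _.
  by rewrite (dotZr hH) normcM normc_conj.
apply: le_lt_trans (cauchy_schwarz hH _ _) _.
apply: (@le_lt_trans _ _ ((M + 1) * nrm (v - partial_proj dot e N v))).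
  by rewrite ler_wpM2r ?nrm_ge0// (le_trans (xM n))// lerDl.
by rewrite mulrC -ltr_pdivlMr.
Qed.

(** Tychonoff gives a cluster point of the sequence in the compact product of
    the intervals; indices with n-th error below 1/n on the first n coordinates are
    then chosen increasingly. *)
Lemma cluster_subseq (f : nat -> nat * bool -> R) (M : R) :
  (forall n i, `|f n i| <= M) ->
  exists (c : nat * bool -> R) (k : nat -> nat), {homo k : m n / (m < n)%N} /\
    forall i, f (k n) i @[n --> \oo] --> c i.
Proof.
move=> fM.
have := @tychonoff (nat * bool)%type (fun=> R : topologicalType) (fun=> `[-M, M]%classic).
have cI : nat * bool -> compact `[-M, M]%classic by move=> _; exact: segment_compact.
move=> /(_ cI) /(_ (f @ \oo) _) [].
  by exists 0%N => // n _ /= i; rewrite in_itv/= -ler_norml fM.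
move=> c [_ cf].
have pick J N : exists n, (N < n)%N /\
    forall i : 'I_J, forall b, `|c (val i, b) - f n (val i, b)| < J.+1%:R^-1.
  have FN : (f @ \oo) [set g | exists2 n, (N < n)%N & g = f n].
    by exists N.+1 => // n /= Nn; exists n.
  have Bc : nbhs c [set g : nat * bool -> R | forall i : 'I_J, forall b,
      `|c (val i, b) - g (val i, b)| < J.+1%:R^-1].
    apply: (@filter_forall _ _ _ (nbhs c)) => i; apply: (@filter_forall _ _ _ (nbhs c)) => b.
    have J0 : 0 < J.+1%:R^-1 :> R by rewrite invr_gt0.
    have hB : nbhs (c (val i, b)) (ball (c (val i, b)) (J.+1%:R^-1 : R)).
      exact: nbhsx_ballx.
    exact: (@proj_continuous (nat * bool)%type (fun=> R : topologicalType)
      (val i, b) c (ball (c (val i, b)) (J.+1%:R^-1 : R)) hB).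
  have [g [[n Nn ->]]] := cf _ _ FN Bc.
  by exists n.
have /choice[nx hnx] : forall JN : nat * nat, exists n, (JN.2 < n)%N /\
    forall i : 'I_JN.1, forall b, `|c (val i, b) - f n (val i, b)| < JN.1.+1%:R^-1.
  by move=> [J N]; exact: pick.
pose k := fix k n := if n is n'.+1 then nx (n, k n') else nx (0%N, 0%N).
exists c, k; split.
  apply: homo_ltn => [y x z xy yz|n]; first exact: ltn_trans xy yz.
  by have [] := hnx (n.+1, k n).
move=> [i b]; apply/cvgrPdist_lt => eps eps0.
have [m hm] := ltr_add_invr eps0; rewrite add0r in hm.
exists (maxn i.+1 m.+1) => // -[|n] /=; first by rewrite geq_max.
rewrite geq_max => /andP[ni nm].
have [_ /(_ (Ordinal ni) b) /= h] := hnx (n.+1, k n).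
apply: lt_trans h _; apply: le_lt_trans hm.
rewrite lef_pV2 ?posrE// ler_nat; exact: leq_trans nm _.
Qed.

(** A subsequence along which all coordinates converge; the limit coordinates are
    square-summable by Bessel, hence those of a vector. *)
Lemma weak_compact (x : nat -> H) (M : R) : (forall n, nrm (x n) <= M) ->
  exists (k : nat -> nat) (y : H), {homo k : m n / (m < n)%N} /\
    forall v, normc (dot (x (k n) - y) v) @[n --> \oo] --> (0 : R).
Proof.
move=> xM; have [e [eo eb]] := orthonormal_basis hH.
have M0 : 0 <= M by apply: le_trans (xM 0%N); exact: nrm_ge0.
have e1 i : nrm (e i) <= 1.
  rewrite -(ler_pXn2r (n := 2))// ?nnegrE ?nrm_ge0//.
  by rewrite (nrm_sq hH) eo eqxx/= expr1n; case: (_ == _).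
have dM n i : normc (dot (x n) (e i)) <= M.
  by rewrite (le_trans (cauchy_schwarz hH _ _))// -[leRHS]mulr1 ler_pM ?nrm_ge0.
pose f n (ib : nat * bool) :=
  if ib.2 then complex.Re (dot (x n) (e ib.1)) else complex.Im (dot (x n) (e ib.1)).
have fM n i : `|f n i| <= M.
  by rewrite /f; case: i.2; apply: le_trans (dM n i.1);
    rewrite ?ler_Re_normc ?ler_Im_normc.
have [c [k [k_incr ck]]] := cluster_subseq fM.
pose z i := Complex (c (i, true)) (c (i, false)).
have dz i : normc (dot (x (k n)) (e i) - z i) @[n --> \oo] --> (0 : R).
  have h : `|f (k n) (i, true) - c (i, true)| + `|f (k n) (i, false) - c (i, false)|
      @[n --> \oo] --> (0 : R).
    rewrite -[X in _ --> X](addr0 0); apply: cvgD; apply/norm_cvg0P;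
      apply/subr_cvg0; exact: ck.
  apply: squeeze_cvgr (cvg_cst 0) h; apply: nearW => n.
  by rewrite normc_ge0/= (le_trans (normc_le_ReIm _))// !(ReD,ImD,ReN,ImN).
have zB n : \sum_(i < n) normc (z i) ^+ 2 <= M ^+ 2.
  have h : \sum_(i < n) normc (dot (x (k j)) (e i)) ^+ 2 @[j --> \oo]
      --> \sum_(i < n) normc (z i) ^+ 2.
    apply: cvg_sumr => i; apply: cvgM; apply/subr_cvg0/norm_cvg0P;
    apply: squeeze_cvgr (cvg_cst 0) (dz i); apply: nearW => j;
    by rewrite normr_ge0; exact: ler_normc_dist.
  apply: (ler_cvg_to h (cvg_cst _)); apply: nearW => j /=.
  apply: (@le_trans _ _ (nrm (x (k j)) ^+ 2)); last first.
    by rewrite lerXn2r ?nnegrE ?nrm_ge0.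
  apply: le_trans (bessel_dot hH (x (k j)) (orthonormal0_ord (n := n) eo)).
  by apply: ler_sum => i _; rewrite (dotC hH) normc_conj.
have [y yz] := orthonormal_series hH eo zB.
exists k, y; split => //.
apply: (@weak_cvg_basis e _ (M + nrm y)) => // [n|i].
  by rewrite (le_trans (ler_nrmD hH _ _))// (nrmN hH) lerD2r.
suff ye : dot y (e i) = z i by under eq_fun do rewrite (dotBl hH) ye; exact: dz.
have [ei0|ei] := eqVneq (e i) 0.
  rewrite ei0 (dot0r hH); apply: cvg_normc_unique (dz i).
  by rewrite ei0; under eq_fun do rewrite (dot0r hH) subrr normc0; exact: cvg_cst.
have h := nrm_cvg_dot hH (e i) yz; apply: cvg_normc_unique h _.
apply: (@cvg_trans _ ((fun=> 0 : R) @ \oo)); last exact: cvg_cst.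
apply: near_eq_cvg; exists i.+1 => // n /= ni.
have := dot_lin_comb hH (fun j : 'I_n => z j) (Ordinal ni) (orthonormal0_ord eo).
by rewrite /= ei mulr1 => ->; rewrite subrr normc0.
Qed.

(** Gram-Schmidt applied to v, padded with 0 into a sequence: it stays inside
    the subspace P, and independence keeps its vectors from vanishing. *)
Lemma orthonormal_of_free (P : H -> Prop) n (v : 'I_n -> H) :
  P 0 -> (forall a x y, P x -> P y -> P (a *: x + y)) ->
  (forall c : 'I_n -> R[i], \sum_(i < n) c i *: v i = 0 -> forall i, c i = 0) ->
  (forall i, P (v i)) ->
  exists e : 'I_n -> H, (forall i, P (e i)) /\
    forall i j, dot (e i) (e j) = (i == j)%:R.
Proof.
move=> P0 Plin vfree Pv.
pose s k := if insub k is Some i then v i else 0.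
have sE (i : 'I_n) : s i = v i by rewrite /s valK.
pose e := gram_schmidt dot s.
have eo : orthonormal0 dot e := gram_schmidt_orthonormal hH s.
have closed_lin Q : Q 0 -> (forall a x y, Q x -> Q y -> Q (a *: x + y)) ->
    (forall a x, Q x -> Q (a *: x)) /\
    forall (m : nat) (c : nat -> R[i]) (w : nat -> H), (forall i, (i < m)%N -> Q (w i)) ->
      Q (\sum_(i < m) c i *: w i).
  move=> Q0 Ql; split=> [a x Qx|m c w Qw].
    by rewrite -(addr0 (a *: x)); exact: Ql.
  elim: m Qw => [|m IHm] Qw; first by rewrite big_ord0.
  by rewrite big_ord_recr/= addrC; apply: Ql; [exact: Qw|apply: IHm => i im; apply: Qw; exact: ltnW].
have gsQ (Q : H -> Prop) m : Q 0 -> (forall a x y, Q x -> Q y -> Q (a *: x + y)) ->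
    (forall i, (i <= m)%N -> Q (s i)) -> forall i, (i <= m)%N -> Q (e i).
  move=> Q0 Ql Qs; have [Qz Qsum] := closed_lin Q Q0 Ql.
  move=> i; elim/ltn_ind : i => i IHi im.
  rewrite /e gram_schmidtE; apply: Qz; rewrite addrC -scaleN1r; apply: Ql; last exact: Qs.
  apply: (Qsum i (fun j => dot (s i) (e j)) e) => j ji.
  by apply: IHi => //; exact: leq_trans (ltnW ji) im.
have Pe k : P (e k).
  apply: (gsQ P k) => // i _; rewrite /s; case: insubP => // ? _ _; exact: Pv.
have eN0 (i : 'I_n) : e i != 0.
  apply/negP => /eqP ei0.
  (* A vanishing vector makes v i a combination of its predecessors. *)
  have [d hd] : exists d : nat -> R[i], s i = \sum_(j < i) d j *: s j.
    have -> : s i = partial_proj dot e i (s i).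
      by rewrite -[LHS](gram_schmidt_span hH s (ltnSn i)) /partial_proj big_ord_recr/= -/e ei0
        scaler0 addr0.
    pose Q w := exists d : nat -> R[i], w = \sum_(j < i) d j *: s j.
    have Q0 : Q 0 by exists (fun=> 0); rewrite big1// => j _; rewrite scale0r.
    have Ql a x y : Q x -> Q y -> Q (a *: x + y).
      move=> [d ->] [d' ->]; exists (fun j => a * d j + d' j).
      rewrite scaler_sumr -big_split; apply: eq_bigr => j _.
      by rewrite scalerDl scalerA.
    have [_ Qsum] := closed_lin Q Q0 Ql.
    apply: (Qsum i (fun j => dot (s i) (e j)) e) => j ji.
    apply: (gsQ Q j) => // j' jj'.
    have j'i : (j' < i)%N by exact: leq_ltn_trans jj' ji.
    exists (fun l => (l == j')%:R); rewrite (bigD1 (Ordinal j'i))//= eqxx scale1r.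
    rewrite big1 ?addr0// => l lj; rewrite (_ : (l == j' :> nat) = false) ?scale0r//.
    by apply: contraNF lj => /eqP h; apply/eqP/val_inj.
  pose c (j : 'I_n) := if (j < i)%N then d j else if j == i then -1 else 0 : R[i].
  have : \sum_j c j *: v j = 0.
    rewrite (bigD1 i)//= {1}/c ltnn eqxx scaleN1r -sE hd addrC.
    apply/eqP; rewrite subr_eq0; apply/eqP.
    rewrite (big_ord_widen_cond n xpredT (fun j => d j *: s j) (ltnW (ltn_ord i)))/=.
    rewrite big_mkcond [RHS]big_mkcond/=; apply: eq_bigr => j _; rewrite /c -sE.
    by have [->|ji] := eqVneq j i; rewrite ?ltnn//=; case: ifP; rewrite ?scale0r.
  move=> /vfree/(_ i); rewrite /c ltnn eqxx => /eqP.
  by rewrite oppr_eq0 oner_eq0.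
exists (fun i => e i); split => // i j.
by rewrite eo (eN0 i) andbT.
Qed.

End Riesz.

(** * Absolute value of an operator *)

Section AbsoluteValueOf.
Context (R : realType) (H : lmodType R[i]) (dot : H -> H -> R[i]).
Hypothesis hH : hilbert_axioms dot.
Local Notation nrm := (hnorm dot).
Local Notation "x %:C" := ((x%:C)%C).
Implicit Types (u v w : H) (a : R[i]).

Lemma linear_maps (f : H -> H) : linear f ->
  [/\ f 0 = 0, (forall u v, f (u + v) = f u + f v),
      (forall u v, f (u - v) = f u - f v) & (forall a u, f (a *: u) = a *: f u)].
Proof.
move=> lf; have f0 : f 0 = 0.
  by have := lf (-1) 0 0; rewrite scaler0 addr0 scaleN1r addNr.
split => // [u v|u v|a u].
- by have := lf 1 u v; rewrite !scale1r.
- by rewrite [u - v]addrC -scaleN1r lf scaleN1r addrC.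
- by have := lf a u 0; rewrite f0 !addr0.
Qed.

Lemma nrm_cvg_unique (x : nat -> H) y z :
  nrm (x n - y) @[n --> \oo] --> (0 : R) ->
  nrm (x n - z) @[n --> \oo] --> (0 : R) -> y = z.
Proof.
move=> xy xz; apply: (dot_ext hH) => w.
exact: cvg_normc_unique (nrm_cvg_dot hH w xy) (nrm_cvg_dot hH w xz).
Qed.

Lemma nrm_cvg_lin a (x x' : nat -> H) y y' :
  nrm (x n - y) @[n --> \oo] --> (0 : R) ->
  nrm (x' n - y') @[n --> \oo] --> (0 : R) ->
  nrm ((a *: x n + x' n) - (a *: y + y')) @[n --> \oo] --> (0 : R).
Proof.
move=> xy xz.
have h : normc a * nrm (x n - y) + nrm (x' n - y') @[n --> \oo] --> (0 : R).
  by rewrite -[X in _ --> X](addr0 0) -{1}(mulr0 (normc a)); apply: cvgD => //; apply: cvgMr.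
apply: squeeze_cvgr (cvg_cst 0) h; apply: nearW => n; rewrite nrm_ge0/=.
by rewrite opprD addrACA -scalerBr (le_trans (ler_nrmD hH _ _))// (nrmZ hH).
Qed.

Lemma nrm_cvg_le (x : nat -> H) y (B : R) :
  nrm (x n - y) @[n --> \oo] --> (0 : R) -> (forall n, nrm (x n) <= B) ->
  nrm y <= B.
Proof.
move=> xy xB; have h : nrm (x n - y) + B @[n --> \oo] --> 0 + B.
  by apply: cvgD => //; exact: cvg_cst.
rewrite add0r in h; apply: (ler_cvg_to (cvg_cst _) h); apply: nearW => n.
rewrite -{1}(subrK (x n) y) (le_trans (ler_nrmD hH _ _))// (nrmBC hH).
by rewrite lerD2l.
Qed.

Section ContractionRoot.
Context (B : H -> H).
Hypothesis linB : linear B.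
Hypothesis saB : forall u v, dot (B u) v = dot u (B v).
Hypothesis contrB : forall v, nrm (B v) <= nrm v.

Fixpoint root_approx n v : H :=
  if n isn't n'.+1 then 0 else 2^-1 *: (B v + root_approx n' (root_approx n' v)).

Fixpoint root_majorant n : R :=
  if n isn't n'.+1 then 0 else 2^-1 * (1 + root_majorant n' * root_majorant n').

Local Notation Y := root_approx.
Local Notation a := root_majorant.

Lemma linear_root_approx n : linear (Y n).
Proof.
elim: n => [|n IHn] c u v /=; first by rewrite scaler0 addr0.
rewrite linB !IHn scalerA mulrC -scalerA -scalerDr; congr (_ *: _).
by rewrite scalerDr addrACA.
Qed.

Lemma root_approx_sa n u v : dot (Y n u) v = dot u (Y n v).
Proof.
elim: n u v => [|n IHn] u v /=; first by rewrite (dot0l hH) (dot0r hH).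
rewrite (dotZl hH) (dotZr hH) (dotDl hH) (dotDr hH) saB !IHn; congr (_ * _).
by rewrite halfC conjCR.
Qed.

Lemma root_approx_commB n v : Y n (B v) = B (Y n v).
Proof.
have [B0 BD _ BZ] := linear_maps linB.
by elim: n v => [|n IHn] v /=; rewrite ?B0// BZ BD !IHn.
Qed.

Lemma root_approx_comm n m v : Y n (Y m v) = Y m (Y n v).
Proof.
elim: n m v => [|n IHn] m v /=; first by have [->] := linear_maps (linear_root_approx m).
have [_ YD _ YZ] := linear_maps (linear_root_approx m).
by rewrite YZ YD -root_approx_commB !IHn.
Qed.

Lemma root_majorant_itv n : 0 <= a n <= 1.
Proof. by elim: n => /= [|n]; [lra|nra]. Qed.

Lemma nrm_root_approx n v : nrm (Y n v) <= a n * nrm v.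
Proof.
elim: n v => [|n IHn] v /=; first by rewrite (nrm0 hH) mul0r.
rewrite (nrmZ hH) halfC normc_real ger0_norm//.
rewrite -mulrA ler_wpM2l// mulrDl mul1r (le_trans (ler_nrmD hH _ _))// lerD//.
have /andP[a0 _] := root_majorant_itv n.
by rewrite (le_trans (IHn _))// -mulrA ler_wpM2l.
Qed.

Lemma nrm_root_step n v : nrm (Y n.+1 v - Y n v) <= (a n.+1 - a n) * nrm v.
Proof.
elim: n v => [|n IHn] v.
  rewrite subr0 /=; have := nrm_root_approx 1 v; rewrite /= => /le_trans; apply.
  by rewrite subr0.
have [_ YD YB _] := linear_maps (linear_root_approx n).
have [_ YD' YB' _] := linear_maps (linear_root_approx n.+1).
have -> : Y n.+2 v - Y n.+1 v =
    2^-1 *: (Y n.+1 (Y n.+1 v - Y n v) + Y n (Y n.+1 v - Y n v)).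
  rewrite YB' YB (root_approx_comm n.+1 n) addrA subrK.
  rewrite -[Y n.+2 v]/(2^-1 *: (B v + Y n.+1 (Y n.+1 v))).
  rewrite -[X in _ - X]/(2^-1 *: (B v + Y n (Y n v))) -scalerBr.
  by rewrite opprD addrACA subrr add0r.
have -> : a n.+2 - a n.+1 = 2^-1 * ((a n.+1 + a n) * (a n.+1 - a n)).
  rewrite -[a n.+2]/(2^-1 * (1 + a n.+1 * a n.+1)).
  rewrite -[X in _ - X]/(2^-1 * (1 + a n * a n)); ring.
rewrite (nrmZ hH) halfC normc_real ger0_norm// -[leRHS]mulrA.
rewrite ler_wpM2l// (le_trans (ler_nrmD hH _ _))// -mulrA mulrDl.
have /andP[a0 _] := root_majorant_itv n.
have /andP[a0' _] := root_majorant_itv n.+1.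
by apply: lerD; rewrite (le_trans (nrm_root_approx _ _))// ler_wpM2l.
Qed.

Lemma root_majorant_nd : nondecreasing_seq a.
Proof.
apply/nondecreasing_seqP => n; have /andP[a0 a1] := root_majorant_itv n.
by rewrite /=; nra.
Qed.

Lemma root_approx_cvg v : exists y, nrm (Y n v - y) @[n --> \oo] --> (0 : R).
Proof.
apply: (dot_complete hH) => eps eps0.
have key m n : (m <= n)%N -> nrm (Y n v - Y m v) <= (a n - a m) * nrm v.
  move=> /subnKC <-; elim: (n - m)%N => [|d IHd].
    by rewrite addn0 !subrr (nrm0 hH) mul0r.
  rewrite addnS (le_trans (ler_nrmB hH _ (Y (m + d) v) _))//.
  apply: le_trans (lerD (nrm_root_step _ _) IHd) _.
  by rewrite -mulrDl addrA subrK.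
have ca : cvgn a.
  apply: nondecreasing_is_cvgn; first exact: root_majorant_nd.
  by exists 1 => _ [n _ <-]; have /andP[] := root_majorant_itv n.
have v1 : 0 < nrm v + 1 by rewrite ltr_wpDl// nrm_ge0.
have e1 : 0 < eps / (nrm v + 1) by rewrite divr_gt0.
have /cvgrPdist_lt/(_ _ e1) [N _ hN] := ca.
have key2 m n : (N <= m)%N -> (m <= n)%N -> nrm (Y n v - Y m v) < eps.
  move=> Nm mn; apply: le_lt_trans (key _ _ mn) _.
  have h : a n - a m < eps / (nrm v + 1).
    apply: le_lt_trans (hN m Nm); rewrite ger0_norm ?subr_ge0; last first.
      apply: nondecreasing_cvgn_le => //; exact: root_majorant_nd.
    by rewrite lerD2r; apply: nondecreasing_cvgn_le => //; exact: root_majorant_nd.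
  rewrite ltr_pdivlMr// in h; apply: le_lt_trans h.
  rewrite ler_wpM2l ?lerDl//.
  by rewrite subr_ge0; exact: root_majorant_nd.
exists N => m n Nm Nn; case: (leqP n m) => [nm|/ltnW mn]; first exact: key2.
by rewrite (nrmBC hH); exact: key2.
Qed.

(** The operator 1 - Y is the square root of 1 - B. The iteration
    Y_0 = 0, Y_(n+1) = (B + Y_n^2) / 2 consists of polynomials in B with non-negative
    coefficients, so its increments are dominated in norm by those of the same
    iteration started with the number 1 in place of B, which increases and is
    bounded by 1. *)
Lemma contraction_root : exists Y : H -> H,
  [/\ linear Y, (forall u v, dot (Y u) v = dot u (Y v)),
      (forall v, nrm (Y v) <= nrm v) &
      (forall v, Y v + Y v = B v + Y (Y v))].
Proof.
have [Z hZ] := choice root_approx_cvg.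
have Z1 v : nrm (Z v) <= nrm v.
  apply: (nrm_cvg_le (hZ v)) => n; have /andP[a0 a1] := root_majorant_itv n.
  by rewrite (le_trans (nrm_root_approx _ _))// ler_piMl// nrm_ge0.
exists Z; split => //.
- move=> c u v; apply: nrm_cvg_unique (hZ _) _.
  under eq_fun do rewrite linear_root_approx.
  exact: nrm_cvg_lin.
- move=> u v; apply: (@cvg_normc_unique _ (fun n => dot (Y n u) v)).
    exact: nrm_cvg_dot.
  under eq_fun do rewrite root_approx_sa -normc_conj conjCB -!(dotC hH).
  exact: nrm_cvg_dot.
- move=> v; pose X n := Y n.+1 v + Y n.+1 v.
  have hS : nrm (Y n.+1 v - Z v) @[n --> \oo] --> (0 : R).
    by have := hZ v; rewrite -(cvg_shiftS (fun n => nrm (Y n v - Z v))).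
  apply: (@nrm_cvg_unique X).
    have := nrm_cvg_lin 1 hS hS; rewrite scale1r.
    by under eq_fun do rewrite scale1r.
  have -> : X = fun n => 1 *: B v + Y n (Y n v).
    apply/funext => n; rewrite /X /= -scalerDl scale1r.
    by rewrite -[2^-1]mul1r -splitr scale1r.
  have -> : B v + Z (Z v) = 1 *: B v + Z (Z v) by rewrite scale1r.
  apply: (nrm_cvg_lin 1 (x := fun=> B v)).
    by rewrite subrr (nrm0 hH); exact: cvg_cst.
  have h : nrm (Y n v - Z v) + nrm (Y n (Z v) - Z (Z v)) @[n --> \oo] --> (0 : R).
    by rewrite -[X in _ --> X](addr0 0); apply: cvgD.
  apply: squeeze_cvgr (cvg_cst 0) h; apply: nearW => n; rewrite nrm_ge0/=.
  rewrite (le_trans (ler_nrmB hH _ (Y n (Z v)) _))// lerD2r.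
  have [_ _ YB _] := linear_maps (linear_root_approx n).
  rewrite -YB (le_trans (nrm_root_approx _ _))// ler_piMl ?nrm_ge0//.
  by have /andP[] := root_majorant_itv n.
Qed.

End ContractionRoot.

(** For M > 0 bounding T, the operator B = 1 - T^*T / M^2 is a self-adjoint
    contraction, and |T| is M times the square root of 1 - B. *)
Lemma absolute_value_exists (T S : H -> H) : linear T -> linear S ->
  bounded_op dot T -> is_adjoint dot T S -> exists A, is_absolute_value dot T A.
Proof.
move=> linT linS [M0 hM0] TS.
pose M := `|M0| + 1.
have M_gt0 : 0 < M by rewrite ltr_wpDl.
have TM v : nrm (T v) <= M * nrm v.
  rewrite (le_trans (hM0 v))// ler_wpM2r ?nrm_ge0//.
  by rewrite (le_trans (ler_norm _))// lerDl.
have SM v : nrm (S v) <= M * nrm v.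
  have [->|Sv0] := eqVneq (nrm (S v)) 0; first by rewrite mulr_ge0 ?nrm_ge0 ?(ltW M_gt0).
  have Sv : 0 < nrm (S v) by rewrite lt_def Sv0 nrm_ge0.
  rewrite -(ler_pM2r Sv) -expr2 -[leLHS]ger0_norm ?sqr_ge0// -normc_real.
  rewrite -(dot_nrm hH) -TS (le_trans (cauchy_schwarz hH _ _))//.
  by rewrite mulrAC ler_wpM2r ?nrm_ge0.
have ST u v : dot (S u) v = dot u (T v).
  by rewrite (dotC hH) -TS -(dotC hH).
have [T0 TD TB TZ] := linear_maps linT; have [S0 SD SB SZ] := linear_maps linS.
pose q := M ^- 2; have q0 : 0 < q by rewrite invr_gt0 exprn_gt0.
pose B v := v - q%:C *: S (T v).
have linB : linear B.
  move=> c u v; rewrite /B linT linS scalerDr scalerA mulrC -scalerA.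
  by rewrite opprD addrACA -scalerBr.
have saB u v : dot (B u) v = dot u (B v).
  by rewrite /B (dotBl hH) (dotBr hH) (dotZl hH) (dotZr hH) conjCR ST TS.
have contrB v : nrm (B v) <= nrm v.
  rewrite -(ler_pXn2r (n := 2))// ?nnegrE ?nrm_ge0// /B (nrm_sqD hH) (nrmN hH).
  rewrite (nrmZ hH) normc_real (ger0_norm (ltW q0)) -addrA gerDl.
  rewrite (dotNr hH) (dotZr hH) conjCR -TS (dot_nrm hH) ReN ReZ/= exprMn.
  have : nrm (S (T v)) ^+ 2 <= (M * nrm (T v)) ^+ 2.
    by rewrite ler_pXn2r ?nnegrE ?mulr_ge0 ?nrm_ge0 ?(ltW M_gt0).
  rewrite exprMn => h.
  apply: (@le_trans _ _ (2 * - (q * nrm (T v) ^+ 2) + q ^+ 2 * (M ^+ 2 * nrm (T v) ^+ 2))).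
    by rewrite lerD2l ler_wpM2l ?sqr_ge0.
  have -> : q ^+ 2 * (M ^+ 2 * nrm (T v) ^+ 2) = q * nrm (T v) ^+ 2.
    by rewrite mulrA expr2 -(mulrA q) /q mulVf ?mulr1// expf_neq0// gt_eqF.
  have := mulr_ge0 (ltW q0) (sqr_ge0 (nrm (T v))); lra.
have [Y [linY saY contrY eqY]] := contraction_root linB saB contrB.
have [Y0 YD YB YZ] := linear_maps linY.
pose A v := M%:C *: (v - Y v); exists A; split.
- move=> c u v; rewrite /A linY opprD addrACA -scalerBr scalerDr !scalerA.
  by rewrite mulrC.
- exists (M * 2) => v; rewrite /A (nrmZ hH) normc_real (ger0_norm (ltW M_gt0)) -mulrA.
  rewrite ler_wpM2l ?(ltW M_gt0)// (le_trans (ler_nrmD hH _ _))// (nrmN hH).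
  by rewrite mulr_natl mulr2n lerD2l.
- move=> v; rewrite /A (dotZl hH); apply: mulr_ge0; first by rewrite ler0c ltW.
  rewrite (dotBl hH) (dot_nrm hH).
  have dr : complex.Im (dot (Y v) v) = 0.
    have := dotC hH (Y v) v; rewrite -saY => /(congr1 (@complex.Im R)).
    by rewrite ImJ; lra.
  have h : complex.Re (dot (Y v) v) <= nrm v ^+ 2.
    rewrite (le_trans (ler_norm _))// (le_trans (ler_Re_normc _))//.
    by rewrite (le_trans (cauchy_schwarz hH _ _))// expr2 ler_wpM2r ?nrm_ge0.
  by rewrite lecE ReD ReN ImD ImN dr/= subr0 eqxx subr_ge0.
- exists S; split=> // v; rewrite /A YZ YB -scalerBr scalerA -realCM.
  have -> : (v - Y v) - (Y v - Y (Y v)) = v - B v.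
    have -> : Y (Y v) = Y v + Y v - B v by rewrite eqY addrAC subrr add0r.
    by rewrite opprB [Y v + Y v - B v - Y v]addrAC addrK addrA subrK.
  rewrite /B opprB addrC subrK scalerA -realCM /q -expr2 divff ?scale1r//.
  by rewrite expf_neq0// gt_eqF.
Qed.

End AbsoluteValueOf.

(** * Complex integration *)

Section ComplexIntegration.
Context (R : realType) d (T : measurableType d) (mu : {measure set T -> \bar R}).
Implicit Types f g : T -> R[i].
Local Notation "x %:C" := ((x%:C)%C).

Definition L1norm f : \bar R := (\int[mu]_x (normc (f x))%:E)%E.
Definition sqint f : \bar R := (\int[mu]_x ((normc (f x)) ^+ 2)%:E)%E.

Lemma cmeasurable_cst (a : R[i]) : cmeasurable (fun _ : T => a).
Proof. by split; exact: measurable_cst. Qed.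

Lemma ge0_integralZlR (c : R) (h : T -> R) : measurable_fun setT h ->
  (forall x, 0 <= h x) -> 0 <= c ->
  (\int[mu]_x (c * h x)%:E = c%:E * \int[mu]_x (h x)%:E)%E.
Proof.
move=> mh h0 c0; under eq_integral do rewrite EFinM.
apply: ge0_integralZl_EFin => //; first by move=> x _; rewrite lee_fin.
exact/measurable_EFinP.
Qed.

Lemma cmeasurable_real (h : T -> R) : measurable_fun setT h ->
  cmeasurable (fun x => (h x)%:C).
Proof. by move=> mh; split => //=; exact: measurable_cst. Qed.

Lemma cmeasurableJ f : cmeasurable f -> cmeasurable (fun x => (f x)^*).
Proof.
move=> [mr mi]; split; first by under eq_fun do rewrite ReJ.
by under eq_fun do rewrite ImJ; exact: measurableT_comp.
Qed.

Lemma cmeasurableM f g : cmeasurable f -> cmeasurable g ->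
  cmeasurable (fun x => f x * g x).
Proof.
move=> [fr fi] [gr gi]; split.
- under eq_fun do rewrite ReM.
  by apply: measurable_funB; exact: measurable_funM.
- under eq_fun do rewrite ImM.
  by apply: measurable_funD; exact: measurable_funM.
Qed.

Lemma cmeasurableD f g : cmeasurable f -> cmeasurable g ->
  cmeasurable (fun x => f x + g x).
Proof.
move=> mf mg; have := cmeasurable_lin 1 mf mg.
by under eq_fun do rewrite mul1r.
Qed.

Lemma cmeasurableB f g : cmeasurable f -> cmeasurable g ->
  cmeasurable (fun x => f x - g x).
Proof.
move=> mf mg; have := cmeasurable_lin (-1) mg mf.
by under eq_fun do rewrite mulN1r addrC.
Qed.

Lemma cmeasurable_sum (I : Type) (r : seq I) (F : I -> T -> R[i]) :
  (forall i, cmeasurable (F i)) -> cmeasurable (fun x => \sum_(i <- r) F i x).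
Proof.
move=> mF; elim: r => [|i r IHr].
  by under eq_fun do rewrite big_nil; exact: cmeasurable_cst.
by under eq_fun do rewrite big_cons; exact: cmeasurableD.
Qed.

Lemma cmeasurable_lim (F : nat -> T -> R[i]) f : (forall n, cmeasurable (F n)) ->
  (forall x, normc (F n x - f x) @[n --> \oo] --> (0 : R)) -> cmeasurable f.
Proof.
move=> mF Ff; split.
- apply: (@measurable_fun_cvg _ _ _ setT (fun n x => complex.Re (F n x))).
    by move=> n; have [] := mF n.
  move=> x _; apply/subr_cvg0/norm_cvg0P; apply: squeeze_cvgr (cvg_cst 0) (Ff x).
  by apply: nearW => n; rewrite normr_ge0/= -ReN -ReD ler_Re_normc.
- apply: (@measurable_fun_cvg _ _ _ setT (fun n x => complex.Im (F n x))).
    by move=> n; have [] := mF n.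
  move=> x _; apply/subr_cvg0/norm_cvg0P; apply: squeeze_cvgr (cvg_cst 0) (Ff x).
  by apply: nearW => n; rewrite normr_ge0/= -ImN -ImD ler_Im_normc.
Qed.

Lemma measurable_normcE f : cmeasurable f ->
  measurable_fun setT (fun x => (normc (f x))%:E).
Proof. by move=> mf; apply/measurable_EFinP; exact: measurable_normc. Qed.

Lemma measurable_normc2E f : cmeasurable f ->
  measurable_fun setT (fun x => (normc (f x) ^+ 2)%:E).
Proof.
by move=> mf; apply/measurable_EFinP/measurable_funX; exact: measurable_normc.
Qed.

Lemma cintegrableP f :
  cintegrable mu f <-> cmeasurable f /\ (L1norm f < +oo)%E.
Proof.
split=> [[ir ii]|[[mr mi] f1]].
  have mf : cmeasurable f.
    split; apply/measurable_EFinP; [exact: measurable_int ir|exact: measurable_int ii].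
  split=> //; move: ir ii => /integrableP[mr fr] /integrableP[mi fi].
  apply: (@le_lt_trans _ _ (\int[mu]_x (`|(complex.Re (f x))%:E| + `|(complex.Im (f x))%:E|)))%E.
    apply: ge0_le_integral => //.
    - by move=> x _; rewrite lee_fin normc_ge0.
    - exact: measurable_normcE.
    - by apply: emeasurable_funD; exact: measurableT_comp.
    - by move=> x _; rewrite !abse_EFin -EFinD lee_fin normc_le_ReIm.
  rewrite ge0_integralD//; first exact: lte_add_pinfty.
  - exact: measurableT_comp.
  - exact: measurableT_comp.
have mf : cmeasurable f by [].
split; apply/integrableP; (split; first by apply/measurable_EFinP).
- apply: le_lt_trans f1; apply: ge0_le_integral => //.
  + by apply: measurableT_comp => //; exact/measurable_EFinP.
  + exact: measurable_normcE.
  + by move=> x _; rewrite abse_EFin lee_fin ler_Re_normc.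
- apply: le_lt_trans f1; apply: ge0_le_integral => //.
  + by apply: measurableT_comp => //; exact/measurable_EFinP.
  + exact: measurable_normcE.
  + by move=> x _; rewrite abse_EFin lee_fin ler_Im_normc.
Qed.

Lemma L1norm_le f (h : T -> R) : cmeasurable f -> measurable_fun setT h ->
  (forall x, normc (f x) <= h x) -> (L1norm f <= \int[mu]_x (h x)%:E)%E.
Proof.
move=> mf mh fh; apply: ge0_le_integral => //.
- by move=> x _; rewrite lee_fin normc_ge0.
- exact: measurable_normcE.
- exact/measurable_EFinP.
- by move=> x _; rewrite lee_fin.
Qed.

Lemma integrableR_lin (a b : R) (h k : T -> R) :
  mu.-integrable setT (EFin \o h) -> mu.-integrable setT (EFin \o k) ->
  mu.-integrable setT (EFin \o (fun x => a * h x + b * k x)) /\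
  \int[mu]_x (a * h x + b * k x) = a * \int[mu]_x h x + b * \int[mu]_x k x.
Proof.
move=> ih ik.
have ia : mu.-integrable setT (EFin \o (fun x => a * h x)) by exact: (integrableZl measurableT a ih).
have ib : mu.-integrable setT (EFin \o (fun x => b * k x)) by exact: (integrableZl measurableT b ik).
split; last by rewrite RintegralD// !RintegralZl.
exact: (integrableD measurableT ia ib).
Qed.

Lemma cintegrable_lin a f g : cintegrable mu f -> cintegrable mu g ->
  cintegrable mu (fun x => a * f x + g x).
Proof.
move=> [fr fi] [gr gi]; split.
- have [h _] := integrableR_lin (complex.Re a) (- complex.Im a) fr fi.
  have [k _] := integrableR_lin 1 1 h gr; apply: eq_integrable k => // x _ /=.
  by rewrite ReD ReM; congr EFin; ring.
- have [h _] := integrableR_lin (complex.Re a) (complex.Im a) fi fr.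
  have [k _] := integrableR_lin 1 1 h gi; apply: eq_integrable k => // x _ /=.
  by rewrite ImD ImM; congr EFin; ring.
Qed.

Lemma cintegral_lin a f g : cintegrable mu f -> cintegrable mu g ->
  cintegral mu (fun x => a * f x + g x) = a * cintegral mu f + cintegral mu g.
Proof.
move=> [fr fi] [gr gi]; apply: complex_eqP.
- have [h hE] := integrableR_lin (complex.Re a) (- complex.Im a) fr fi.
  have [_ kE] := integrableR_lin 1 1 h gr.
  rewrite ReD ReM /= -[X in _ = X - _ + _]mul1r.
  transitivity (1 * \int[mu]_x (complex.Re a * complex.Re (f x) + - complex.Im a * complex.Im (f x)) +
     1 * \int[mu]_x complex.Re (g x)); last by rewrite hE; ring.
  by rewrite -kE; apply: eq_Rintegral => x _; rewrite ReD ReM; ring.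
- have [h hE] := integrableR_lin (complex.Re a) (complex.Im a) fi fr.
  have [_ kE] := integrableR_lin 1 1 h gi.
  rewrite ImD ImM /=.
  transitivity (1 * \int[mu]_x (complex.Re a * complex.Im (f x) + complex.Im a * complex.Re (f x)) +
     1 * \int[mu]_x complex.Im (g x)); last by rewrite hE; ring.
  by rewrite -kE; apply: eq_Rintegral => x _; rewrite ImD ImM; ring.
Qed.

Lemma Rintegral0 : \int[mu]_x (0 : R) = 0.
Proof. by rewrite /Rintegral integral0. Qed.

Lemma cintegral0 : cintegral mu (fun=> 0) = 0.
Proof. by rewrite /cintegral /= Rintegral0. Qed.

Lemma cintegrable0 : cintegrable mu (fun=> 0).
Proof. by split; exact: integrable0. Qed.

Lemma cintegrableZ a f : cintegrable mu f -> cintegrable mu (fun x => a * f x).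
Proof.
move=> i; have := cintegrable_lin a i cintegrable0.
by under eq_fun do rewrite addr0.
Qed.

Lemma cintegralZ a f : cintegrable mu f ->
  cintegral mu (fun x => a * f x) = a * cintegral mu f.
Proof.
move=> i; have := cintegral_lin a i cintegrable0.
by under eq_fun do rewrite addr0; rewrite cintegral0 addr0.
Qed.

Lemma cintegrableB f g : cintegrable mu f -> cintegrable mu g ->
  cintegrable mu (fun x => f x - g x).
Proof.
move=> i j; have := cintegrable_lin (-1) j i.
by under eq_fun do rewrite mulN1r addrC.
Qed.

Lemma cintegralB f g : cintegrable mu f -> cintegrable mu g ->
  cintegral mu (fun x => f x - g x) = cintegral mu f - cintegral mu g.
Proof.
move=> i j; have := cintegral_lin (-1) j i.
by under eq_fun do rewrite mulN1r addrC; rewrite mulN1r addrC.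
Qed.

Lemma cintegralJ f : cintegrable mu f ->
  cintegral mu (fun x => (f x)^*) = (cintegral mu f)^*.
Proof.
move=> [fr fi]; apply: complex_eqP; rewrite ?ReJ ?ImJ /=.
  by apply: eq_Rintegral => x _; rewrite ReJ.
rewrite -[RHS]mulN1r -RintegralZl//.
by apply: eq_Rintegral => x _; rewrite ImJ mulN1r.
Qed.

Lemma eq_cintegral f g : (forall x, f x = g x) -> cintegral mu f = cintegral mu g.
Proof. by move=> fg; congr cintegral; apply/funext. Qed.

Lemma ae_eq_cintegral f g : cmeasurable f -> cmeasurable g ->
  {ae mu, forall x, f x = g x} -> cintegral mu f = cintegral mu g.
Proof.
move=> [fr fi] [gr gi] fg; rewrite /cintegral /Rintegral.
congr Complex; congr fine; apply: ae_eq_integral => //; try exact/measurable_EFinP;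
by apply: filterS fg => x ->.
Qed.

(** Multiply f by the unit complex number that makes its integral positive, and
    compare real parts with moduli. *)
Lemma normc_cintegral f : cintegrable mu f ->
  ((normc (cintegral mu f))%:E <= L1norm f)%E.
Proof.
move=> iF; set w := cintegral mu f.
have [w0|w0] := eqVneq w 0.
  by rewrite w0 normc0; apply: integral_ge0 => x _; rewrite lee_fin normc_ge0.
have nw : normc w != 0 by apply: contra_neq w0; exact: eq0_normc.
pose c := w^* * ((normc w)^-1)%:C.
have nc : normc c = 1.
  by rewrite normcM normc_conj normc_real ger0_norm ?invr_ge0 ?normc_ge0// divff.
have cw : c * w = (normc w)%:C.
  rewrite /c mulrAC [_^* * _]mulrC mulcJ -realCM expr2 -mulrA divff//.
  by rewrite mulr1.
have [ir ii] := cintegrableZ c iF.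
have -> : (normc w)%:E = (\int[mu]_x (complex.Re (c * f x))%:E)%E.
  have <- : complex.Re (cintegral mu (fun x => c * f x)) = normc w.
    by rewrite cintegralZ// -/w cw.
  rewrite /= /Rintegral fineK//; exact: integrable_fin_num.
have /cintegrableP[mf _] := iF.
have iN : mu.-integrable setT (fun x => (normc (f x))%:E).
  apply/integrableP; split; first exact: measurable_normcE.
  under eq_integral do rewrite abse_EFin ger0_norm ?normc_ge0//.
  by have /cintegrableP[] := iF.
apply: le_integral => // x _; rewrite lee_fin.
rewrite (le_trans (ler_norm _))// (le_trans (ler_Re_normc _))//.
by rewrite normcM nc mul1r.
Qed.

Lemma clnorm1E f : clnorm mu 1 f = L1norm f.
Proof.
rewrite /clnorm Lnorm1; apply: eq_integral => x _.
by rewrite abse_EFin ger0_norm ?normc_ge0.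
Qed.

Lemma sqint_ge0 f : (0 <= sqint f)%E.
Proof. by apply: integral_ge0 => x _; rewrite lee_fin sqr_ge0. Qed.

Lemma clnorm2E f : (clnorm mu 2%:E f = (sqint f) `^ 2^-1)%E.
Proof.
rewrite /clnorm unlock /sqint; congr (_ `^ _)%E; apply: eq_integral => x _.
by rewrite abse_EFin ger0_norm ?normc_ge0// poweR_EFin powR_mulrn ?normc_ge0.
Qed.

Lemma cLp2P f : cLp mu 2%:E f <-> cmeasurable f /\ (sqint f < +oo)%E.
Proof.
rewrite /cLp clnorm2E; split=> -[mf h]; split => //; last exact: poweR_lty.
by apply: lty_poweRy h; rewrite invr_eq0 pnatr_eq0.
Qed.

Lemma cprod_integrable f g : cLp mu 2%:E f -> cLp mu 2%:E g ->
  cintegrable mu (fun x => f x * (g x)^*).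
Proof.
move=> /cLp2P[mf f2] /cLp2P[mg g2]; apply/cintegrableP.
have mfg : cmeasurable (fun x => f x * (g x)^*).
  by apply: cmeasurableM => //; exact: cmeasurableJ.
split=> //.
apply: (@le_lt_trans _ _ (\int[mu]_x ((normc (f x)) ^+ 2 + (normc (g x)) ^+ 2)%:E)%E).
  apply: L1norm_le => //.
    by apply: measurable_funD; apply: measurable_funX; exact: measurable_normc.
  move=> x; rewrite normcM normc_conj.
  by have := sqr_ge0 (normc (f x) - normc (g x)); have := normc_ge0 (f x);
    have := normc_ge0 (g x); nra.
under eq_integral do rewrite EFinD.
rewrite ge0_integralD//; first exact: lte_add_pinfty.
- by move=> x _; rewrite lee_fin sqr_ge0.
- exact: measurable_normc2E.
- by move=> x _; rewrite lee_fin sqr_ge0.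
- exact: measurable_normc2E.
Qed.

Lemma cprod_linl a f g h : cLp mu 2%:E f -> cLp mu 2%:E g -> cLp mu 2%:E h ->
  cprod mu (fun x => a * f x + g x) h = a * cprod mu f h + cprod mu g h.
Proof.
move=> f2 g2 h2; rewrite /cprod -cintegral_lin; try exact: cprod_integrable.
by apply: eq_cintegral => x; rewrite mulrDl mulrA.
Qed.

Lemma cprodC f g : cLp mu 2%:E f -> cLp mu 2%:E g ->
  cprod mu g f = (cprod mu f g)^*.
Proof.
move=> f2 g2; rewrite /cprod -cintegralJ; last exact: cprod_integrable.
by apply: eq_cintegral => x; rewrite conjCM conjCK mulrC.
Qed.

Lemma cprod_self f : cLp mu 2%:E f -> cprod mu f f = (fine (sqint f))%:C.
Proof.
move=> f2; apply: complex_eqP => /=.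
  by congr fine; apply: eq_integral => x _; rewrite mulcJ.
rewrite -[RHS]Rintegral0; apply: eq_Rintegral => x _; by rewrite mulcJ.
Qed.

End ComplexIntegration.

(** * Operators given by a symbol on a frame *)

(** A map S from a Hilbert space to functions on Z, each S^~ z being a functional
    of norm at most 1, and contracting the space into L^2(Z). *)
Section Frame.
Context (R : realType) (H : lmodType R[i]) (dot : H -> H -> R[i]).
Hypothesis hH : hilbert_axioms dot.
Local Notation nrm := (hnorm dot).
Local Notation "x %:C" := ((x%:C)%C).
Context d (Z : measurableType d) (pi : {measure set Z -> \bar R}).
Context (S : H -> Z -> R[i]).
Hypothesis Smeas : forall f, cmeasurable (S f).
Hypothesis Slin : forall a f g z, S (a *: f + g) z = a * S f z + S g z.
Hypothesis Sbound : forall f z, normc (S f z) <= nrm f.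
Hypothesis Ssqint : forall f, (sqint pi (S f) <= ((nrm f) ^+ 2)%:E)%E.

(** Hoelder's inequality for h w^(1/r) and w^(1/q) with 1/r + 1/q = 1. *)
Lemma jensen_weight (r : R) (h w : Z -> R) : 1 <= r ->
  measurable_fun setT h -> measurable_fun setT w ->
  (forall z, 0 <= h z) -> (forall z, 0 <= w z) ->
  (\int[pi]_z (w z)%:E <= 1)%E ->
  ((\int[pi]_z (h z * w z)%:E) `^ r <= \int[pi]_z (h z `^ r * w z)%:E)%E.
Proof.
move=> r1 mh mw h0 w0 wle.
have r0 : 0 < r by exact: lt_le_trans r1.
have int0 (k : Z -> R) : (forall z, 0 <= k z) -> (0 <= \int[pi]_z (k z)%:E)%E.
  by move=> k0; apply: integral_ge0 => z _; rewrite lee_fin.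
have [r1'|rN1] := eqVneq r 1.
  rewrite r1' poweRe1; last by apply: int0 => z; rewrite mulr_ge0.
  by rewrite le_eqVlt; apply/orP; left; apply/eqP/eq_integral => z _; rewrite powRr1.
have r_gt1 : 1 < r by rewrite lt_def rN1.
pose q := (1 - r^-1)^-1.
have r1V : r^-1 < 1 by rewrite invf_lt1.
have q0 : 0 < q by rewrite invr_gt0 subr_gt0.
have rq : r^-1 + q^-1 = 1 by rewrite invrK addrC subrK.
pose f z := h z * w z `^ r^-1; pose g z := w z `^ q^-1.
have mpow s : measurable_fun setT (fun z => w z `^ s).
  exact: (measurableT_comp (measurable_powR s)).
have mf : measurable_fun setT f by exact: measurable_funM.
have mg : measurable_fun setT g by exact: mpow.
have := hoelder pi mf mg r0 q0 rq.
have wV (s : R) z : s != 0 -> (w z `^ s^-1) `^ s = w z.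
  by move=> s0; rewrite -powRrM mulVf// powRr1.
have -> : ('N[pi]_1[EFin \o (f \* g)%R] = \int[pi]_z (h z * w z)%:E)%E.
  rewrite Lnorm1; apply: eq_integral => z _ /=.
  rewrite ger0_norm ?mulr_ge0 ?powR_ge0// /f /g -mulrA -powRD ?rq ?oner_eq0//.
  by rewrite powRr1.
have gle : ('N[pi]_q%:E[EFin \o g] <= 1)%E.
  rewrite unlock (eq_integral (fun z => (w z)%:E)); last first.
    by move=> z _; rewrite /= ger0_norm ?powR_ge0// /g wV// gt_eqF.
  rewrite -(poweR1r q^-1); apply: gt0_ler_poweR => //.
  - by rewrite invr_ge0 ltW.
  - by rewrite in_itv/= leey int0.
  - by rewrite in_itv/= leey andbT lee_fin.
move=> hold; rewrite -[leRHS](_ : ('N[pi]_r%:E[EFin \o f] `^ r = _)%E).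
  apply: gt0_ler_poweR.
  - exact: ltW.
  - by rewrite in_itv/= leey int0// => z; rewrite mulr_ge0.
  - by rewrite in_itv/= leey Lnorm_ge0.
  - by apply: le_trans hold _; rewrite -[leRHS]mule1 lee_wpmul2l ?Lnorm_ge0.
rewrite poweR_Lnorm ?gt_eqF//; apply: eq_integral => z _ /=.
rewrite ger0_norm ?mulr_ge0 ?powR_ge0// /f powRM ?powR_ge0// wV//.
by rewrite gt_eqF.
Qed.

Lemma frame_map_linear z : [/\ S 0 z = 0, (forall a f, S (a *: f) z = a * S f z) &
  (forall f g, S (f - g) z = S f z - S g z)].
Proof.
have S0 : S 0 z = 0.
  by have := Slin (-1) 0 0 z; rewrite scaler0 addr0 mulN1r addNr.
split=> // [a f|f g]; first by rewrite -[_ *: _]addr0 Slin S0 addr0.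
by rewrite [f - g]addrC -scaleN1r Slin mulN1r addrC.
Qed.

(** For unit vectors this weight is bounded by 1 and has integral at most 1, so it
    may stand for a sub-probability density in Jensen's inequality. *)
Definition weight f g z := normc (S f z) * normc (S g z).

Lemma measurable_weight f g : measurable_fun setT (weight f g).
Proof. by apply: measurable_funM; exact: measurable_normc. Qed.

Lemma weight_ge0 f g z : 0 <= weight f g z.
Proof. by rewrite mulr_ge0 ?normc_ge0. Qed.

Lemma weight_int f g : nrm f <= 1 -> nrm g <= 1 ->
  (\int[pi]_z (weight f g z)%:E <= 1)%E.
Proof.
move=> f1 g1.
apply: (@le_trans _ _ (\int[pi]_z (2^-1%:E * ((normc (S f z)) ^+ 2 + (normc (S g z)) ^+ 2)%:E)))%E.
  apply: ge0_le_integral => //.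
  - by move=> z _; rewrite lee_fin weight_ge0.
  - by apply/measurable_EFinP; exact: measurable_weight.
  - apply/measurable_EFinP; apply: measurable_funM => //.
    by apply: measurable_funD; apply: measurable_funX; exact: measurable_normc.
  - move=> z _; rewrite -EFinM lee_fin /weight.
    by have := sqr_ge0 (normc (S f z) - normc (S g z)); nra.
rewrite ge0_integralZl_EFin//; last 2 first.
- by move=> z _; rewrite lee_fin addr_ge0 ?sqr_ge0.
- apply/measurable_EFinP.
  by apply: measurable_funD; apply: measurable_funX; exact: measurable_normc.
under eq_integral do rewrite EFinD.
rewrite ge0_integralD//; last 4 first.
- by move=> z _; rewrite lee_fin sqr_ge0.
- exact: measurable_normc2E.
- by move=> z _; rewrite lee_fin sqr_ge0.
- exact: measurable_normc2E.
have h k : nrm k <= 1 -> (sqint pi (S k) <= 1)%E.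
  move=> k1; apply: le_trans (Ssqint k) _; rewrite lee_fin.
  by rewrite expr_le1// nrm_ge0.
apply: (@le_trans _ _ (2^-1%:E * (1 + 1)))%E.
  by rewrite lee_pmul2l//; apply: leeD; exact: h.
by rewrite -EFinD -EFinM lee_fin mulVf.
Qed.

Lemma weight_le1 f g z : nrm f <= 1 -> nrm g <= 1 -> weight f g z <= 1.
Proof.
move=> f1 g1; rewrite -[leRHS]mulr1 ler_pM ?normc_ge0//.
- exact: le_trans (Sbound _ _) f1.
- exact: le_trans (Sbound _ _) g1.
Qed.

Section Symbol.
Context (p : \bar R) (u : Z -> R[i]).
Hypothesis p1 : (1 <= p)%E.
Hypothesis uLp : cLp pi p u.

Let umeas : cmeasurable u. Proof. by case: uLp. Qed.

Lemma measurable_powu (r : R) : measurable_fun setT (fun z => normc (u z) `^ r).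
Proof.
apply: (measurableT_comp (measurable_powR r)).
exact: measurable_normc.
Qed.

Lemma clnormE (r : R) : r != 0 -> p = r%:E ->
  (clnorm pi p u = (\int[pi]_z (normc (u z) `^ r)%:E) `^ r^-1)%E.
Proof.
move=> r0 ->; rewrite /clnorm unlock; congr (_ `^ _)%E.
by apply: eq_integral => z _; rewrite abse_EFin ger0_norm ?normc_ge0.
Qed.

Lemma weighted_symbol (r : R) f g : p = r%:E -> nrm f <= 1 -> nrm g <= 1 ->
  ((\int[pi]_z (normc (u z) * weight f g z)%:E) `^ r <=
   \int[pi]_z (normc (u z) `^ r * weight f g z)%:E)%E.
Proof.
move=> pr f1 g1; apply: jensen_weight.
- by have := p1; rewrite pr lee_fin.
- exact: measurable_normc.
- exact: measurable_weight.
- by move=> z; exact: normc_ge0.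
- exact: weight_ge0.
- exact: weight_int.
Qed.

(** For p finite, Jensen and the bound w <= 1 pass from the r-th power of the
    integral of |u| w to the integral of |u|^r; for p infinite, the total mass of w is
    enough. *)
Lemma symbol_weight_le f g : nrm f <= 1 -> nrm g <= 1 ->
  (\int[pi]_z (normc (u z) * weight f g z)%:E <= clnorm pi p u)%E.
Proof.
move=> f1 g1.
have int0 : (0 <= \int[pi]_z (normc (u z) * weight f g z)%:E)%E.
  by apply: integral_ge0 => z _; rewrite lee_fin mulr_ge0 ?normc_ge0 ?weight_ge0.
have muw : measurable_fun setT (fun z => normc (u z) * weight f g z).
  by apply: measurable_funM; [exact: measurable_normc|exact: measurable_weight].
have [[r pr]|pr] : (exists r, p = r%:E) \/ p = +oo%E.
- by have := p1; case: (p) => [r _| _|//]; [left; exists r|right].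
- have r1 : 1 <= r by have := p1; rewrite pr lee_fin.
  have r0 : 0 < r by rewrite (lt_le_trans _ r1).
  rewrite (clnormE _ pr) ?gt_eqF//.
  have hle := weighted_symbol pr f1 g1.
  rewrite -[leLHS](poweRe1) // -(divff (lt0r_neq0 r0)) poweRrM.
  apply: gt0_ler_poweR.
  + by rewrite invr_ge0 ltW.
  + by rewrite in_itv/= leey poweR_ge0.
  + rewrite in_itv/= leey integral_ge0// => z _; by rewrite lee_fin powR_ge0.
  + apply: le_trans hle _; apply: ge0_le_integral => //.
    * by move=> z _; rewrite lee_fin mulr_ge0 ?powR_ge0 ?weight_ge0.
    * apply/measurable_EFinP; apply: measurable_funM; first exact: measurable_powu.
      exact: measurable_weight.
    * by apply/measurable_EFinP; exact: measurable_powu.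
    * move=> z _; rewrite lee_fin ler_piMr ?powR_ge0//; exact: weight_le1.
(* The essential supremum norm is 0 by convention when Z has measure 0. *)
- have [_] := uLp; rewrite pr /clnorm unlock.
  case: ifPn => [pi0|]; last first.
    rewrite -leNgt measure_le0 => /eqP pi0 _.
    rewrite (_ : \int[pi]_z _ = 0)%E//; apply/eqP; rewrite eq_le int0 andbT.
    apply: (@le_trans _ _ (\int[pi]_z (cst +oo%E z)))%E.
      by apply: ge0_le_integral => //; [move=> z _;
        rewrite lee_fin mulr_ge0 ?normc_ge0 ?weight_ge0|exact/measurable_EFinP|
        move=> z _; exact: leey].
    by rewrite integral_cst// pi0 mule0.
  set N := ess_sup _ _ => Noo.
  have N0 : (0 <= N)%E.
    by apply: ess_sup_gee => //; apply: nearW => z /=.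
  have Nfin : N \is a fin_num by rewrite ge0_fin_numE.
  apply: (@le_trans _ _ (\int[pi]_z (N * (weight f g z)%:E)))%E.
    apply: ae_ge0_le_integral => //.
    + by move=> z _; rewrite lee_fin mulr_ge0 ?normc_ge0 ?weight_ge0.
    + exact/measurable_EFinP.
    + by move=> z _; rewrite mule_ge0// lee_fin weight_ge0.
    + by apply: measurable_funeM; apply/measurable_EFinP; exact: measurable_weight.
    + have := ess_sup_ge pi (abse \o (fun z => (normc (u z))%:E)).
      apply: filterS => z /= uN _; rewrite EFinM; apply: lee_wpmul2r.
        by rewrite lee_fin weight_ge0.
      by apply: le_trans uN; rewrite lee_fin ler_norm.
  rewrite -(fineK Nfin) ge0_integralZl_EFin//; last 3 first.
  + by move=> z _; rewrite lee_fin weight_ge0.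
  + by apply/measurable_EFinP; exact: measurable_weight.
  + by rewrite fine_ge0.
  by rewrite fineK// -[leRHS]mule1 lee_wpmul2l// weight_int.
Qed.

Definition form f g z := u z * S f z * (S g z)^*.

Lemma cmeasurable_form f g : cmeasurable (form f g).
Proof.
exact: (cmeasurableM (cmeasurableM umeas (Smeas f)) (cmeasurableJ (Smeas g))).
Qed.

Local Notation N := (fine (clnorm pi p u)).

Lemma symbol_norm_ge0 : 0 <= N.
Proof. by rewrite fine_ge0// Lnorm_ge0. Qed.

Lemma symbol_norm_fin : N%:E = clnorm pi p u.
Proof. by rewrite fineK// ge0_fin_numE ?Lnorm_ge0//; case: uLp. Qed.

(** Reduction to vectors of norm at most 1; a zero vector has no unit multiple, and
    is replaced by 0. *)
Lemma form_scale f g : exists f' g', [/\ nrm f' <= 1, nrm g' <= 1 &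
  forall z, form f g z = (nrm f * nrm g)%:C * form f' g' z].
Proof.
have unit k : exists k', nrm k' <= 1 /\ k = (nrm k)%:C *: k'.
  have [k0|k0] := eqVneq (nrm k) 0.
    by exists 0; rewrite (nrm0 hH) k0 scale0r; split; [exact: ler01|exact: (nrm_eq0 hH)].
  exists ((nrm k)^-1%:C *: k); rewrite (nrmZ hH) normc_real.
  rewrite ger0_norm ?invr_ge0 ?nrm_ge0// mulVf//; split => //.
  by rewrite scalerA -realCM divff// scale1r.
have [f' [f1 fE]] := unit f; have [g' [g1 gE]] := unit g.
exists f', g'; split => // z; rewrite /form.
have [_ SZ _] := frame_map_linear z; rewrite {1}fE {1}gE !SZ conjCM conjCR realCM; ring.
Qed.

Lemma form_integrable f g : cintegrable pi (form f g) /\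
  normc (cintegral pi (form f g)) <= N * (nrm f * nrm g).
Proof.
have [f' [g' [f1 g1 fE]]] := form_scale f g.
have le' : (L1norm pi (form f' g') <= N%:E)%E.
  rewrite symbol_norm_fin; apply: le_trans (symbol_weight_le f1 g1).
  apply: L1norm_le; first exact: cmeasurable_form.
    by apply: measurable_funM; [exact: measurable_normc|exact: measurable_weight].
  by move=> z; rewrite /form !normcM normc_conj mulrA.
have i' : cintegrable pi (form f' g').
  apply/cintegrableP; split; first exact: cmeasurable_form.
  by apply: le_lt_trans le' _; rewrite ltry.
have -> : form f g = fun z => (nrm f * nrm g)%:C * form f' g' z by apply/funext.
split; first exact: cintegrableZ.
rewrite cintegralZ// normcM normc_real ger0_norm ?mulr_ge0 ?nrm_ge0//.
rewrite mulrC ler_wpM2r ?mulr_ge0 ?nrm_ge0// -lee_fin.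
exact: le_trans (normc_cintegral i') le'.
Qed.

Lemma frame_operator_exists : exists T : H -> H, linear T /\
  forall f g, dot (T f) g = cintegral pi (form f g).
Proof.
have hT f : exists w, forall g, dot w g = cintegral pi (form f g).
  pose l g := (cintegral pi (form f g))^*.
  have [|||w hw] := @riesz _ _ _ hH l (N * nrm f).
  - move=> a x y; rewrite /l.
    have [ix _] := form_integrable f x; have [iy _] := form_integrable f y.
    have -> : cintegral pi (form f (a *: x + y)) =
        a^* * cintegral pi (form f x) + cintegral pi (form f y).
      rewrite -cintegral_lin//; apply: eq_cintegral => z.
      by rewrite /form Slin conjCD conjCM; ring.
    by rewrite conjCD conjCM conjCK.
  - by rewrite mulr_ge0 ?symbol_norm_ge0 ?nrm_ge0.
  - move=> v; rewrite normc_conj -mulrA; by have [] := form_integrable f v.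
  by exists w => g; rewrite (dotC hH) -hw conjCK.
have [T hT'] := choice hT; exists T; split => // a x y.
apply: (dot_ext hH) => g; rewrite (dot_linear hH) !hT'.
have [ix _] := form_integrable x g; have [iy _] := form_integrable y g.
rewrite -cintegral_lin//; apply: eq_cintegral => z.
by rewrite /form Slin; ring.
Qed.

Lemma frame_operator_bounded (T : H -> H) :
  (forall f g, dot (T f) g = cintegral pi (form f g)) ->
  forall f, nrm (T f) <= N * nrm f.
Proof.
move=> hT f; have [->|Tf0] := eqVneq (nrm (T f)) 0.
  by rewrite mulr_ge0 ?symbol_norm_ge0 ?nrm_ge0.
have Tf : 0 < nrm (T f) by rewrite lt_def Tf0 nrm_ge0.
rewrite -(ler_pM2r Tf) -expr2 -[leLHS]ger0_norm ?sqr_ge0// -normc_real.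
by rewrite -(dot_nrm hH) hT -mulrA; have [] := form_integrable f (T f).
Qed.

End Symbol.

Lemma clnormJ p u : clnorm pi p (fun z => (u z)^*) = clnorm pi p u.
Proof. by apply: eq_Lnorm => z; rewrite normc_conj. Qed.

(** The adjoint is the operator with the conjugate symbol. *)
Lemma frame_operator_adjoint p u (T : H -> H) : (1 <= p)%E -> cLp pi p u ->
  (forall f g, dot (T f) g = cintegral pi (form u f g)) ->
  exists S, linear S /\ is_adjoint dot T S.
Proof.
move=> p1 [mu_ ulp] hT.
have uJ : cLp pi p (fun z => (u z)^*).
  by split; [exact: cmeasurableJ|rewrite clnormJ].
have [S' [linS hS]] := frame_operator_exists p1 uJ.
exists S'; split => // f g; rewrite hT (dotC hH) hS -cintegralJ.
  by apply: eq_cintegral => z; rewrite /form !conjCM !conjCK; ring.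
by have [] := form_integrable p1 uJ g f.
Qed.

Section Finite.
Context (r : R) (u : Z -> R[i]).
Hypothesis r1 : 1 <= r.
Hypothesis uLp : cLp pi r%:E u.
Context (T : H -> H).
Hypothesis linT : linear T.
Hypothesis Tform : forall f g, dot (T f) g = cintegral pi (form u f g).

Let r0 : 0 < r. Proof. exact: lt_le_trans r1. Qed.

Let r1E : (1 <= r%:E)%E. Proof. by rewrite lee_fin. Qed.

Let umeas : cmeasurable u. Proof. by case: uLp. Qed.

Lemma powu_lty : (\int[pi]_z (normc (u z) `^ r)%:E < +oo)%E.
Proof.
have [_] := uLp; rewrite (clnormE u _ (erefl r%:E)) ?gt_eqF//.
by apply: lty_poweRy; rewrite invr_eq0 gt_eqF.
Qed.

Lemma powu_integrable : pi.-integrable setT (fun z => (normc (u z) `^ r)%:E).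
Proof.
apply/integrableP; split; first by apply/measurable_EFinP; exact: measurable_powu uLp r.
under eq_integral do rewrite abse_EFin ger0_norm ?powR_ge0//.
exact: powu_lty.
Qed.

(** Take g the unit vector along T f, so that |T f| = <T f, g>, and use Jensen
    with |S g| <= 1. *)
Lemma nrm_frame_operator_pow f : nrm f <= 1 ->
  (((nrm (T f)) `^ r)%:E <= \int[pi]_z (normc (u z) `^ r * normc (S f z))%:E)%E.
Proof.
move=> f1; have [->|Tf0] := eqVneq (nrm (T f)) 0.
  rewrite powR0 ?gt_eqF//; apply: integral_ge0 => z _.
  by rewrite lee_fin mulr_ge0 ?powR_ge0 ?normc_ge0.
have Tf : 0 < nrm (T f) by rewrite lt_def Tf0 nrm_ge0.
pose g := (nrm (T f))^-1%:C *: T f.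
have g1 : nrm g <= 1.
  by rewrite (nrmZ hH) normc_real ger0_norm ?invr_ge0 ?nrm_ge0// mulVf.
have -> : nrm (T f) = normc (dot (T f) g).
  rewrite (dotZr hH) conjCR (dot_nrm hH) -realCM normc_real expr2 mulKf//.
  by rewrite ger0_norm// nrm_ge0.
have [iF _] := form_integrable r1E uLp f g.
rewrite Tform -poweR_EFin.
apply: (@le_trans _ _ ((\int[pi]_z (normc (u z) * weight f g z)%:E) `^ r)%E).
  apply: gt0_ler_poweR.
  - exact: ltW.
  - by rewrite in_itv/= leey andbT lee_fin sqrtr_ge0.
  - rewrite in_itv/= leey integral_ge0// => z _.
    by rewrite lee_fin mulr_ge0 ?normc_ge0 ?weight_ge0.
  - apply: le_trans (normc_cintegral iF) _; apply: L1norm_le.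
    + exact: cmeasurable_form uLp f g.
    + by apply: measurable_funM; [exact: measurable_normc|exact: measurable_weight].
    + by move=> z; rewrite /form !normcM normc_conj mulrA.
apply: le_trans (weighted_symbol r1E uLp erefl f1 g1) _.
have mu_ := measurable_powu uLp r.
apply: ge0_le_integral => //.
- by move=> z _; rewrite lee_fin mulr_ge0 ?powR_ge0 ?weight_ge0.
- by apply/measurable_EFinP; apply: measurable_funM => //; exact: measurable_weight.
- by apply/measurable_EFinP; apply: measurable_funM => //; exact: measurable_normc.
- move=> z _; rewrite lee_fin ler_wpM2l ?powR_ge0// ler_piMr ?normc_ge0//.
  exact: le_trans (Sbound _ _) g1.
Qed.

(** Evaluation at z is a bounded functional, hence a scalar product. *)
Lemma frame_coef_cvg (x : nat -> H) z :
  (forall v, normc (dot (x n) v) @[n --> \oo] --> (0 : R)) ->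
  normc (S (x n) z) @[n --> \oo] --> (0 : R).
Proof.
move=> x0; have [|||w Sw] := @riesz _ _ _ hH (S^~ z) 1 => //.
- by move=> a f g; rewrite Slin.
- by move=> v; rewrite mul1r Sbound.
- by under eq_fun do rewrite Sw; exact: x0.
Qed.

(** Along a weakly convergent subsequence the differences are weakly null, so
    their images under S tend to 0 pointwise and dominated convergence applies to
    [nrm_frame_operator_pow]. *)
Lemma frame_operator_compact : compact_op dot T.
Proof.
move=> x [M xM]; have [k [y [k_incr ky]]] := weak_compact hH xM.
exists k, (T y); split => //.
(* C rescales the differences into the unit ball. *)
pose C := `|M| + nrm y + 1.
have C0 : 0 < C by rewrite ltr_wpDl// addr_ge0// nrm_ge0.
pose f n := (C^-1)%:C *: (x (k n) - y).
have f1 n : nrm (f n) <= 1.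
  rewrite (nrmZ hH) normc_real ger0_norm ?invr_ge0 ?(ltW C0)//.
  rewrite ler_pdivrMl// mulr1 (le_trans (ler_nrmD hH _ _))// (nrmN hH) /C.
  rewrite -[leLHS]addr0 lerD// lerD2r (le_trans (xM _))// ler_norm//.
have [T0 TD TB TZ] := linear_maps linT.
have fS z : normc (S (f n) z) @[n --> \oo] --> (0 : R).
  apply: frame_coef_cvg => v; under eq_fun do rewrite (dotZl hH) normcM.
  by rewrite -(mulr0 (normc (C^-1)%:C)); apply: cvgMr; exact: ky.
have mw n : measurable_fun setT (fun z => normc (u z) `^ r * normc (S (f n) z)).
  by apply: measurable_funM; [exact: measurable_powu uLp r|exact: measurable_normc].
have I0 : (\int[pi]_z (normc (u z) `^ r * normc (S (f n) z))%:E)%E @[n --> \oo]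
    --> 0%E.
  have := @dominated_cvg _ _ _ pi setT measurableT
    (fun n z => (normc (u z) `^ r * normc (S (f n) z))%:E) (fun=> 0%E)
    (fun z => (normc (u z) `^ r)%:E).
  rewrite integral0; apply => //.
  - by move=> n; apply/measurable_EFinP.
  - move=> z _; apply: cvg_EFin; first exact: nearW.
    by rewrite -(mulr0 (normc (u z) `^ r)); apply: cvgMr; exact: fS.
  - exact: powu_integrable.
  - move=> n z _; rewrite abse_EFin lee_fin ger0_norm ?mulr_ge0 ?powR_ge0 ?normc_ge0//.
    by rewrite ler_piMr ?powR_ge0// (le_trans (Sbound _ _)).
have Tf0 : nrm (T (f n)) @[n --> \oo] --> (0 : R).
  apply/cvgr0Pnorm_lt => eps eps0.
  have er : (0 < (eps `^ r)%:E)%E by rewrite lte_fin powR_gt0.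
  have := I0 => /(_ [set e | e < (eps `^ r)%:E]%E) [].
    exact: open_ereal_lt'.
  move=> N _ hN; exists N => // n /= Nn; rewrite ger0_norm ?nrm_ge0// ltNge.
  apply/negP => epsle; have := le_lt_trans (nrm_frame_operator_pow (f1 n)) (hN n Nn).
  rewrite lte_fin ltNge => /negP; apply.
  by apply: ge0_ler_powR; rewrite ?nnegrE ?nrm_ge0 ?(ltW r0) ?(ltW eps0).
have -> : (fun n => nrm (T (x (k n)) - T y)) = fun n => C * nrm (T (f n)).
  apply/funext => n; rewrite /f TZ TB (nrmZ hH) normc_real.
  by rewrite ger0_norm ?invr_ge0 ?(ltW C0)// mulVKf// gt_eqF.
by rewrite -(mulr0 C); apply: cvgMr.
Qed.

Section AbsoluteValue.
Context (A : H -> H).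
Hypothesis absA : is_absolute_value dot T A.

(** Polarization: the quadratic form of A is real at x + y and at x + i y. *)
Lemma absolute_value_sa x y : dot (A x) y = dot x (A y).
Proof.
have [linA _ A0 _] := absA; have [_ AD _ AZ] := linear_maps linA.
have real v : complex.Im (dot (A v) v) = 0.
  by have := A0 v; rewrite lecE => /andP[/eqP].
have h1 := real (x + y); have h2 := real (x + 'i%C *: y).
move: h1 h2; rewrite !AD AZ !(dotDl hH) !(dotDr hH) !(dotZl hH) !(dotZr hH).
rewrite !(ImD, ImM, ReM, ImJ, ReJ) /= !real (dotC hH (A y) x).
move=> h1 h2; apply: complex_eqP; rewrite ?ReJ ?ImJ.
  by move: h2; rewrite ?(mul0r, mul1r, mulr0, oppr0, addr0, add0r, subr0, mulN1r, sub0r, mulrN1); lra.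
by move: h1; rewrite ?ImJ; lra.
Qed.

(** With f_i = T e_i / l_i, again orthonormal because T^*T = A^2, one has
    l_i = <T e_i, f_i>; Jensen bounds each l_i^r and Bessel bounds the sum of the
    weights by 1. *)
Lemma singular_sum (I : finType) (e : I -> H) (l : I -> R) :
  (forall i j, dot (e i) (e j) = (i == j)%:R) -> (forall i, 0 < l i) ->
  (forall i, A (e i) = (l i)%:C *: e i) ->
  ((\sum_i l i `^ r)%:E <= \int[pi]_z (normc (u z) `^ r)%:E)%E.
Proof.
move=> eo l0 Ae.
have [_ _ _ [T' [TT' AT]]] := absA.
pose f i := (l i)^-1%:C *: T (e i).
have fo i j : dot (f i) (f j) = (i == j)%:R.
  rewrite (dotZl hH) (dotZr hH) TT' -AT !Ae.
  have [_ _ _ AZ] := linear_maps (let: And4 h _ _ _ := absA in h).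
  rewrite AZ Ae !(dotZr hH) eo !conjCR.
  have [->|_] := eqVneq i j; last by rewrite !mulr0.
  by rewrite mulr1 -!realCM mulrA -invfM mulVf// mulf_neq0 ?gt_eqF.
have nrm1 (g : I -> H) (i : I) : (forall i j, dot (g i) (g j) = (i == j)%:R) -> nrm (g i) = 1.
  by move=> go; rewrite /hnorm go eqxx sqrtr1.
have bes (g : I -> H) z : (forall i j, dot (g i) (g j) = (i == j)%:R) ->
    \sum_i normc (S (g i) z) ^+ 2 <= 1.
  move=> go; rewrite -[leRHS](expr1n _ 2); apply: (bessel hH (l := S^~ z)) => //.
  - move=> i j; rewrite go; case: eqVneq => //= ij.
    by have := nrm1 _ i go; case: eqVneq => // ->; rewrite (nrm0 hH) => /eqP; rewrite eq_sym oner_eq0.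
  - by move=> a x y; rewrite Slin.
  - by move=> v; rewrite mul1r.
have lE i : (l i)%:C = dot (T (e i)) (f i).
  rewrite (dotZr hH) conjCR TT' -AT Ae.
  have [_ _ _ AZ] := linear_maps (let: And4 h _ _ _ := absA in h).
  by rewrite AZ Ae !(dotZr hH) eo eqxx !conjCR mulr1 -realCM -realCM mulKf ?gt_eqF.
have step i : ((l i `^ r)%:E <= \int[pi]_z (normc (u z) `^ r * weight (e i) (f i) z)%:E)%E.
  have e1 : nrm (e i) <= 1 by rewrite nrm1.
  have f1 : nrm (f i) <= 1 by rewrite nrm1.
  apply: le_trans (weighted_symbol r1E uLp erefl e1 f1).
  have [iF _] := form_integrable r1E uLp (e i) (f i).
  rewrite -poweR_EFin; apply: gt0_ler_poweR.
  - exact: ltW.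
  - by rewrite in_itv/= leey lee_fin ltW.
  - rewrite in_itv/= leey integral_ge0// => z _.
    by rewrite lee_fin mulr_ge0 ?normc_ge0 ?weight_ge0.
  - have -> : l i = normc (cintegral pi (form u (e i) (f i))).
      by rewrite -Tform -lE normc_real gtr0_norm.
    apply: le_trans (normc_cintegral iF) _; apply: L1norm_le.
    + exact: cmeasurable_form uLp _ _.
    + by apply: measurable_funM; [exact: measurable_normc|exact: measurable_weight].
    + by move=> z; rewrite /form !normcM normc_conj mulrA.
have mu_ := measurable_powu uLp r.
rewrite -sumEFin; apply: (@le_trans _ _
    (\sum_i \int[pi]_z (normc (u z) `^ r * weight (e i) (f i) z)%:E)%E).
  by apply: lee_sum => i _; exact: step.
rewrite -ge0_integral_sum//; last 2 first.
- by move=> i; apply/measurable_EFinP; apply: measurable_funM => //; exact: measurable_weight.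
- by move=> i z _; rewrite lee_fin mulr_ge0 ?powR_ge0 ?weight_ge0.
apply: ge0_le_integral => //.
- by move=> z _; apply: sume_ge0 => i _; rewrite lee_fin mulr_ge0 ?powR_ge0 ?weight_ge0.
- apply: emeasurable_sum => i; apply/measurable_EFinP; apply: measurable_funM => //.
  exact: measurable_weight.
- exact/measurable_EFinP.
- move=> z _; rewrite sumEFin lee_fin -mulr_sumr ler_piMr ?powR_ge0//.
  apply: (@le_trans _ _ (2^-1 * (\sum_i normc (S (e i) z) ^+ 2 + \sum_i normc (S (f i) z) ^+ 2))).
    rewrite -big_split mulr_sumr; apply: ler_sum => i _ /=.
    by rewrite /weight; have := sqr_ge0 (normc (S (e i) z) - normc (S (f i) z)); nra.
  by have := bes e z eo; have := bes f z fo; lra.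
Qed.

Local Notation X := (fine (\int[pi]_z (normc (u z) `^ r)%:E)%E).

Lemma powu_integral_fin : (\int[pi]_z (normc (u z) `^ r)%:E)%E = X%:E.
Proof.
rewrite fineK// ge0_fin_numE ?powu_lty//; apply: integral_ge0 => z _.
by rewrite lee_fin powR_ge0.
Qed.

Lemma eigen_orthonormal (l : R) n (v : 'I_n -> H) :
  (forall c : 'I_n -> R[i], \sum_(i < n) c i *: v i = 0 -> forall i, c i = 0) ->
  (forall i, A (v i) = l%:C *: v i) ->
  exists e : 'I_n -> H, (forall i, A (e i) = l%:C *: e i) /\
    (forall i j, dot (e i) (e j) = (i == j)%:R).
Proof.
move=> vfree Av; have [linA _ _ _] := absA.
have [A0 AD _ AZ] := linear_maps linA.
apply: (orthonormal_of_free hH (P := fun x => A x = l%:C *: x) _ _ vfree Av).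
  by rewrite A0 scaler0.
move=> a x y Ax Ay; rewrite linA Ax Ay scalerDr !scalerA; congr (_ *: _ + _).
by rewrite mulrC.
Qed.

(** [singular_sum] bounds the size of independent families of eigenvectors, so
    the supremum in [multiplicity] is a maximum. *)
Lemma multiplicity_attained (l : R) : 0 < l -> exists n (e : 'I_n -> H),
  [/\ multiplicity A l = n%:R%:E, (forall i, A (e i) = l%:C *: e i) &
      (forall i j, dot (e i) (e j) = (i == j)%:R)].
Proof.
move=> l0.
pose P n := `[< exists v : 'I_n -> H,
  (forall c : 'I_n -> R[i], \sum_(i < n) c i *: v i = 0 -> forall i, c i = 0) /\
  (forall i, A (v i) = l%:C *: v i) >].
have P0 : P 0%N by apply/asboolP; exists (fun=> 0); split=> [c _ []|[]].
have [m hm] : exists m : nat, forall n, P n -> (n <= m)%N.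
  have [m hm] : exists m : nat, X / l `^ r < m%:R.
    by exists (Num.truncn (X / l `^ r)).+1; exact: truncnS_gt.
  exists m => n /asboolP[v [vfree Av]]; rewrite -(ler_nat R).
  apply: le_trans (ltW hm); rewrite ler_pdivlMr ?powR_gt0//.
  have [e [Ae eo]] := eigen_orthonormal vfree Av.
  have h := singular_sum eo (fun=> l0) Ae.
  by rewrite powu_integral_fin lee_fin sumr_const card_ord -mulr_natl in h.
have exP : exists n, P n by exists 0%N.
have [n Pn nmax] := ex_maxnP exP hm.
move/asboolP : (Pn) => [v [vfree Av]].
have [e [Ae eo]] := eigen_orthonormal vfree Av.
exists n, e; split => //; apply/eqP; rewrite eq_le; apply/andP; split.
  apply: ge_ereal_sup => _ [k Pk <-]; rewrite lee_fin ler_nat.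
  by apply: nmax; exact/asboolP.
by apply: ereal_sup_ubound; exists n => //; exact/asboolP.
Qed.

(** For a self-adjoint operator, eigenvectors of distinct eigenvalues are
    orthogonal, so the families attaining the multiplicities of finitely many
    eigenvalues form one orthonormal family. *)
Lemma singular_esum :
  (\esum_(l in [set l : R | (0 < l)%R]) (multiplicity A l * (l `^ r)%:E) <= X%:E)%E.
Proof.
apply: ge_ereal_sup => _ [F [Ffin F0] <-].
rewrite fsbig_finite//=; set s := (X in (\sum_(x <- X) _)%E).
have s0 l : l \in s -> 0 < l.
  by move=> ls; apply: F0; rewrite -(fset_setK Ffin).
have us : uniq s by exact: finmap.fset_uniq.
rewrite big_tnth.
pose t i := tnth (in_tuple s) i.
have t0 i : 0 < t i by apply: s0; exact: mem_tnth.
pose N i := sval (cid (multiplicity_attained (t0 i))).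
pose E i : 'I_(N i) -> H := sval (cid (svalP (cid (multiplicity_attained (t0 i))))).
have hE i : [/\ multiplicity A (t i) = (N i)%:R%:E, (forall k, A (E i k) = (t i)%:C *: E i k) &
    (forall j k, dot (E i j) (E i k) = (j == k)%:R)].
  exact: (svalP (cid (svalP (cid (multiplicity_attained (t0 i)))))).
have -> : (\sum_(i < size s) (multiplicity A (t i) * (t i `^ r)%:E) =
    (\sum_(i < size s) \sum_(k < N i) t i `^ r)%:E)%E.
  rewrite -sumEFin; apply: eq_bigr => i _; have [-> _ _] := hE i.
  by rewrite -EFinM sumr_const card_ord mulr_natl.
rewrite (sig_big_dep xpredT (fun _ => xpredT) (fun i (k : 'I_(N i)) => t i `^ r))/=.
rewrite -powu_integral_fin.
apply: (@singular_sum _ (fun p : {i : 'I_(size s) & 'I_(N i)} => E (tag p) (tagged p))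
  (fun p => t (tag p))) => [[i k] [j l]| p |p] //=; last first.
  by have [_ -> _] := hE (tag p).
have [ij|ij] := eqVneq i j.
  rewrite -{}ij in l *; have [_ _ ->] := hE i.
  by rewrite -[existT _ i l]/(Tagged (fun i => 'I_(N i)) l) eq_Tagged.
have [pq|_] := eqVneq (existT (fun i => 'I_(N i)) i k) (existT _ j l).
  by move: (congr1 tag pq) => /= e; rewrite e eqxx in ij.
have := absolute_value_sa (E i k) (E j l).
have [_ -> _] := hE i; have [_ -> _] := hE j.
rewrite (dotZl hH) (dotZr hH) conjCR => /eqP; rewrite -subr_eq0 -mulrBl -realCB.
rewrite mulf_eq0 => /orP[|/eqP//]; rewrite (inj_eq (@complexI R) _ 0) subr_eq0.
by rewrite /t !(tnth_nth 0)/= nth_uniq // (inj_eq val_inj) (negbTE ij).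
Qed.

End AbsoluteValue.
End Finite.

(** For p infinite the Schatten norm is the operator norm, bounded directly; for p
    finite, [singular_esum] is applied to the absolute value. *)
Theorem frame_operator_schatten (p : \bar R) (u : Z -> R[i]) :
  (1 <= p)%E -> cLp pi p u ->
  exists T : {linear H -> H},
    [/\ forall f g, cintegrable pi (form u f g) /\
          dot (T f) g = cintegral pi (form u f g),
        schatten_class dot p T &
        (schatten_norm dot p T <= clnorm pi p u)%E].
Proof.
move=> p1 up; have [T [linT hT]] := frame_operator_exists p1 up.
pose T' : {linear H -> H} := HB.pack T (GRing.isLinear.Build _ _ _ _ T linT).
have Tb := frame_operator_bounded p1 up hT.
have bT : bounded_op dot T by exists (fine (clnorm pi p u)).
exists T'; rewrite [X in schatten_class _ _ X](_ : _ = T)//.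
rewrite [X in schatten_norm _ _ X](_ : _ = T)//.
suff [h1 h2] : schatten_class dot p T /\ (schatten_norm dot p T <= clnorm pi p u)%E.
  by split => // f g; split; [have [] := form_integrable p1 up f g|exact: hT].
have [[r pr]|pr] : (exists r, p = r%:E) \/ p = +oo%E.
- by case: (p) p1 => [r _| _|//]; [left; exists r|right].
- rewrite pr in p1 up *; have r1 : 1 <= r by rewrite lee_fin in p1.
  have r0 : 0 < r by exact: lt_le_trans r1.
  have [S' [linS TS]] := frame_operator_adjoint p1 up hT.
  have [A0 hA0] := absolute_value_exists hH linT linS bT TS.
  have absA : is_absolute_value dot T (absolute_value dot T).
    exact: (xgetPex _ (ex_intro _ A0 hA0)).
  have le : (schatten_norm dot r%:E T <= clnorm pi r%:E u)%E.
    rewrite (clnormE u _ (erefl r%:E)) ?gt_eqF// (powu_integral_fin r1 up).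
    have hs := singular_esum r1 up hT absA.
    apply: gt0_ler_poweR => //.
    + by rewrite invr_ge0 ltW.
    + rewrite in_itv/= leey andbT; apply: esum_ge0 => l l0.
      rewrite mule_ge0 ?lee_fin ?powR_ge0//; apply: ereal_sup_ubound.
      by exists 0%N => //; exists (fun=> 0); split=> [c _ []|[]].
    + by rewrite in_itv/= leey andbT; rewrite -(powu_integral_fin r1 up) integral_ge0// => z _;
        rewrite lee_fin powR_ge0.
  split; last exact: le.
  split; first exact: (frame_operator_compact r1 up linT hT).
  by apply: le_lt_trans le _; case: up.
- rewrite pr in p1 up Tb *; split; first exact: bT.
  apply: ge_ereal_sup => _ [v v1 <-].
  have [_ ufin] := up.
  rewrite -[leRHS]fineK; last by rewrite ge0_fin_numE ?Lnorm_ge0.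
  rewrite lee_fin (le_trans (Tb v))// ler_piMr// fine_ge0// Lnorm_ge0//.
Qed.

End Frame.

(** * Completeness of the square-integrable functions *)

Section SquareIntegrable.
Context (R : realType) d (T : measurableType d) (mu : {measure set T -> \bar R}).

Lemma fatou_cvg (h : nat -> T -> R) (g : T -> R) (b : nat -> \bar R) (B : \bar R) :
  (forall n, measurable_fun setT (h n)) -> measurable_fun setT g ->
  (forall n x, 0 <= h n x) ->
  {ae mu, forall x, h n x @[n --> \oo] --> g x} ->
  (forall n, (\int[mu]_x (h n x)%:E <= b n)%E) -> b n @[n --> \oo] --> B ->
  (\int[mu]_x (g x)%:E <= B)%E.
Proof.
move=> mh mg h0 hg hb bB.
have mhE n : measurable_fun setT (EFin \o h n) by exact/measurable_EFinP.
have ae_eq : {ae mu, forall x, setT x -> ((g x)%:E = limn_einf (fun n => (h n x)%:E))%E}.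
  apply: filterS hg => x hx _; have : (h n x)%:E @[n --> \oo] --> (g x)%:E.
    by apply: cvg_EFin => //; exact: nearW.
  by move=> /cvg_limn_einf_sup[-> _].
have ml : measurable_fun setT (fun x => limn_einf (fun n => (h n x)%:E)).
  have -> : (fun x => limn_einf (fun n => (h n x)%:E)) =
      (fun x => - limn_esup (fun n => (- (h n x)%:E)))%E.
    by apply/funext => x; rewrite [limn_esup _](limn_esupN (fun n => (h n x)%:E)) oppeK.
  apply: measurableT_comp => //.
  apply: (@measurable_fun_limn_esup _ _ _ _ (fun n x => (- (h n x)%:E)%E)) => n.
  by apply: measurableT_comp => //; exact: mhE.
rewrite (ae_eq_integral (fun x => limn_einf (fun n => (h n x)%:E)))//; last exact/measurable_EFinP.
apply: le_trans (fatou mu measurableT mhE _) _.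
  by move=> n x _; rewrite lee_fin.
rewrite limn_einf_lim -(cvg_lim _ bB)//; apply: lee_lim.
- exact: is_cvg_einfs.
- by apply/cvg_ex; exists B.
- apply: nearW => n; apply: le_trans (hb n); apply: ereal_inf_lbound.
  by exists n => //=.
Qed.

Lemma fast_cauchy_cvg (a : nat -> R) (c : R) :
  (forall j, `|a j.+1 - a j| <= c * 2^-1 ^+ j) -> cvgn a.
Proof.
move=> ac.
have c0 : 0 <= c by have := ac 0%N; rewrite expr0 mulr1; exact: le_trans.
have : cvgn (series (telescope a)).
  apply: normed_cvg; apply: (@series_le_cvg _ _ (geometric c 2^-1)) => //.
  - by move=> n /=.
  - by move=> n /=; rewrite mulr_ge0 ?exprn_ge0.
  - apply: is_cvg_geometric_series; rewrite ger0_norm// invf_lt1//.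
    by rewrite ltr1n.
rewrite telescopeK => h.
have -> : a = (fun n => (a n - a 0%N) + a 0%N) by apply/funext => n; rewrite subrK.
by apply: is_cvgD => //; exact: is_cvg_cst.
Qed.

Lemma sqint_scale (f : T -> R[i]) (c : R) : cmeasurable f -> 0 <= c ->
  (\int[mu]_x (c * normc (f x) ^+ 2)%:E = c%:E * sqint mu f)%E.
Proof.
move=> mf c0; apply: ge0_integralZlR => // [|x]; last exact: sqr_ge0.
by apply: measurable_funX; exact: measurable_normc.
Qed.

(** The limit is taken pointwise and is given by a formula that depends on the
    sequence of values only, so that it inherits every invariance of the
    functions of the sequence. *)
Definition seq_limit (k : nat -> nat) (s : nat -> R[i]) : R[i] :=
  Complex (fine (limn_esup (fun n => (complex.Re (s (k n)))%:E)))
          (fine (limn_esup (fun n => (complex.Im (s (k n)))%:E))).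

Lemma seq_limitP k (s : nat -> R[i]) :
  cvgn (fun n => complex.Re (s (k n))) -> cvgn (fun n => complex.Im (s (k n))) ->
  normc (s (k n) - seq_limit k s) @[n --> \oo] --> (0 : R).
Proof.
move=> cr ci.
have lim_re (a : nat -> R) : cvgn a -> a n @[n --> \oo] -->
    fine (limn_esup (fun n => (a n)%:E)).
  move=> ca; have : (a n)%:E @[n --> \oo] --> (limn a)%:E.
    by apply: cvg_EFin => //; exact: nearW.
  by move=> /cvg_limn_einf_sup[_ ->].
have h : `|complex.Re (s (k n)) - complex.Re (seq_limit k s)| +
  `|complex.Im (s (k n)) - complex.Im (seq_limit k s)| @[n --> \oo] --> (0 : R).
  rewrite -[X in _ --> X](addr0 0); apply: cvgD; apply/norm_cvg0P/subr_cvg0;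
    exact: lim_re.
apply: squeeze_cvgr (cvg_cst 0) h; apply: nearW => n.
by rewrite normc_ge0/= (le_trans (normc_le_ReIm _))// !(ReD,ImD,ReN,ImN).
Qed.

Lemma cmeasurable_seq_limit k (f : nat -> T -> R[i]) :
  (forall n, cmeasurable (f n)) -> cmeasurable (fun x => seq_limit k (f^~ x)).
Proof.
move=> mf; split => /=.
- apply: (measurableT_comp (fine_measurable measurableT)) => //.
  apply: (@measurable_fun_limn_esup _ _ _ _ (fun n x => (complex.Re (f (k n) x))%:E)).
  by move=> n; apply/measurable_EFinP; case: (mf (k n)).
- apply: (measurableT_comp (fine_measurable measurableT)) => //.
  apply: (@measurable_fun_limn_esup _ _ _ _ (fun n x => (complex.Im (f (k n) x))%:E)).
  by move=> n; apply/measurable_EFinP; case: (mf (k n)).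
Qed.

(** Riesz-Fischer. Along indices k with square increments at most 8^-j, the series
    of 4^j |f_(k j+1) - f_(k j)|^2 has a finite integral, so almost everywhere the
    increments are O(2^-j) and the values converge; Fatou's lemma turns this into
    convergence in square mean. *)
Lemma sqint_cauchy_cvg (f : nat -> T -> R[i]) :
  (forall n, cLp mu 2%:E (f n)) ->
  (forall e : R, 0 < e -> exists N, forall m n, (N <= m)%N -> (N <= n)%N ->
     (sqint mu (fun x => f m x - f n x)%R <= e%:E)%E) ->
  exists k, forall e : R, 0 < e -> exists N, forall n, (N <= n)%N ->
     (sqint mu (fun x => f n x - seq_limit k (f^~ x))%R <= e%:E)%E.
Proof.
move=> fL fC.
have mf n : cmeasurable (f n) by have [] := fL n.
have mfB m n : cmeasurable (fun x => f m x - f n x) by exact: cmeasurableB.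
have e8 j : 0 < (8^-1 ^+ j : R) by rewrite exprn_gt0.
have [N hN] := choice (fun j => fC _ (e8 j)).
pose k := fix k j := if j is j'.+1 then maxn (k j').+1 (N j) else N 0%N.
have kN j : (N j <= k j)%N by case: j => //= j; exact: leq_maxr.
have k_incr : {homo k : m n / (m < n)%N}.
  by apply: homo_ltn => [y x z|j]; [exact: ltn_trans|rewrite /= leq_maxl].
have kge j : (j <= k j)%N.
  by elim: j => // j IHj; apply: leq_ltn_trans IHj _; exact: k_incr.
exists k.
pose dj j x := f (k j.+1) x - f (k j) x.
have sd j : (sqint mu (dj j) <= (8^-1 ^+ j)%:E)%E.
  by apply: hN => //; apply: leq_trans (kN j) _ => //; apply: ltnW; exact: k_incr.
pose W x := (\sum_(0 <= j <oo) (4 ^+ j * normc (dj j x) ^+ 2)%:E)%E.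
have W0 j x : (0 <= (4 ^+ j * normc (dj j x) ^+ 2)%:E)%E.
  by rewrite lee_fin mulr_ge0 ?sqr_ge0 ?exprn_ge0.
have mW j : measurable_fun setT (fun x => (4 ^+ j * normc (dj j x) ^+ 2)%:E).
  apply/measurable_EFinP; apply: measurable_funM => //; apply: measurable_funX.
  exact/measurable_normc/mfB.
have intW : (\int[mu]_x W x <= 2%:E)%E.
  rewrite integral_nneseries//.
  apply: lime_le.
    by apply: is_cvg_nneseries => n _ _; exact: integral_ge0.
  apply: nearW => n; apply: (@le_trans _ _ (\sum_(0 <= j < n) (2^-1 ^+ j)%:E)%E).
    apply: lee_sum => j _; rewrite sqint_scale ?exprn_ge0//; last exact: mfB.
    apply: (@le_trans _ _ ((4 ^+ j)%:E * (8^-1 ^+ j)%:E)%E).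
      by apply: lee_wpmul2l => //; rewrite lee_fin exprn_ge0.
    rewrite -EFinM lee_fin -exprMn (_ : 4 * 8^-1 = 2^-1)//.
    by apply/eqP; rewrite -(inj_eq (mulIf (_ : 8 != 0 :> R))) ?pnatr_eq0// mulfVK ?pnatr_eq0//; apply/eqP; lra.
  rewrite sumEFin lee_fin.
  have := @geometric_le_lim R n 1 2^-1; rewrite mul1r.
  have -> : (1 - 2^-1)^-1 = 2 :> R.
    by rewrite (_ : 1 - 2^-1 = 2^-1) ?invrK//; lra.
  rewrite /series/= => h; apply: le_trans (h _ _ _) => //; last first.
    by rewrite ger0_norm// invf_lt1// ltr1n.
  by apply: ler_sum => j _; rewrite mul1r.
have Wint : mu.-integrable setT W.
  apply/integrableP; split.
    by apply: ge0_emeasurable_sum.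
  under eq_integral do rewrite gee0_abs ?nneseries_ge0//.
  by apply: le_lt_trans intW _; rewrite ltry.
have cv : {ae mu, forall x, normc (f (k n) x - seq_limit k (f^~ x)) @[n --> \oo] --> (0 : R)}.
  apply: filterS (integrable_ae measurableT Wint) => x /(_ I) Wx.
  have bd j : normc (dj j x) <= Num.sqrt (fine (W x)) * 2^-1 ^+ j.
    have W0' : 0 <= fine (W x) by rewrite fine_ge0// nneseries_ge0.
    rewrite -(ler_pXn2r (n := 2))// ?nnegrE ?normc_ge0 ?mulr_ge0 ?sqrtr_ge0 ?exprn_ge0//.
    rewrite exprMn sqr_sqrtr// -exprM mulnC exprM (_ : 2^-1 ^+ 2 = 4^-1 :> R); last by lra.
    rewrite exprVn ler_pdivlMr ?exprn_gt0// mulrC -lee_fin fineK//.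
    apply: le_trans (nneseries_lim_ge j.+1 _); last by move=> i _ _; exact: W0.
    rewrite big_nat_recr//= leeDr//.
    by apply: sume_ge0 => i _; exact: W0.
  apply: seq_limitP; apply: fast_cauchy_cvg => j.
    by apply: le_trans (bd j); rewrite -ReN -ReD ler_Re_normc.
  by apply: le_trans (bd j); rewrite -ImN -ImD ler_Im_normc.
move=> e e0; have [M hM] := fC e e0; exists M => n Mn.
have mg := cmeasurable_seq_limit k mf.
apply: (@fatou_cvg (fun j x => normc (f n x - f (k (M + j)%N) x) ^+ 2) _ (fun=> e%:E)).
- by move=> j; apply: measurable_funX; apply: measurable_normc; exact: mfB.
- by apply: measurable_funX; apply: measurable_normc; exact: cmeasurableB.
- by move=> j x; exact: sqr_ge0.
- apply: filterS cv => x cx.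
  have h : normc (f n x - f (k (M + j)%N) x) @[j --> \oo] -->
      normc (f n x - seq_limit k (f^~ x)).
    apply/subr_cvg0/norm_cvg0P.
    have cx' : normc (f (k (M + j)%N) x - seq_limit k (f^~ x)) @[j --> \oo] --> (0 : R).
      have := cx; rewrite -(cvg_shiftn M (fun j => normc (f (k j) x - seq_limit k (f^~ x)))).
      by under eq_fun do rewrite addnC.
    apply: squeeze_cvgr (cvg_cst 0) cx'; apply: nearW => j.
    rewrite normr_ge0 (le_trans (ler_normc_dist _ _))//.
    by rewrite -normcN le_eqVlt; apply/orP; left; apply/eqP; congr normc; ring.
  by under eq_fun do rewrite expr2; rewrite expr2; exact: cvgM.
- move=> j; apply: hM => //; apply: leq_trans (leq_addr j M) _; exact: kge.
- exact: cvg_cst.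
Qed.

Lemma cprod_ae (f f' g g' : T -> R[i]) : cmeasurable f -> cmeasurable f' ->
  cmeasurable g -> cmeasurable g' ->
  {ae mu, forall x, f x = f' x} -> {ae mu, forall x, g x = g' x} ->
  cprod mu f g = cprod mu f' g'.
Proof.
move=> mf mf' mg mg' ff gg; apply: ae_eq_cintegral.
- by apply: cmeasurableM => //; exact: cmeasurableJ.
- by apply: cmeasurableM => //; exact: cmeasurableJ.
- by apply: (@filterS2 _ _ (ae_filter_ringOfSetsType mu)) ff gg => x -> ->.
Qed.

Lemma sqint_fin (f : T -> R[i]) : cLp mu 2%:E f -> sqint mu f = (fine (sqint mu f))%:E.
Proof. by move=> /cLp2P[_ h]; rewrite fineK// ge0_fin_numE// sqint_ge0. Qed.

Lemma sqint_ae (f g : T -> R[i]) : cmeasurable f -> cmeasurable g ->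
  {ae mu, forall x, f x = g x} -> sqint mu f = sqint mu g.
Proof.
move=> mf mg fg; apply: ae_eq_integral => //; try exact: measurable_normc2E.
by apply: (@filterS _ _ (ae_filter_ringOfSetsType mu)) fg => x ->.
Qed.

Lemma sqint_eq0 (f : T -> R[i]) : cmeasurable f -> sqint mu f = 0%E ->
  {ae mu, forall x, f x = 0}.
Proof.
move=> mf f0.
have := @ae_eq_integral_abs _ _ _ mu setT measurableT
  (fun x => (normc (f x) ^+ 2)%:E) (measurable_normc2E mf).
have -> : (\int[mu]_x `|(normc (f x) ^+ 2)%:E| = 0)%E.
  by rewrite -f0; apply: eq_integral => x _; rewrite abse_EFin ger0_norm// sqr_ge0.
case=> /(_ erefl) h _; apply: (@filterS _ _ (ae_filter_ringOfSetsType mu)) h => x /(_ I) /= [].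
by move=> /eqP; rewrite sqrf_eq0 => /eqP/eq0_normc.
Qed.

End SquareIntegrable.

(** * The Hilbert space of bi-invariant functions *)

Section L2Hilbert.
Context (R : realType) (G : topologicalGroupType).
Context (mu : {measure set (borel G) -> \bar R}) (K : set G).
Local Notation L2 := (L2 mu K).
Local Notation L2_dot := (@L2_dot R G mu K).
Implicit Types (v w : L2) (f g : borel G -> R[i]).

Lemma L2_fun_biinv v : Lp_biinv mu K 2%:E (L2_fun v).
Proof. by rewrite /L2_fun; case: (repr v) => f /=; rewrite inE. Qed.

Lemma L2_fun_Lp v : cLp mu 2%:E (L2_fun v).
Proof. by have [] := L2_fun_biinv v. Qed.

Lemma L2_fun_measurable v : cmeasurable (L2_fun v).
Proof. by have [] := L2_fun_Lp v. Qed.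

Lemma L2_class_fun (f : L2fun mu K) :
  {ae mu, forall x, L2_fun (L2_class f) x = f x}.
Proof.
have : (L2_class (repr (L2_class f)) == L2_class f) by rewrite -L2_repr.
rewrite L2_class_eq inE => h; apply: (@filterS _ _ (ae_filter_ringOfSetsType mu)) h => x /=.
by rewrite fctE opprfctE => /eqP; rewrite subr_eq0 => /eqP.
Qed.

Lemma L2_exists f : Lp_biinv mu K 2%:E f ->
  exists v, {ae mu, forall x, L2_fun v x = f x}.
Proof.
move=> hf; have pf : (f : G -> R[i]^o) \in L2_pred mu K by rewrite inE.
by exists (L2_class (MkL2fun pf)); exact: (L2_class_fun (MkL2fun pf)).
Qed.

Lemma L2_fun_lin (a : R[i]) v w :
  {ae mu, forall x, L2_fun (a *: v + w) x = a * L2_fun v x + L2_fun w x}.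
Proof.
have -> : a *: v + w = L2_class (a *: repr v + repr w).
  by rewrite -L2_addE -L2_scaleE -!L2_repr.
apply: (@filterS _ _ (ae_filter_ringOfSetsType mu)) (L2_class_fun (a *: repr v + repr w)) => x ->.
by [].
Qed.

Lemma L2_nrm v : hnorm L2_dot v ^+ 2 = fine (sqint mu (L2_fun v)).
Proof.
have v2 := L2_fun_Lp v.
by rewrite /hnorm /L2_dot cprod_self//= sqr_sqrtr// fine_ge0// sqint_ge0.
Qed.

Lemma L2_sqint v : sqint mu (L2_fun v) = ((hnorm L2_dot v) ^+ 2)%:E.
Proof. by rewrite L2_nrm -sqint_fin//; exact: L2_fun_Lp. Qed.

(** Completeness is the only point: the limit must be bi-invariant at every point,
    which [seq_limit] ensures as it depends on the values of the sequence only. *)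
Lemma L2_hilbert : hilbert_separable L2_dot -> hilbert_axioms L2_dot.
Proof.
have lin a u v w : L2_dot (a *: u + v) w = a * L2_dot u w + L2_dot v w.
  rewrite -cprod_linl; try exact: L2_fun_Lp.
  apply: cprod_ae; try exact: L2_fun_measurable.
  - by apply: cmeasurable_lin; exact: L2_fun_measurable.
  - exact: L2_fun_lin.
  - exact: aeW.
move=> sep; split => //.
- by move=> u v; apply: cprodC; exact: L2_fun_Lp.
- move=> v; rewrite /L2_dot cprod_self; last exact: L2_fun_Lp.
  by rewrite ler0c fine_ge0// sqint_ge0.
- move=> v; rewrite /L2_dot cprod_self; last exact: L2_fun_Lp.
  move=> /(congr1 (@complex.Re R)) /= v0.
  have /sqint_eq0 h : sqint mu (L2_fun v) = 0%E.
    by rewrite sqint_fin ?v0//; exact: L2_fun_Lp.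
  have {}h := h (L2_fun_measurable v).
  rewrite (L2_repr v) -[RHS](_ : L2_class 0 = 0); last first.
    by apply: (addIr (L2_class 0)); rewrite add0r L2_addE addr0.
  apply/eqP; rewrite L2_class_eq subr0 inE; exact: h.
- move=> x xC; pose f n := L2_fun (x n).
  have fL n : cLp mu 2%:E (f n) by exact: L2_fun_Lp.
  have mf n : cmeasurable (f n) by exact: L2_fun_measurable.
  have mfB m n : cmeasurable (fun x => f m x - f n x) by exact: cmeasurableB.
  have fun_sub v w : {ae mu, forall x, L2_fun (v - w) x = L2_fun v x - L2_fun w x}.
    have := L2_fun_lin (-1) w v; rewrite scaleN1r addrC.
    apply: (@filterS _ _ (ae_filter_ringOfSetsType mu)) => y ->.
    by rewrite mulN1r addrC.
  have fC e : 0 < e -> exists N, forall m n, (N <= m)%N -> (N <= n)%N ->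
      (sqint mu (fun x => f m x - f n x)%R <= e%:E)%E.
    move=> e0; have [|N hN] := xC (Num.sqrt e); first by rewrite sqrtr_gt0.
    exists N => m n Nm Nn; rewrite -(@sqint_ae _ _ _ mu (L2_fun (x m - x n))).
    + rewrite L2_sqint lee_fin -[leRHS]sqr_sqrtr ?(ltW e0)//.
      by rewrite lerXn2r ?nnegrE ?sqrtr_ge0 ?nrm_ge0 ?ltW ?hN.
    + exact: L2_fun_measurable.
    + exact: mfB.
    + exact: fun_sub.
  have [k hk] := sqint_cauchy_cvg fL fC.
  pose g y := seq_limit k (f^~ y).
  have mg : cmeasurable g by exact: cmeasurable_seq_limit.
  have [N hN] := hk 1 ltr01.
  have gL : cLp mu 2%:E g.
    have d2 : cLp mu 2%:E (fun y => f N y - g y).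
      apply/cLp2P; split; first exact: cmeasurableB.
      by apply: le_lt_trans (hN N (leqnn _)) _; rewrite ltry.
    have := cLp2_lin (-1) d2 (fL N); under eq_fun do rewrite mulN1r opprB subrK.
    by [].
  have gb : biinvariant K g.
    move=> y k1 k2 Kk1 Kk2; rewrite /g; congr seq_limit; apply/funext => n.
    by have [_ b] := L2_fun_biinv (x n); exact: b.
  have [y hy] := L2_exists (conj gL gb).
  exists y; apply/cvgr0Pnorm_lt => e e0.
  have e2 : 0 < (e / 2) ^+ 2 by rewrite exprn_gt0// divr_gt0.
  have [M hM] := hk _ e2; exists M => // n /= Mn.
  rewrite ger0_norm ?nrm_ge0//; apply: (@le_lt_trans _ _ (e / 2)); last first.
    by rewrite ltr_pdivrMr// mulr_natr mulr2n ltrDl.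
  rewrite -(ler_pXn2r (n := 2)) ?nnegrE ?nrm_ge0 ?divr_ge0 ?(ltW e0)//.
  rewrite -lee_fin -L2_sqint; apply: le_trans (hM n Mn).
  rewrite le_eqVlt; apply/orP; left; apply/eqP; apply: sqint_ae.
  + exact: L2_fun_measurable.
  + exact: cmeasurableB.
  + apply: (@filterS2 _ _ (ae_filter_ringOfSetsType mu)) (fun_sub (x n) y) hy => z -> ->.
    by [].
Qed.

End L2Hilbert.

(** * Tonelli on rectangles of finite measure *)

(** The measures at hand need not be sigma-finite. Restricting them to sets of
    finite measure brings in Tonelli's theorem without changing the integral of
    functions that vanish elsewhere. *)
Lemma integral_mfrestr (R : realType) d (T : measurableType d)
    (mu : {measure set T -> \bar R}) (D : set T) (mD : measurable D)
    (moo : (mu D < +oo)%E) (f : T -> \bar R) :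
  measurable_fun setT f -> (forall x, (0 <= f x)%E) -> (forall x, ~ D x -> f x = 0%E) ->
  (\int[mfrestr mD moo]_x f x = \int[mu]_x f x)%E.
Proof.
move=> mf f0 fD.
have restr (m : {measure set T -> \bar R}) : (\int[m]_x f x = \int[m]_(x in D) f x)%E.
  rewrite [RHS]integral_mkcond; apply: eq_integral => x _; rewrite patchE.
  by case: ifPn => // /negP xD; apply: fD => Dx; apply: xD; rewrite inE.
rewrite !restr; apply: eq_measure_integral => A mA AD.
by rewrite /= /mfrestr /mrestr setIidl.
Qed.

Section FubiniRectangle.
Context (R : realType) d1 d2 (T1 : measurableType d1) (T2 : measurableType d2).
Context (m1 : {measure set T1 -> \bar R}) (m2 : {measure set T2 -> \bar R}).
Context (C : set T1) (D : set T2) (mC : measurable C) (mD : measurable D).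
Context (Coo : (m1 C < +oo)%E) (Doo : (m2 D < +oo)%E).
Context (F : T1 * T2 -> R).
Hypothesis mF : measurable_fun setT F.
Hypothesis F0 : forall z, 0 <= F z.
Hypothesis FC : forall t x, ~ C t -> F (t, x) = 0.
Hypothesis FD : forall t x, ~ D x -> F (t, x) = 0.

Let mu1 : {finite_measure set T1 -> \bar R} := mfrestr mC Coo.
Let mu2 : {finite_measure set T2 -> \bar R} := mfrestr mD Doo.

Let mFE : measurable_fun setT (EFin \o F).
Proof. exact/measurable_EFinP. Qed.

Let F0E z : (0 <= (EFin \o F) z)%E.
Proof. by rewrite lee_fin. Qed.

Let section1E t : (\int[mu2]_x (F (t, x))%:E = \int[m2]_x (F (t, x))%:E)%E.
Proof.
apply: integral_mfrestr => [|x|x Dx]; last by rewrite FD.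
  by apply/measurable_EFinP; exact: measurableT_comp.
by rewrite lee_fin.
Qed.

Let section2E x : (\int[mu1]_t (F (t, x))%:E = \int[m1]_t (F (t, x))%:E)%E.
Proof.
apply: integral_mfrestr => [|t|t Ct]; last by rewrite FC.
  by apply/measurable_EFinP; exact: measurableT_comp.
by rewrite lee_fin.
Qed.

Lemma measurable_section_integral1 :
  measurable_fun setT (fun t => \int[m2]_x (F (t, x))%:E)%E.
Proof.
have : measurable_fun setT (fun t => \int[mu2]_x (F (t, x))%:E)%E.
  exact: (measurable_fun_fubini_tonelli_F (m2 := mu2) _ mFE F0E).
by under eq_fun do rewrite section1E.
Qed.

Lemma measurable_section_integral2 :
  measurable_fun setT (fun x => \int[m1]_t (F (t, x))%:E)%E.
Proof.
have : measurable_fun setT (fun x => \int[mu1]_t (F (t, x))%:E)%E.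
  exact: (measurable_fun_fubini_tonelli_G (m1 := mu1) _ mFE F0E).
by under eq_fun do rewrite section2E.
Qed.

Let iter1E : (\int[mu1]_t \int[mu2]_x (F (t, x))%:E = \int[m1]_t \int[m2]_x (F (t, x))%:E)%E.
Proof.
transitivity (\int[mu1]_t \int[m2]_x (F (t, x))%:E)%E.
  by apply: eq_integral => t _; exact: section1E.
apply: integral_mfrestr => [|t|t Ct].
- exact: measurable_section_integral1.
- by apply: integral_ge0 => x _; rewrite lee_fin.
- by under eq_integral do rewrite FC//; rewrite integral0.
Qed.

Lemma fubini_rectangle :
  (\int[m1]_t \int[m2]_x (F (t, x))%:E = \int[m2]_x \int[m1]_t (F (t, x))%:E)%E.
Proof.
rewrite -iter1E; transitivity (\int[mu2]_x \int[mu1]_t (F (t, x))%:E)%E.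
  exact: (fubini_tonelli (m1 := mu1) (m2 := mu2) _ mFE F0E).
transitivity (\int[mu2]_x \int[m1]_t (F (t, x))%:E)%E.
  by apply: eq_integral => x _; exact: section2E.
apply: integral_mfrestr => [|x|x Dx].
- exact: measurable_section_integral2.
- by apply: integral_ge0 => t _; rewrite lee_fin.
- by under eq_integral do rewrite FD//; rewrite integral0.
Qed.

(** On C x D the measure pi is finite and agrees on rectangles with the product of
    the restrictions, hence equals it. *)
Lemma product_rectangle (pi : {measure set (T1 * T2)%type -> \bar R}) :
  (forall A B, measurable A -> measurable B -> pi (A `*` B) = (m1 A * m2 B)%E) ->
  (\int[pi]_z (F z)%:E = \int[m1]_t \int[m2]_x (F (t, x))%:E)%E.
Proof.
move=> piE.
have mCD : measurable (C `*` D) by exact: measurableX.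
have piCD : (pi (C `*` D) < +oo)%E.
  by rewrite piE// lte_mul_pinfty// ge0_fin_numE.
pose pi' : {measure set (T1 * T2)%type -> \bar R} := mfrestr mCD piCD.
rewrite -iter1E; transitivity (\int[(mu1 \x mu2)%E]_z (F z)%:E)%E; last first.
  exact: (fubini_tonelli1 (m1 := mu1) (m2 := mu2) _ mFE F0E).
transitivity (\int[pi']_z (F z)%:E)%E.
  apply/esym; apply: integral_mfrestr => [|z|[t x] /= /not_andP[Ct|Dx]].
  - exact: mFE.
  - by rewrite lee_fin.
  - by rewrite FC.
  - by rewrite FD.
apply: eq_measure_integral => A mA _; apply/esym.
apply: (product_measure_unique (m' := pi')) => // A' B mA' mB.
rewrite /= /mfrestr /mrestr (_ : _ `&` _ = (A' `&` C) `*` (B `&` D)); last first.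
  by apply/seteqP; split => -[t x] /=; tauto.
by rewrite piE//; exact: measurableI.
Qed.

End FubiniRectangle.

(** * Continuous functions and Borel sets *)

Section Topology.
Context (R : realType).

Lemma continuous_borel (T : ptopologicalType) (f : T -> R) :
  continuous f -> measurable_fun setT (f : borel T -> R).
Proof.
move=> /continuousP cf; apply: (measurability _ (RGenOpens.measurableE R)).
move=> _ [_ [a [b ->] <-]]; rewrite setTI; apply: sub_sigma_algebra.
by apply: cf; exact: interval_open.
Qed.

Lemma open_borel (T : ptopologicalType) (U : set T) :
  open U -> measurable (U : set (borel T)).
Proof. exact: sub_sigma_algebra. Qed.

Lemma closed_borel (T : ptopologicalType) (U : set T) :
  closed U -> measurable (U : set (borel T)).
Proof.
move=> cU; rewrite -[U]setCK; apply: measurableC; apply: open_borel.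
by rewrite openC.
Qed.

Lemma ccontinuousP (T : topologicalType) (f : T -> R[i]) :
  ccontinuous f <->
  forall x (e : R), 0 < e -> \forall y \near x, normc (f x - f y) < e.
Proof.
have normE (z : R[i]) : `|z| = ((normc z)%:C)%C by case: z.
split=> [cf x e e0|h x].
  have := cf x => /cvgrPdist_lt/(_ (e%:C)%C); rewrite ltcR => /(_ e0).
  by apply: filterS => y; rewrite normE ltcR.
apply/cvgrPdist_lt => e; rewrite ltcE/= => /andP[/eqP ei e0].
have := h x _ e0; apply: filterS => y fy.
by rewrite normE ltcE/= ei eqxx.
Qed.

Lemma continuous_normal (T : topologicalType) (f : T -> R) : continuous f <->
  forall x (e : R), 0 < e -> \forall y \near x, `|f x - f y| < e.
Proof.
split=> [cf x e e0|h x]; first by have := cf x => /cvgrPdist_lt/(_ _ e0).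
by apply/cvgrPdist_lt => e e0; exact: h.
Qed.

Lemma ccontinuous_ReIm (T : topologicalType) (f : T -> R[i]) :
  continuous (fun x => complex.Re (f x)) -> continuous (fun x => complex.Im (f x)) ->
  ccontinuous f.
Proof.
move=> /continuous_normal cr /continuous_normal ci; apply/ccontinuousP => x e e0.
have e2 : 0 < e / 2 by rewrite divr_gt0.
near=> y; apply: le_lt_trans (normc_le_ReIm _) _; rewrite ReD ReN ImD ImN.
rewrite [ltRHS]splitr; apply: ltrD; near: y; [exact: cr|exact: ci].
Unshelve. all: by end_near. Qed.

Lemma ccontinuous_Re (T : topologicalType) (f : T -> R[i]) :
  ccontinuous f -> continuous (fun x => complex.Re (f x)).
Proof.
move=> /ccontinuousP cf; apply/continuous_normal => x e e0.
have := cf x e e0; apply: filterS => y.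
by apply: le_lt_trans; rewrite -ReN -ReD ler_Re_normc.
Qed.

Lemma ccontinuous_Im (T : topologicalType) (f : T -> R[i]) :
  ccontinuous f -> continuous (fun x => complex.Im (f x)).
Proof.
move=> /ccontinuousP cf; apply/continuous_normal => x e e0.
have := cf x e e0; apply: filterS => y.
by apply: le_lt_trans; rewrite -ImN -ImD ler_Im_normc.
Qed.

Lemma ccontinuous_normc (T : topologicalType) (f : T -> R[i]) :
  ccontinuous f -> continuous (fun x => normc (f x)).
Proof.
move=> /ccontinuousP cf; apply/continuous_normal => x e e0.
have := cf x e e0; apply: filterS => y.
by apply: le_lt_trans; exact: ler_normc_dist.
Qed.

Lemma ccontinuous_measurable (T : ptopologicalType) (f : T -> R[i]) :
  ccontinuous f -> cmeasurable (f : borel T -> R[i]).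
Proof.
move=> cf; split; apply: continuous_borel; [exact: ccontinuous_Re|exact: ccontinuous_Im].
Qed.

Lemma ccontinuous_comp (S T : topologicalType) (f : S -> T) (g : T -> R[i]) :
  continuous f -> ccontinuous g -> ccontinuous (g \o f).
Proof. by move=> cf cg x; apply: continuous_comp; [exact: cf|exact: cg]. Qed.

Lemma ccontinuousJ (T : topologicalType) (f : T -> R[i]) :
  ccontinuous f -> ccontinuous (fun x => (f x)^*).
Proof.
move=> /ccontinuousP cf; apply/ccontinuousP => x e e0.
by have := cf x e e0; apply: filterS => y; rewrite -conjCB normc_conj.
Qed.

Lemma ccontinuousM (T : topologicalType) (f g : T -> R[i]) :
  ccontinuous f -> ccontinuous g -> ccontinuous (fun x => f x * g x).
Proof. by move=> cf cg x; apply: cvgM; [exact: cf|exact: cg]. Qed.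

Lemma ccontinuousD (T : topologicalType) (f g : T -> R[i]) :
  ccontinuous f -> ccontinuous g -> ccontinuous (fun x => f x + g x).
Proof. by move=> cf cg x; apply: cvgD; [exact: cf|exact: cg]. Qed.

Lemma ccontinuous_cst (T : topologicalType) (c : R[i]) : ccontinuous (fun _ : T => c).
Proof. by move=> x; exact: cvg_cst. Qed.

Lemma ccontinuous_real (T : topologicalType) (f : T -> R) :
  continuous f -> ccontinuous (fun x => ((f x)%:C)%C).
Proof. by move=> cf; apply: ccontinuous_ReIm => //= x; exact: cvg_cst. Qed.

(** Compactness of D makes the neighbourhoods of x0 given by continuity at the
    points (x0, y) uniform in y. *)
Lemma uniform_tube (X Y : topologicalType) (D : set Y) (F : X * Y -> R) :
  compact D -> continuous F -> forall x0 (e : R), 0 < e ->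
  \forall x \near x0, forall y, D y -> `|F (x0, y) - F (x, y)| < e.
Proof.
move=> /compact_near_coveringP cD /continuous_normal cF x0 e e0.
apply: (cD _ (nbhs x0) (fun x y => `|F (x0, y) - F (x, y)| < e)) => y Dy.
have e2 : 0 < e / 2 by rewrite divr_gt0.
have h1 := cF (x0, y) _ e2.
have [[U V] /= [Ux Vy] UV] := h1.
exists (V, U) => //= -[y' x] /= [Vy' Ux'].
have a1 := UV (x0, y') (conj (nbhs_singleton Ux) Vy').
have a2 := UV (x, y') (conj Ux' Vy').
rewrite /= in a1 a2.
rewrite (_ : F (x0, y') - F (x, y') = (F (x0, y) - F (x, y')) - (F (x0, y) - F (x0, y'))); last by ring.
by rewrite (le_lt_trans (ler_normB _ _))// [ltRHS]splitr ltrD.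
Qed.

(** Uniform continuity in the first variable turns a compactly supported
    continuous function into a uniform limit of functions that are piecewise
    constant in that variable, and those are visibly measurable for the product
    sigma-algebra even when it is smaller than the Borel sets of the product. *)
Lemma measurable_compact_support (X Y : ptopologicalType) (C : set X) (D : set Y)
    (F : X * Y -> R) :
  hausdorff_space X -> compact C -> compact D -> continuous F ->
  (forall t x, ~ C t -> F (t, x) = 0) -> (forall t x, ~ D x -> F (t, x) = 0) ->
  measurable_fun setT (F : borel X * borel Y -> R).
Proof.
move=> hX cC cD cF FC FD.
have mC : measurable (C : set (borel X)) by apply: closed_borel; exact: compact_closed.
have step (n : nat) : exists g : borel X * borel Y -> R, measurable_fun setT g /\
    forall z, `|F z - g z| <= n.+1%:R^-1.
  have n0 : 0 < n.+1%:R^-1 :> R by rewrite invr_gt0.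
  pose B (t0 : X) : set X := [set t | forall y, D y -> `|F (t0, y) - F (t, y)| < n.+1%:R^-1]°.
  have oB t0 : open (B t0) by exact: open_interior.
  have Bt t0 : B t0 t0 by exact: uniform_tube.
  have : C `<=` cover C B by move=> t Ct; exists t => //; exact: Bt.
  have := cC; rewrite compact_cover => /(_ _ C B) h /h[//|D' _ CD'].
  have [g [mg hg]] : exists g : borel X * borel Y -> R, measurable_fun setT g /\
      forall t x, (exists2 t0, t0 \in finmap.enum_fset D' & B t0 t) ->
      `|F (t, x) - g (t, x)| <= n.+1%:R^-1.
    elim: (finmap.enum_fset D') => [|t0 s [g [mg IH]]].
      by exists (fun=> 0); split => // t x [].
    exists (fun z : borel X * borel Y => if (z.1 : X) \in B t0 then F (t0, z.2) else g z); split.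
      apply: measurable_fun_ifT => //.
        apply: (measurable_fun_bool true).
        rewrite [X in measurable X](_ : _ = (B t0) `*` setT).
          by apply: measurableX => //; exact: open_borel.
        apply/seteqP; split => -[t x] /=; first by move=> [_ /set_mem].
        by move=> [Bt' _]; split => //; exact: mem_set.
      have mFt0 : measurable_fun setT (fun x : borel Y => F (t0, x)).
        apply: continuous_borel => x; apply: (@continuous_comp _ _ _ (fun x => (t0, x)) F).
          by apply: cvg_pair => //=; exact: cvg_cst.
        exact: cF.
      exact: (measurableT_comp mFt0 measurable_snd).
    move=> t x [t1]; rewrite inE /= => /orP[/eqP->|t1s] Bt1.
      rewrite mem_set//; have := interior_subset Bt1; rewrite /= => h'.
      have [Dx|Dx] := pselect (D x); last by rewrite !FD// subrr normr0.
      by rewrite distrC ltW// h'.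
    case: ifPn => [/set_mem Bt0|_]; last by apply: IH; exists t1.
    have := interior_subset Bt0; rewrite /= => h'.
    have [Dx|Dx] := pselect (D x); last by rewrite !FD// subrr normr0.
    by rewrite distrC ltW// h'.
  exists (fun z : borel X * borel Y => if (z.1 : X) \in C then g z else 0); split.
    apply: measurable_fun_ifT => //.
    apply: (measurable_fun_bool true).
    rewrite [X in measurable X](_ : _ = C `*` setT); first exact: measurableX.
    apply/seteqP; split => -[t x] /=; first by move=> [_ /set_mem].
    by move=> [Ct _]; split => //; exact: mem_set.
  move=> [t x] /=; case: ifPn => [/set_mem Ct|/negP Ct].
    by apply: hg; have [t0 t0D Bt0] := CD' _ Ct; exists t0.
  by rewrite FC ?subrr ?normr0// => Ct'; apply: Ct; rewrite inE.
have [g hg] := choice step.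
apply: (@measurable_fun_cvg _ _ _ setT g); first by move=> n; have [] := hg n.
move=> z _; apply/cvgrPdist_lt => e e0.
have [m hm] := ltr_add_invr e0; rewrite add0r in hm.
exists m => // n /= mn; have [_ /(_ z) h] := hg n.
apply: le_lt_trans h _; apply: le_lt_trans hm.
by rewrite lef_pV2 ?posrE// ler_nat.
Qed.

End Topology.

(** * Urysohn functions on a group *)

Section Group.
Context (R : realType) (G : topologicalGroupType).
Local Open Scope group_scope.

Lemma continuous_mulg (T : topologicalType) (f g : T -> G) :
  continuous f -> continuous g -> continuous (fun x => f x * g x).
Proof.
move=> cf cg x.
apply: (@continuous_comp _ _ _ (fun x => (f x, g x)) (fun z => z.1 * z.2)).
  by apply: cvg_pair; [exact: cf|exact: cg].
exact: mulg_continuous.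
Qed.

Lemma continuous_invg (T : topologicalType) (f : T -> G) :
  continuous f -> continuous (fun x => (f x)^-1).
Proof. by move=> cf x; apply: continuous_comp; [exact: cf|exact: invg_continuous]. Qed.

Lemma continuous_cst_fun (T U : topologicalType) (c : U) : continuous (fun _ : T => c).
Proof. by move=> x; exact: cvg_cst. Qed.

Lemma continuous_idfun (T : topologicalType) : continuous (fun x : T => x).
Proof. by move=> x; exact: cvg_id. Qed.

Lemma continuous_mull (a : G) : continuous (fun x => a * x).
Proof. by apply: continuous_mulg; [exact: continuous_cst_fun|exact: continuous_idfun]. Qed.

Lemma compact_image (S T : topologicalType) (f : S -> T) (A : set S) :
  continuous f -> compact A -> compact (f @` A).
Proof.
move=> cf cA; apply: continuous_compact => //.
exact: continuous_subspaceT.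
Qed.

Lemma compact_mulg (A B : set G) : compact A -> compact B ->
  compact [set z.1 * z.2 | z in A `*` B].
Proof.
move=> cA cB; apply: compact_image; first exact: mulg_continuous.
exact: compact_setX.
Qed.

Lemma compact_invg (A : set G) : compact A -> compact [set x^-1 | x in A].
Proof. by move=> cA; apply: compact_image => //; exact: invg_continuous. Qed.

Local Close Scope group_scope.

Section Urysohn.
Hypothesis hG : hausdorff_space G.
Hypothesis lcG : locally_compact [set: G].

Lemma point_urysohn (x : G) (V : set G) : open V -> V x ->
  exists (f : G -> R) (D : set G), [/\ continuous f, (forall y, 0 <= f y <= 1),
    f x = 1, compact D & D `<=` V /\ forall y, ~ D y -> f y = 0].
Proof.
move=> oV Vx; have [U] := lcG (x := x) I; rewrite withinET => xU [cU clU].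
have xV : nbhs x V by exact: open_nbhs_nbhs.
have reg := @compact_regular G x U hG cU xU.
have [W xW WV] := reg V xV.
pose N := (W `&` U)°.
have nN : nbhs x N by apply: nbhs_interior; exact: filterI.
have clB : closed (~` N) by rewrite closedC; exact: open_interior.
have nBx : ~ (~` N) x by apply; exact: nbhs_singleton.
have /(@uniform_separatorP _ R) := @locally_compact_completely_regular G R lcG hG x _ clB nBx.
move=> [f [cf f01 fx fN]].
have f01' y : 0 <= f y <= 1.
  by have := f01 (f y) (ex_intro2 _ _ y I erefl); rewrite /= in_itv.
exists (fun y => 1 - f y), (closure (W `&` U)); split.
- by move=> y; apply: cvgB; [exact: cvg_cst|exact: cf].
- by move=> y; have /andP[a b] := f01' y; rewrite subr_ge0 b lerBlDr lerDl a.
- by rewrite (imsub1 fx)// subr0.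
- apply: (subclosed_compact _ cU); first exact: closed_closure.
  rewrite [X in _ `<=` X](closure_id U).1//.
  exact: closure_subset (@subIsetr _ _ _).
- split; first by apply: subset_trans WV; apply: closure_subset; exact: subIsetl.
  move=> y Dy; rewrite (imsub1 fN) ?subrr// => Ny; apply: Dy.
  by apply: subset_closure; exact: interior_subset Ny.
Qed.

(** Finitely many functions equal to 1 at a point cover C by the sets where they
    exceed 1/2; twice their sum, cut off at 1, is 1 on C. *)
Lemma compact_urysohn (C V : set G) : compact C -> open V -> C `<=` V ->
  exists (f : G -> R) (D : set G), [/\ continuous f, (forall y, 0 <= f y <= 1),
    (forall y, C y -> f y = 1), compact D & D `<=` V /\ forall y, ~ D y -> f y = 0].
Proof.
move=> cC oV CV.
have hp (x : G) : exists (f : G -> R) (D : set G), [/\ continuous f, (forall y, 0 <= f y <= 1),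
    V x -> f x = 1, compact D & D `<=` V /\ forall y, ~ D y -> f y = 0].
  have [Vx|Vx] := pselect (V x).
    by have [f [D [h1 h2 h3 h4 h5]]] := point_urysohn oV Vx; exists f, D.
  exists (fun=> 0), set0; split => //.
  - exact: continuous_cst_fun.
  - by move=> y; rewrite lexx ler01.
  - exact: compact0.
  - by split.
have [f hf] := choice hp; have [D hfD] := choice hf.
pose B x := [set y | 2^-1 < f x y].
have oB x : open (B x).
  have [/continuousP cf _ _ _ _] := hfD x.
  rewrite (_ : B x = f x @^-1` [set r | 2^-1 < r]) //; apply: cf.
  exact: open_gt.
have CB : C `<=` cover C B.
  move=> x Cx; exists x => //; have [_ _ f1 _ _] := hfD x.
  by rewrite /B/= f1 ?invf_lt1 ?ltr1n//; exact: CV.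
have h : cover_compact C by rewrite -compact_cover.
have [D' _ CD'] := h _ C B (fun x _ => oB x) CB.
have [g [E [cg g0 gf cE [EV gE]]]] : exists (g : G -> R) (E : set G),
    [/\ continuous g, (forall y, 0 <= g y),
      (forall x y, x \in finmap.enum_fset D' -> f x y <= g y), compact E &
      E `<=` V /\ forall y, ~ E y -> g y = 0].
  elim: (finmap.enum_fset D') => [|x s [g [E [cg g0 gf cE [EV gE]]]]].
    exists (fun=> 0), set0; split => //; [exact: continuous_cst_fun|exact: compact0|by split].
  have [cf f01 _ cD [DV fD]] := hfD x.
  exists (fun y => f x y + g y), (D x `|` E); split.
  - by move=> y; apply: cvgD; [exact: cf|exact: cg].
  - by move=> y; have /andP[a _] := f01 y; rewrite addr_ge0.
  - move=> x' y; rewrite inE => /orP[/eqP->|x's]; first by rewrite lerDl.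
    by rewrite (le_trans (gf _ _ x's))// lerDr; have /andP[] := f01 y.
  - exact: compactU.
  - split; first by move=> y [/DV|/EV].
    move=> y /not_orP[Dy Ey]; by rewrite fD// gE// addr0.
exists (fun y => Num.min (2 * g y) 1), E; split.
- move=> y; apply: (@continuous_min R G (fun y => 2 * g y) (fun=> 1)).
    by apply: cvgMr; exact: cg.
  exact: cvg_cst.
- by move=> y; rewrite le_min ler01 ge_min lexx orbT mulr_ge0.
- move=> y Cy; have [x xD Bx] := CD' _ Cy; apply/min_idPr.
  have := gf x y xD; move: Bx; rewrite /B/=; lra.
- by [].
- by split=> // y Ey; rewrite gE// mulr0; apply/min_idPl.
Qed.

Section Biinvariant.
Context (K : set G).
Hypothesis hK : compact_subgroup K.

Definition KxK : set (G * G) := K `*` K.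

Lemma compact_KxK : compact KxK.
Proof. by have [cK _ _ _] := hK; exact: compact_setX. Qed.

(** The supremum over K x K replaces the average over K x K: it keeps a
    function continuous and needs no invariant measure on K. *)
Definition biinv_sup (f : G -> R) (x : G) : R :=
  sup [set f (k.1 * x * k.2)%g | k in KxK].

Variable f : G -> R.
Hypothesis cf : continuous f.
Hypothesis f01 : forall y, 0 <= f y <= 1.

Lemma biinv_sup_has_sup x : has_sup [set f (k.1 * x * k.2)%g | k in KxK].
Proof.
have [_ K1 _ _] := hK; split; first by exists (f (1 * x * 1)%g), (1%g, 1%g).
by exists 1 => _ [k _ <-]; have /andP[] := f01 (k.1 * x * k.2)%g.
Qed.

Lemma biinv_sup_ge x k k' : K k -> K k' -> f (k * x * k')%g <= biinv_sup f x.
Proof.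
move=> Kk Kk'; apply: sup_ubound; first exact: (biinv_sup_has_sup x).2.
by exists (k, k').
Qed.

Lemma biinv_sup_le x b : (forall k k', K k -> K k' -> f (k * x * k')%g <= b) ->
  biinv_sup f x <= b.
Proof.
move=> h; apply: ge_sup; first exact: (biinv_sup_has_sup x).1.
by move=> _ [[k k'] [/= Kk Kk'] <-]; exact: h.
Qed.

Lemma biinv_sup_01 x : 0 <= biinv_sup f x <= 1.
Proof.
have [_ K1 _ _] := hK; apply/andP; split.
  apply: le_trans (biinv_sup_ge x K1 K1).
  by have /andP[] := f01 (1 * x * 1)%g.
by apply: biinv_sup_le => k k' _ _; have /andP[] := f01 (k * x * k')%g.
Qed.

(** By [uniform_tube] the translates of f by K x K are equicontinuous at x. *)
Lemma continuous_biinv_sup : continuous (biinv_sup f).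
Proof.
apply/continuous_normal => x e e0.
have cF : continuous (fun z : G * (G * G) => f (z.2.1 * z.1 * z.2.2)%g).
  move=> z; apply: (@continuous_comp _ _ _ (fun z : G * (G * G) => (z.2.1 * z.1 * z.2.2)%g) f).
    have c21 : continuous (fun z : G * (G * G) => z.2.1).
      by move=> w; apply: continuous_comp; [exact: cvg_snd|exact: cvg_fst].
    have c22 : continuous (fun z : G * (G * G) => z.2.2).
      by move=> w; apply: continuous_comp; [exact: cvg_snd|exact: cvg_snd].
    apply: continuous_mulg => //; apply: continuous_mulg => //.
    by move=> w; exact: cvg_fst.
  exact: cf.
have e2 : 0 < e / 2 by rewrite divr_gt0.
have := uniform_tube compact_KxK cF x e2; apply: filterS => y h.
apply: (@le_lt_trans _ _ (e / 2)); last by rewrite ltr_pdivrMr// mulr_natr mulr2n ltrDl.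
have h1 k k' : K k -> K k' -> `|f (k * x * k')%g - f (k * y * k')%g| < e / 2.
  by move=> Kk Kk'; exact: (h (k, k')).
rewrite ler_norml lerBlDr lerBrDr; apply/andP; split.
  rewrite addrC lerBlDr; apply: biinv_sup_le => k k' Kk Kk'.
  have := h1 _ _ Kk Kk'; rewrite ltr_norml => /andP[a b].
  have := biinv_sup_ge x Kk Kk'; lra.
apply: biinv_sup_le => k k' Kk Kk'.
have := h1 _ _ Kk Kk'; rewrite ltr_norml => /andP[a b].
have := biinv_sup_ge y Kk Kk'; lra.
Qed.

Lemma biinv_sup_biinv x k k' : K k -> K k' -> biinv_sup f (k * x * k')%g = biinv_sup f x.
Proof.
have [_ K1 KM KV] := hK => Kk Kk'; apply/eqP; rewrite eq_le; apply/andP; split.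
  apply: biinv_sup_le => l l' Kl Kl'.
  rewrite (_ : (l * (k * x * k') * l')%g = ((l * k) * x * (k' * l'))%g).
    by apply: biinv_sup_ge; exact: KM.
  by rewrite !mulgA.
apply: biinv_sup_le => l l' Kl Kl'.
rewrite (_ : (l * x * l')%g = ((l * k^-1) * (k * x * k') * (k'^-1 * l'))%g).
  by apply: biinv_sup_ge; apply: KM => //; exact: KV.
by rewrite !mulgA mulgVK mulgK.
Qed.

End Biinvariant.

End Urysohn.

End Group.

(** * Haar measure *)

Section Haar.
Context (R : realType) (G : topologicalGroupType).
Hypothesis hG : hausdorff_space G.
Hypothesis lcG : locally_compact [set: G].
Context (mu : {measure set (borel G) -> \bar R}).
Hypothesis haar : left_haar mu.
Local Notation "x %:C" := ((x%:C)%C).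

Lemma haar_compact (C : set G) : compact C -> (mu C < +oo)%E.
Proof. by have [[h _ _] _ _] := haar; exact: h. Qed.

Lemma compact_borel (C : set G) : compact C -> measurable (C : set (borel G)).
Proof. by move=> cC; apply: closed_borel; exact: compact_closed. Qed.

Lemma measurable_continuous_comp (f : G -> G) d (T : measurableType d)
    (g : borel G -> T) :
  continuous f -> measurable_fun setT g -> measurable_fun setT (fun x : borel G => g (f x)).
Proof.
move=> /continuousP cf mg; apply: (measurableT_comp mg).
have mgen (U : set (borel G)) : open U -> measurable ((f : borel G -> borel G) @^-1` U).
  by move=> oU; apply: open_borel; exact: cf.
apply: (@measurability _ _ _ _ setT (f : borel G -> borel G) (@open G)) => //.
by move=> _ [U oU <-]; rewrite setTI; exact: mgen.
Qed.

Lemma haar_translate (a : G) (f : borel G -> \bar R) :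
  measurable_fun setT f -> (forall x, (0 <= f x)%E) ->
  (\int[mu]_x f (a * x)%g = \int[mu]_x f x)%E.
Proof.
move=> mf f0; have [_ _ inv] := haar.
have mt : measurable_fun setT (fun x : borel G => (a * x)%g : borel G).
  apply: (measurable_continuous_comp (g := id)) => //; exact: continuous_mull.
transitivity (\int[pushforward mu (fun x : borel G => (a * x)%g : borel G)]_x f x)%E.
  by rewrite (ge0_integral_pushforward mt).
apply: eq_measure_integral => A mA _.
rewrite /pushforward -(inv a^-1%g A mA); congr (mu _).
apply/seteqP; split => [x /= Ax|_ [x Ax <-] /=]; last by rewrite mulVKg.
by exists (a * x)%g => //; rewrite mulKg.
Qed.

(** Finitely many translates of a null open set would cover any compact set, and by
    inner regularity the whole group would be null. *)
Lemma haar_open_gt0 (U : set G) (x : G) : open U -> U x -> (0 < mu U)%E.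
Proof.
move=> oU Ux; rewrite lt0e measure_ge0 andbT; apply/eqP => U0.
have [[_ _ inner] muN0 inv] := haar; apply: muN0.
rewrite inner; last exact: openT.
apply/eqP; rewrite eq_le; apply/andP; split; last first.
  by apply: ereal_sup_ubound; exists set0; [split => //; exact: compact0|exact: measure0].
apply: ge_ereal_sup => _ [C [cC _] <-].
pose B (c : G) : set G := [set ((c * x^-1)%g * u)%g | u in U].
have BE c : B c = (fun y => ((c * x^-1)^-1 * y)%g) @^-1` U.
  apply/seteqP; split => [_ [u Uu <-]|y Uy] /=; first by rewrite mulKg.
  by exists ((c * x^-1)^-1 * y)%g => //; rewrite mulVKg.
have oB c : open (B c).
  by rewrite BE; move/continuousP : (@continuous_mull G (c * x^-1)^-1%g); exact.
have B0 c : mu (B c) = 0%E by rewrite -U0; apply: inv; exact: open_borel.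
have CB : C `<=` cover C B.
  by move=> c Cc; exists c => //; exists x => //; rewrite mulgVK.
have h : cover_compact C by rewrite -compact_cover.
have [D' _ CD'] := h _ C B (fun c _ => oB c) CB.
have [E [mE E0 EB]] : exists E : set (borel G), [/\ measurable E, mu E = 0%E &
    forall c, c \in finmap.enum_fset D' -> B c `<=` E].
  elim: (finmap.enum_fset D') => [|c s [E [mE E0 EB]]].
    by exists set0; split => //; exact: measure0.
  have mBc : measurable (B c : set (borel G)) by exact: open_borel.
  exists (B c `|` E); split.
  - exact: measurableU.
  - by rewrite measureU0 ?B0.
  - move=> c' ; rewrite inE => /orP[/eqP->|/EB h']; first exact: subsetUl.
    by apply: subset_trans h' _; exact: subsetUr.
have CE : C `<=` E by move=> y /CD' [c cD' Bcy]; exact: EB Bcy.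
by rewrite -E0; apply: le_measure => //; rewrite inE; [exact: compact_borel|exact: mE].
Qed.

Section CompactSupport.
Context (f : G -> R[i]) (D : set G).
Hypothesis cf : ccontinuous f.
Hypothesis cD : compact D.
Hypothesis fD : forall x, ~ D x -> f x = 0.

Lemma compact_support_bounded : exists2 M : R, 0 <= M & forall x, normc (f x) <= M.
Proof.
have cimg : compact ((fun x => normc (f x)) @` D).
  by apply: compact_image => //; exact: ccontinuous_normc.
have [M [_ hM]] := compact_bounded cimg.
exists (`|M| + 1) => [|x]; first by rewrite addr_ge0.
have [Dx|Dx] := pselect (D x); last by rewrite fD// normc0 addr_ge0.
have := hM (`|M| + 1); rewrite (le_lt_trans (ler_norm M)) ?ltrDl// => /(_ isT).
move=> /(_ (normc (f x))) /=; rewrite ger0_norm ?normc_ge0//; apply.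
by exists x.
Qed.

Lemma compact_support_integral (h : R -> R) (M : R) :
  measurable_fun setT (fun x : borel G => h (normc (f x))) -> h 0 = 0 ->
  (forall x, 0 <= h (normc (f x)) <= M) ->
  (\int[mu]_x (h (normc (f x)))%:E < +oo)%E.
Proof.
move=> mh h0 hM.
have mD := compact_borel cD.
apply: (@le_lt_trans _ _ (\int[mu]_(x in D) (cst M%:E x))%E).
  rewrite [leRHS]integral_mkcond; apply: ge0_le_integral => //.
  - by move=> x _; rewrite lee_fin; have /andP[] := hM x.
  - exact/measurable_EFinP.
  - by apply/(measurable_restrictT _ mD); exact: measurable_cst.
  - move=> x _; rewrite patchE; case: ifPn => [_|/negP xD].
      by rewrite lee_fin; have /andP[] := hM x.
    by rewrite fD ?normc0 ?h0// => Dx; apply: xD; rewrite inE.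
rewrite integral_cst// lte_mul_pinfty ?lee_fin//.
- by have /andP[/le_trans] := hM 1%g; apply.
- exact: haar_compact.
Qed.

Lemma compact_support_L1 : (L1norm mu f < +oo)%E.
Proof.
have [M M0 hM] := compact_support_bounded.
apply: (compact_support_integral (h := id) (M := M)) => // [|x].
  exact: (measurable_normc (ccontinuous_measurable cf)).
by rewrite normc_ge0 hM.
Qed.

Lemma compact_support_cintegrable : cintegrable mu f.
Proof.
by apply/cintegrableP; split; [exact: ccontinuous_measurable|exact: compact_support_L1].
Qed.

Lemma compact_support_L2 : cLp mu 2%:E f.
Proof.
apply/cLp2P; split; first exact: ccontinuous_measurable.
have [M M0 hM] := compact_support_bounded.
apply: (compact_support_integral (h := fun r => r ^+ 2) (M := M ^+ 2)) => [||x].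
- by apply: measurable_funX; exact: (measurable_normc (ccontinuous_measurable cf)).
- by rewrite expr0n.
- by rewrite sqr_ge0 lerXn2r ?nnegrE ?normc_ge0.
Qed.

End CompactSupport.

Lemma compact_support_ge0_lty (f : G -> R) (D : set G) : continuous f ->
  (forall x, 0 <= f x) -> compact D -> (forall x, ~ D x -> f x = 0) ->
  (\int[mu]_x (f x)%:E < +oo)%E.
Proof.
move=> cf f0 cD fD.
have fD' x : ~ D x -> (f x)%:C = 0 by move=> Dx; rewrite fD.
have := compact_support_L1 (ccontinuous_real cf) cD fD'.
by rewrite /L1norm; under eq_integral do rewrite normc_real ger0_norm//.
Qed.

Context (K : set G).
Hypothesis hK : compact_subgroup K.

Lemma Cc_biinv_support (f : G -> R[i]) : Cc_biinv K f ->
  exists2 D, compact D & forall x, ~ D x -> f x = 0.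
Proof.
move=> [_ cD _]; exists (closure [set x | f x != 0]) => // x Dx.
by apply/eqP/negP => fx; apply: Dx; apply: subset_closure; exact/negP.
Qed.

Lemma Cc_biinv_of_support (f : G -> R[i]) (D : set G) : ccontinuous f ->
  compact D -> (forall x, ~ D x -> f x = 0) -> biinvariant K f -> Cc_biinv K f.
Proof.
move=> cf cD fD fb; split => //.
apply: (subclosed_compact _ cD); first exact: closed_closure.
rewrite [X in _ `<=` X](closure_id D).1; last exact: compact_closed.
apply: closure_subset => x /= /eqP fx; apply: contrapT => Dx.
by apply: fx; exact: fD.
Qed.

Lemma biinv_urysohn (C V : set G) : compact C -> open V -> C `<=` V ->
  (forall x k k', K k -> K k' -> V x -> V (k * x * k')%g) ->
  exists (f : G -> R) (D : set G),
    [/\ continuous f /\ (forall x, 0 <= f x <= 1),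
        (forall x, C x -> f x = 1),
        (forall x k k', K k -> K k' -> f (k * x * k')%g = f x),
        compact D /\ (forall x, ~ D x -> f x = 0) &
        forall x, ~ V x -> f x = 0].
Proof.
move=> cC oV CV Vb; have [f [D [cf f01 fC cD [DV fD]]]] := @compact_urysohn R G hG lcG C V cC oV CV.
have [cK K1 KM KV] := hK.
pose D' := [set z.1 * z.2 | z in ([set z.1 * z.2 | z in K `*` D] `*` K)]%g.
have zero x : (forall k k', K k -> K k' -> ~ D (k * x * k')%g) -> biinv_sup K f x = 0.
  move=> h; apply/eqP; rewrite eq_le; apply/andP; split.
    by apply: (biinv_sup_le hK f01) => k k' Kk Kk'; rewrite fD//; exact: h.
  by have /andP[] := biinv_sup_01 hK f01 x.
exists (biinv_sup K f), D'; split.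
- by split; [exact: continuous_biinv_sup|exact: biinv_sup_01].
- move=> x Cx; apply/eqP; rewrite eq_le.
  have /andP[_ ->] := biinv_sup_01 hK f01 x => /=.
  have := biinv_sup_ge hK f01 x K1 K1.
  by rewrite mul1g mulg1 fC.
- by move=> x k k' Kk Kk'; exact: biinv_sup_biinv.
- split; first by apply: compact_mulg => //; exact: compact_mulg.
  move=> x Dx; apply: zero => k k' Kk Kk' Dk; apply: Dx.
  exists ((k^-1 * (k * x * k'))%g, k'^-1%g) => /=; last first.
    by rewrite !mulgA mulVg mul1g mulgK.
  split; last exact: KV.
  by exists (k^-1, (k * x * k'))%g => //; split => //; exact: KV.
- move=> x Vx; apply: zero => k k' Kk Kk' /DV Vk; apply: Vx.
  have := Vb _ _ _ (KV _ Kk) (KV _ Kk') Vk.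
  by rewrite !mulgA mulVg mul1g mulgK.
Qed.

Lemma Rintegral_ge0_eq (f g : borel G -> R) : (forall x, 0 <= f x) -> (forall x, 0 <= g x) ->
  (\int[mu]_x (f x)%:E < +oo)%E -> (\int[mu]_x (g x)%:E < +oo)%E ->
  \int[mu]_x f x = \int[mu]_x g x -> (\int[mu]_x (f x)%:E = \int[mu]_x (g x)%:E)%E.
Proof.
move=> f0 g0 fi gi; rewrite /Rintegral => fg.
have fin (h : borel G -> R) : (forall x, 0 <= h x) -> (\int[mu]_x (h x)%:E < +oo)%E ->
    (\int[mu]_x (h x)%:E)%E \is a fin_num.
  by move=> h0 hi; rewrite ge0_fin_numE// integral_ge0// => x _; rewrite lee_fin.
by rewrite -(fineK (fin f f0 fi)) -(fineK (fin g g0 gi)) fg.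
Qed.

(** Evaluating f * g = g * f at the unit, for a g that is 1 on the supports of f
    and of its reflection. *)
Lemma gelfand_inverse (f : G -> R) : gelfand_pair mu K ->
  (forall x, 0 <= f x) -> Cc_biinv K (fun x => (f x)%:C) ->
  (\int[mu]_x (f x^-1%g)%:E = \int[mu]_x (f x)%:E)%E.
Proof.
move=> [_ comm] f0 fc; have [cf _ fb] := fc.
have [D cD fD] := Cc_biinv_support fc.
have cDV := compact_invg cD.
have [g [E [[cg g01] gC gb [cE gE] _]]] :=
  @biinv_urysohn (D `|` [set x^-1 | x in D]%g) setT (compactU cD cDV) openT
    (@subsetT _ _) (fun _ _ _ _ _ _ => I).
have gc : Cc_biinv K (fun x => (g x)%:C).
  have h1 : ccontinuous (fun x => (g x)%:C) by exact: ccontinuous_real.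
  have h2 x : ~ E x -> (g x)%:C = 0 by move=> Ex; rewrite gE.
  have h3 : biinvariant K (fun x => (g x)%:C) by move=> x k k' Kk Kk'; rewrite gb.
  exact: (Cc_biinv_of_support h1 cE h2 h3).
have fD' x : ~ D x -> f x = 0 by move=> /fD /(congr1 (@complex.Re R)).
have e := congr1 (fun F => complex.Re (F 1%g)) (comm _ _ fc gc).
have cfr : continuous f by exact: (ccontinuous_Re cf).
apply: Rintegral_ge0_eq => //.
- apply: (@compact_support_ge0_lty _ [set x^-1 | x in D]%g) => //.
    by move=> x; apply: continuous_comp; [exact: invg_continuous|exact: cfr].
  by move=> x Dx; apply: fD' => Dx'; apply: Dx; exists x^-1%g => //; rewrite invgK.
- exact: (@compact_support_ge0_lty _ D).
move: e; rewrite /convolution /cintegral /=.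
under eq_Rintegral => x _.
  rewrite !mul0r subr0 mulg1 (_ : f x * g x^-1%g = f x); last first.
    have [Dx|Dx] := pselect (D x); last by rewrite fD'// mul0r.
    by rewrite gC ?mulr1//; right; exists x.
  over.
move=> ->; apply: eq_Rintegral => x _; rewrite !mul0r subr0 mulg1.
have [Dx|Dx] := pselect (D x^-1%g); last by rewrite fD'// mulr0.
by rewrite gC ?mul1r//; right; exists x^-1%g => //; rewrite invgK.
Qed.

(** The substitution t -> x t turns the argument into alpha(t)^-1; then the modulus
    and the invariance under inversion apply. *)
Lemma modulus_inverse (alpha : G -> G) (delta : R) (b : G -> R) (x : G) :
  gelfand_pair mu K -> topological_automorphism alpha -> modulus mu alpha delta ->
  (forall y, 0 <= b y) -> Cc_biinv K (fun y => (b y)%:C) ->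
  (\int[mu]_t (b (alpha (t^-1 * x)%g))%:E = (delta^-1)%:E * \int[mu]_y (b y)%:E)%E.
Proof.
move=> gp [aM ca _] [delta0 amod] b0 bc.
have cb : continuous b by have [cb _ _] := bc; exact: (ccontinuous_Re cb).
have a1 : alpha 1%g = 1%g.
  by apply: (mulgI (alpha 1%g)); rewrite -aM !mulg1.
have aV y : alpha y^-1%g = (alpha y)^-1%g.
  by apply: (mulgI (alpha y)); rewrite -aM !mulgV.
have mE (h : G -> R) : continuous h -> measurable_fun setT (fun y : borel G => (h y)%:E).
  by move=> ch; apply/measurable_EFinP; exact: continuous_borel.
rewrite -(haar_translate x (f := fun t => (b (alpha (t^-1 * x)%g))%:E)).
- under eq_integral do rewrite invgM -mulgA mulVg mulg1 aV.
  rewrite (amod (fun y => (b y^-1%g)%:E)).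
  + by rewrite gelfand_inverse.
  + apply: mE => y; apply: continuous_comp; [exact: invg_continuous|exact: cb].
  + by move=> y; rewrite lee_fin.
- apply: mE => t; apply: (@continuous_comp _ _ _ (fun t => alpha (t^-1 * x)%g) b); last exact: cb.
  apply: (@continuous_comp _ _ _ (fun t => (t^-1 * x)%g) alpha); last exact: ca.
  apply: continuous_mulg; last exact: continuous_cst_fun.
  exact: invg_continuous.
- by move=> t; rewrite lee_fin.
Qed.

End Haar.

(** * Positive-definite spherical functions *)

Section PositiveDefinite.
Context (R : realType) (G : topologicalGroupType) (phi : G -> R[i]).
Hypothesis pd : positive_definite phi.

Lemma pd_pair (a b : R[i]) (x : G) :
  0 <= (a * a^* + b * b^*) * phi 1%g + (a * b^* * phi x + b * a^* * phi x^-1%g).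
Proof.
have := pd (fun i : 'I_2 => if i == ord0 then a else b)
           (fun i : 'I_2 => if i == ord0 then x else 1%g).
rewrite !big_ord_recl !big_ord0 /= !addr0 invg1 mulVg !mul1g !mulg1.
set s := (X in 0 <= X -> _) => s0; rewrite [X in 0 <= X](_ : _ = s) // /s; ring.
Qed.

Lemma pd_ge0 : 0 <= phi 1%g.
Proof.
have := pd_pair 1 0 1%g; rewrite conjC1 conj_complex0 !mul0r !mulr0 mulr1 !addr0.
by rewrite mul1r !mul0r addr0.
Qed.

(** Positive numbers are real: coefficients (1, 1) and (i, 1) give the imaginary
    and the real part. *)
Lemma pd_conj (x : G) : phi x^-1%g = (phi x)^*.
Proof.
have := pd_ge0; rewrite lecE => /andP[/eqP/= p1 _].
have := pd_pair 1 1 x; have := pd_pair 'i%C 1 x.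
rewrite conjC1 !mulr1 !mul1r.
have -> : ('i%C : R[i])^* = - 'i%C by apply: complex_eqP; rewrite ?ReJ ?ImJ ?ReN ?ImN//= oppr0.
rewrite !lecE => /andP[/eqP h1 _] /andP[/eqP h2 _].
move: h1 h2; rewrite !(ImD, ImM, ReM, ImN, ReN, ReD) /= p1.
by move=> h1 h2; apply: complex_eqP; rewrite ?ReJ ?ImJ; lra.
Qed.

(** Coefficients phi(x)^* and -|phi(x)| in [pd_pair]. *)
Lemma pd_le (x : G) : normc (phi x) <= complex.Re (phi 1%g).
Proof.
set c := complex.Re _; have := pd_ge0; rewrite lecE => /andP[/eqP/= p1 _].
have [->|n0] := eqVneq (normc (phi x)) 0.
  by have := pd_ge0; rewrite lecE => /andP[].
have npos : 0 < normc (phi x) by rewrite lt_def n0 normc_ge0.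
have := pd_pair (phi x)^* (- ((normc (phi x))%:C)%C) x.
rewrite pd_conj conjCK conjCN conjCR.
have -> : phi 1%g = (c%:C)%C by apply: complex_eqP.
have h := mulcJ (phi x).
rewrite (_ : _ + _ = (((normc (phi x)) ^+ 2 * 2 * (c - normc (phi x)))%:C)%C).
  by rewrite ler0c pmulr_rge0 ?subr_ge0// mulr_gt0// exprn_gt0.
rewrite [(phi x)^* * phi x]mulrC h.
rewrite (_ : _ + _ = (((normc (phi x) ^+ 2)%:C)%C + ((normc (phi x) ^+ 2)%:C)%C) * (c%:C)%C
   - ((normc (phi x))%:C)%C * (phi x * (phi x)^*) - ((normc (phi x))%:C)%C * (phi x * (phi x)^*)).
  by rewrite h -!realCD -!realCM -!realCB; congr (_%:C)%C; ring.
by rewrite expr2 realCM; ring.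
Qed.

End PositiveDefinite.

Section Spherical.
Context (R : realType) (G : topologicalGroupType).
Hypothesis hG : hausdorff_space G.
Hypothesis lcG : locally_compact [set: G].
Context (mu : {measure set (borel G) -> \bar R}).
Hypothesis haar : left_haar mu.
Context (K : set G).
Hypothesis hK : compact_subgroup K.
Local Notation "x %:C" := ((x%:C)%C).

(** Tonelli and left invariance; the convolution of functions f >= 0 is the
    iterated integral of a compactly supported function on G x G. *)
Lemma convolution_integral (f : G -> R) (D : set G) (M : R) :
  continuous f -> (forall x, 0 <= f x <= M) -> compact D -> (forall x, ~ D x -> f x = 0) ->
  exists h : borel G -> R, [/\ measurable_fun setT h, (forall x, 0 <= h x),
    convolution mu (fun x => (f x)%:C) (fun x => (f x)%:C) = (fun x => (h x)%:C) &
    (\int[mu]_x (h x)%:E = (\int[mu]_x (f x)%:E) * (\int[mu]_x (f x)%:E))%E].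
Proof.
move=> cf fM cD fD; have f0 x : 0 <= f x by have /andP[] := fM x.
pose F (z : G * G) := f z.1 * f (z.1^-1 * z.2)%g.
pose DD := [set (z.1 * z.2)%g | z in D `*` D].
have cDD : compact DD by exact: compact_mulg.
have cF : continuous F.
  move=> z; apply: cvgM; first by apply: continuous_comp; [exact: cvg_fst|exact: cf].
  apply: (@continuous_comp _ _ _ (fun z : G * G => (z.1^-1 * z.2)%g) f); last exact: cf.
  apply: continuous_mulg; last by move=> w; exact: cvg_snd.
  by apply: continuous_invg => w; exact: cvg_fst.
have FD t x : ~ D t -> F (t, x) = 0 by move=> Dt; rewrite /F fD// mul0r.
have FDD t x : ~ DD x -> F (t, x) = 0.
  move=> Dx; rewrite /F/=; have [Dt|Dt] := pselect (D t); last by rewrite fD// mul0r.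
  rewrite [X in _ * X]fD ?mulr0// => Dtx; apply: Dx.
  by exists (t, t^-1 * x)%g => //=; rewrite mulVKg.
have mF := measurable_compact_support hG cD cDD cF FD FDD.
have F0 z : 0 <= F z by rewrite mulr_ge0.
have mf : measurable_fun setT (fun x : borel G => (f x)%:E).
  by apply/measurable_EFinP; exact: continuous_borel.
have mD := compact_borel hG cD; have mDD := compact_borel hG cDD.
have Doo := haar_compact haar cD; have DDoo := haar_compact haar cDD.
pose h x := fine (\int[mu]_t (F (t, x))%:E).
have fin x : (\int[mu]_t (F (t, x))%:E)%E = (h x)%:E.
  rewrite /h fineK// ge0_fin_numE; last by apply: integral_ge0 => t _; rewrite lee_fin.
  apply: (compact_support_ge0_lty hG haar _ _ cD) => [t|t|t Dt]; last by rewrite FD.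
    apply: (@continuous_comp _ _ _ (fun t => (t, x)) F).
      by apply: cvg_pair => //=; exact: cvg_cst.
    exact: cF.
  exact: F0.
exists h; split.
- apply: (measurableT_comp (fine_measurable measurableT)) => //.
  exact: (measurable_section_integral2 mD Doo mF F0 FD).
- by move=> x; rewrite fine_ge0// integral_ge0// => t _; rewrite lee_fin.
- apply/funext => x; apply: complex_eqP => /=.
    by congr fine; apply: eq_integral => t _; rewrite !mul0r subr0.
  by rewrite -[RHS](Rintegral0 mu); apply: eq_Rintegral => t _; rewrite mul0r mulr0 addr0.
- under eq_integral do rewrite -fin.
  rewrite -(fubini_rectangle mD mDD Doo DDoo mF F0 FD FDD).
  have fint t : (\int[mu]_x (F (t, x))%:E = (f t)%:E * \int[mu]_x (f x)%:E)%E.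
    rewrite /F /=; under eq_integral do rewrite EFinM.
    rewrite ge0_integralZl_EFin//; last 2 first.
    + by move=> x _; rewrite lee_fin.
    + by apply: (measurable_continuous_comp (f := fun x => (t^-1 * x)%g) (g := EFin \o f)) => //;
        exact: continuous_mull.
    by rewrite (haar_translate haar _ mf)// => x; rewrite lee_fin.
  under eq_integral do rewrite fint.
  have foo : (\int[mu]_x (f x)%:E < +oo)%E.
    exact: (compact_support_ge0_lty hG haar cf f0 cD fD).
  have ffin : (\int[mu]_x (f x)%:E)%E \is a fin_num.
    by rewrite ge0_fin_numE// integral_ge0// => x _; rewrite lee_fin.
  under eq_integral do rewrite muleC -[X in (X * _)%E]fineK//.
  rewrite ge0_integralZl_EFin//; last 2 first.
  + by move=> x _; rewrite lee_fin.
  + by rewrite fine_ge0// integral_ge0// => x _; rewrite lee_fin.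
  by rewrite fineK.
Qed.

(** For f >= 0 concentrated near K, the character of phi multiplies the integral
    of f by about phi(1), and f * f >= 0 has integral the square of that of f.
    Hence phi(1)^2 <= phi(1) as |phi| <= phi(1). *)
Lemma spherical_at1 (phi : G -> R[i]) : spherical mu K phi ->
  positive_definite phi -> complex.Re (phi 1%g) <= 1.
Proof.
move=> [cphi bphi chiM _] pd; rewrite leNgt; apply/negP.
set c := complex.Re _ => c1; have [cK K1 KM KV] := hK.
have p1 : phi 1%g = c%:C.
  have := pd_ge0 pd; rewrite lecE => /andP[/eqP/= p1 _]; exact: complex_eqP.
pose e := (c - 1) / 2; have e0 : 0 < e by rewrite divr_gt0 ?subr_gt0.
pose V := [set x | normc (phi 1%g - phi x) < e].
have oV : open V.
  have cn : continuous (fun x => normc (phi 1%g - phi x)).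
    apply: ccontinuous_normc; apply: ccontinuousD; first exact: ccontinuous_cst.
    by move=> x; apply: cvgN; exact: cphi.
  rewrite (_ : V = (fun x => normc (phi 1%g - phi x)) @^-1` [set r | r < e])//.
  by move/continuousP : cn; apply; exact: open_lt.
have Vb x k k' : K k -> K k' -> V x -> V (k * x * k')%g.
  by move=> Kk Kk'; rewrite /V/= bphi.
have KV' : K `<=` V.
  move=> k Kk; have := Vb 1%g k 1%g Kk K1; rewrite !mulg1; apply.
  by rewrite /V/= subrr normc0.
have [f [D [[cf f01] fK fb [cD fD] fV]]] := @biinv_urysohn R G hG lcG K hK K V cK oV KV' Vb.
have f0 x : 0 <= f x by have /andP[] := f01 x.
have fc : Cc_biinv K (fun x => (f x)%:C).
  have h1 : ccontinuous (fun x => (f x)%:C) by exact: ccontinuous_real.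
  have h2 x : ~ D x -> (f x)%:C = 0 by move=> Dx; rewrite fD.
  have h3 : biinvariant K (fun x => (f x)%:C) by move=> x k k' Kk Kk'; rewrite fb.
  exact: (Cc_biinv_of_support hG h1 cD h2 h3).
have [h [mh h0 hE hI]] := convolution_integral cf f01 cD fD.
have foo : (\int[mu]_x (f x)%:E < +oo)%E.
  exact: (compact_support_ge0_lty hG haar cf f0 cD fD).
have mf : measurable_fun setT (fun x : borel G => f x) by exact: continuous_borel.
have int0 : (0 <= \int[mu]_x (f x)%:E)%E.
  by apply: integral_ge0 => x _; rewrite lee_fin.
pose I := fine (\int[mu]_x (f x)%:E).
have IE : (\int[mu]_x (f x)%:E)%E = I%:E by rewrite fineK// ge0_fin_numE.
have I0 : 0 < I.
  rewrite -lte_fin -IE.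
  pose U := [set x | 2^-1 < f x].
  have oU : open U.
    by move/continuousP : cf => /(_ [set r | 2^-1 < r]); apply; exact: open_gt.
  have U1 : U 1%g by rewrite /U/= fK// invf_lt1 ?ltr1n.
  have mU : measurable (U : set (borel G)) by exact: open_borel.
  apply: (@lt_le_trans _ _ (2^-1%:E * mu U)%E).
    by rewrite mule_gt0// (haar_open_gt0 hG haar oU U1).
  rewrite -integral_cst// integral_mkcond; apply: ge0_le_integral => //.
  - by move=> x _; rewrite patchE; case: ifP => // _; rewrite lee_fin.
  - by apply/(measurable_restrictT _ mU); exact: measurable_cst.
  - exact/measurable_EFinP.
  - move=> x _; rewrite patchE; case: ifPn => [/set_mem Ux|_]; rewrite lee_fin//.
    exact: ltW.
have mphi := ccontinuous_measurable cphi.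
have icf : cintegrable mu (fun x => (f x)%:C * phi x).
  have h1 : ccontinuous (fun x => (f x)%:C * phi x).
    by apply: ccontinuousM; [exact: ccontinuous_real|exact: cphi].
  have h2 x : ~ D x -> (f x)%:C * phi x = 0 by move=> Dx; rewrite fD// mul0r.
  exact: (compact_support_cintegrable hG haar h1 cD h2).
pose chi g := cintegral mu (fun x => g x * phi x).
have chif : (c - e) * I <= normc (chi (fun x => (f x)%:C)).
  apply: le_trans (le_trans (ler_norm _) (ler_Re_normc _)); rewrite -lee_fin.
  have [ir _] := icf.
  have -> : (complex.Re (chi (fun x => (f x)%:C)))%:E =
      (\int[mu]_x (complex.Re ((f x)%:C * phi x))%:E)%E.
    by rewrite /chi /cintegral [complex.Re _]/= /Rintegral fineK// integrable_fin_num.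
  rewrite EFinM -IE -ge0_integralZl_EFin//; last 3 first.
  - by move=> x _; rewrite lee_fin.
  - exact/measurable_EFinP.
  - rewrite /e; lra.
  apply: le_integral => //.
  - apply: integrableZl => //; apply/integrableP; split; first exact/measurable_EFinP.
    by under eq_integral do rewrite abse_EFin ger0_norm//.
  move=> x _; rewrite -EFinM lee_fin ReZ.
  have [Vx|Vx] := pselect (V x); last by rewrite fV// mulr0 mul0r.
  rewrite mulrC ler_wpM2l//.
  have := le_lt_trans (ler_Re_normc (phi 1%g - phi x)) Vx.
  by rewrite ReD ReN p1/= ltr_norml => /andP[_]; lra.
have chih : normc (chi (fun x => (h x)%:C)) <= c * I ^+ 2.
  have hoo : (\int[mu]_x (h x)%:E)%E = (I ^+ 2)%:E by rewrite hI IE -EFinM -expr2.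
  have mhphi : cmeasurable (fun x => (h x)%:C * phi x).
    by apply: cmeasurableM => //; exact: cmeasurable_real.
  have L1h : (L1norm mu (fun x => (h x)%:C * phi x)%R <= (c * I ^+ 2)%:E)%E.
    apply: (@le_trans _ _ (\int[mu]_x (c * h x)%:E)%E).
      apply: L1norm_le => //; first exact: measurable_funM.
      move=> x; rewrite normcM normc_real ger0_norm// mulrC ler_wpM2r//.
      exact: pd_le.
    have c0 : 0 <= c by rewrite ltW// (lt_trans _ c1).
    by rewrite (ge0_integralZlR mu mh h0 c0) hoo -EFinM.
  rewrite -lee_fin; apply: (le_trans _ L1h); apply: normc_cintegral.
  by apply/cintegrableP; split => //; apply: le_lt_trans L1h _; rewrite ltry.
have := chiM _ _ fc fc; rewrite hE => /(congr1 (@normc R)).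
rewrite -[X in normc X = _]/(chi (fun x => (h x)%:C)).
rewrite -[X in _ = normc (X * _)]/(chi (fun x => (f x)%:C)).
rewrite -[X in _ = normc (_ * X)]/(chi (fun x => (f x)%:C)) normcM => chi2.
rewrite chi2 in chih.
have : ((c - e) * I) ^+ 2 <= c * I ^+ 2.
  apply: le_trans chih; rewrite -expr2 lerXn2r ?nnegrE ?normc_ge0//.
  by rewrite mulr_ge0 ?(ltW I0)// /e; lra.
rewrite exprMn ler_pM2r ?exprn_gt0// leNgt => /negP; apply.
have -> : (c - e) ^+ 2 = c + e ^+ 2 by rewrite /e; field.
by rewrite ltrDl exprn_gt0.
Qed.

Lemma splus_conj (phi : splus mu K) x : sval phi x^-1%g = (sval phi x)^*.
Proof. by case: phi => phi [? pd] /=; exact: pd_conj. Qed.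

Lemma splus_le1 (phi : splus mu K) x : normc (sval phi x) <= 1.
Proof.
case: phi => phi [[sph _] pd] /=.
exact: le_trans (pd_le pd x) (spherical_at1 sph pd).
Qed.

Lemma splus_continuous (phi : splus mu K) : ccontinuous (sval phi).
Proof. by have [[[]]] := svalP phi. Qed.

Lemma splus_biinv (phi : splus mu K) : biinvariant K (sval phi).
Proof. by have [[[]]] := svalP phi. Qed.

End Spherical.

(** * Density of the compactly supported functions *)

Import HBNNSimple.

Section Density.
Context (R : realType) (G : topologicalGroupType).
Hypothesis hG : hausdorff_space G.
Hypothesis lcG : locally_compact [set: G].
Context (mu : {measure set (borel G) -> \bar R}).
Hypothesis haar : left_haar mu.
Context (K : set G).
Hypothesis hK : compact_subgroup K.
Local Notation "x %:C" := ((x%:C)%C).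

Definition approximable (f : borel G -> R[i]) := forall e : R, 0 < e ->
  exists psi, Cc_biinv K psi /\ (sqint mu (fun x => f x - psi x)%R <= e%:E)%E.

Lemma Cc_biinv_measurable psi : Cc_biinv K psi -> cmeasurable (psi : borel G -> R[i]).
Proof. by move=> [? _ _]; exact: ccontinuous_measurable. Qed.

Lemma Cc_biinv_lin (a : R[i]) f g : Cc_biinv K f -> Cc_biinv K g ->
  Cc_biinv K (fun x => a * f x + g x).
Proof.
move=> fc gc; have [D cD fD] := Cc_biinv_support fc; have [E cE gE] := Cc_biinv_support gc.
have [cf _ fb] := fc; have [cg _ gb] := gc.
apply: (Cc_biinv_of_support hG (D := D `|` E)).
- apply: ccontinuousD; last exact: cg.
  by apply: ccontinuousM; [exact: ccontinuous_cst|exact: cf].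
- exact: compactU.
- by move=> x /not_orP[Dx Ex]; rewrite fD// gE// mulr0 addr0.
- by move=> x k k' Kk Kk'; rewrite fb// gb.
Qed.

Lemma Cc_biinv0 : Cc_biinv K (fun=> 0 : R[i]).
Proof.
apply: (Cc_biinv_of_support hG (D := set0)).
- exact: ccontinuous_cst.
- exact: compact0.
- by [].
- by [].
Qed.

Lemma sqint_lin_le (a : R[i]) (f g : borel G -> R[i]) : cmeasurable f -> cmeasurable g ->
  (sqint mu (fun x => a * f x + g x)%R <=
   (2 * normc a ^+ 2)%:E * sqint mu f + 2%:E * sqint mu g)%E.
Proof.
move=> mf mg.
have mn h : cmeasurable h -> measurable_fun setT (fun x : borel G => normc (h x) ^+ 2).
  by move=> mh; apply: measurable_funX; exact: measurable_normc.
have a0 : 0 <= 2 * normc a ^+ 2 by rewrite mulr_ge0 ?sqr_ge0.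
rewrite -!ge0_integralZlR//; try exact: mn; try by move=> x; exact: sqr_ge0.
rewrite -ge0_integralD//; last 4 first.
- by move=> x _; rewrite lee_fin mulr_ge0 ?sqr_ge0.
- by apply/measurable_EFinP; apply: measurable_funM => //; exact: mn.
- by move=> x _; rewrite lee_fin mulr_ge0 ?sqr_ge0.
- by apply/measurable_EFinP; apply: measurable_funM => //; exact: mn.
apply: ge0_le_integral => //.
- by move=> x _; rewrite lee_fin sqr_ge0.
- by apply: measurable_normc2E; exact: cmeasurable_lin.
- by apply: emeasurable_funD; apply/measurable_EFinP; apply: measurable_funM => //; exact: mn.
- move=> x _; rewrite -EFinD lee_fin.
  apply: (@le_trans _ _ ((normc (a * f x) + normc (g x)) ^+ 2)).
    by rewrite lerXn2r ?nnegrE ?normc_ge0 ?addr_ge0 ?normc_ge0 ?le_normcD.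
  by rewrite normcM; have := sqr_ge0 (normc a * normc (f x) - normc (g x)); nra.
Qed.

Lemma approximable_lin (a : R[i]) f g : cmeasurable f -> cmeasurable g ->
  approximable f -> approximable g -> approximable (fun x => a * f x + g x).
Proof.
move=> mf mg af ag e e0.
pose c := 2 * (2 * normc a ^+ 2 + 2).
have c0 : 0 < c by rewrite mulr_gt0// ltr_wpDl// mulr_ge0 ?sqr_ge0.
have ec : 0 < e / c by rewrite divr_gt0.
have [psi [psic hpsi]] := af _ ec; have [psi' [psic' hpsi']] := ag _ ec.
exists (fun x => a * psi x + psi' x); split; first exact: Cc_biinv_lin.
have mpsi := Cc_biinv_measurable psic; have mpsi' := Cc_biinv_measurable psic'.
rewrite (_ : (fun x => _) = (fun x => a * (f x - psi x) + (g x - psi' x))); last first.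
  by apply/funext => x; ring.
apply: le_trans (sqint_lin_le a _ _) _; try exact: cmeasurableB.
apply: (@le_trans _ _ ((2 * normc a ^+ 2)%:E * (e / c)%:E + 2%:E * (e / c)%:E)%E).
  by apply: leeD; apply: lee_wpmul2l => //; rewrite lee_fin mulr_ge0 ?sqr_ge0.
rewrite -!EFinM -EFinD lee_fin -mulrDl.
have -> : (2 * normc a ^+ 2 + 2) = c / 2 by rewrite /c; field.
have cN0 : c != 0 by rewrite gt_eqF.
have -> : c / 2 * (e / c) = e / 2 by field.
lra.
Qed.

Lemma approximable0 : approximable (fun=> 0).
Proof.
move=> e e0; exists (fun=> 0); split; first exact: Cc_biinv0.
rewrite /sqint; under eq_integral do rewrite subrr normc0 expr0n.
by rewrite integral0 lee_fin ltW.
Qed.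

Lemma approximable_lim (f : borel G -> R[i]) (g : nat -> borel G -> R[i]) :
  cmeasurable f -> (forall n, cmeasurable (g n)) -> (forall n, approximable (g n)) ->
  sqint mu (fun x => f x - g n x) @[n --> \oo] --> 0%E -> approximable f.
Proof.
move=> mf mg ag fg e e0.
have e4 : (0 < (e / 4)%:E)%E by rewrite lte_fin divr_gt0.
have [N _ /(_ N (leqnn _)) /= hN] := fg _ (open_ereal_lt' e4).
have e4' : 0 < e / 4 by rewrite divr_gt0.
have [psi [psic hpsi]] := ag N _ e4'.
exists psi; split => //; have mpsi := Cc_biinv_measurable psic.
rewrite (_ : (fun x => _) = (fun x => 1 * (f x - g N x) + (g N x - psi x))); last first.
  by apply/funext => x; ring.
apply: le_trans (sqint_lin_le 1 _ _) _; try exact: cmeasurableB.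
rewrite normc1 expr1n mulr1.
apply: (@le_trans _ _ (2%:E * (e / 4)%:E + 2%:E * (e / 4)%:E)%E).
  by apply: leeD; apply: lee_wpmul2l => //; exact: ltW.
by rewrite -!EFinM -EFinD lee_fin; lra.
Qed.

(** Outer regularity gives an open set U around A, which is shrunk to the set V of
    points whose K-translates stay in U; inner regularity gives a compact set inside
    V, and a bi-invariant Urysohn function between the two is close to the indicator
    of A. *)
Lemma approximable_indic (A : set (borel G)) : measurable A -> (mu A < +oo)%E ->
  (forall x k k', K k -> K k' -> A x -> A (k * x * k')%g) ->
  approximable (fun x => (\1_A x)%:C).
Proof.
move=> mA Aoo Ab e e0; have [cK K1 KM KV] := hK.
have [[_ outer inner] _ _] := haar.
have e2 : 0 < e / 2 by rewrite divr_gt0.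
have Afin : mu A \is a fin_num by rewrite ge0_fin_numE.
have [U [oU AU] UA] : exists2 U : set G, open U /\ A `<=` U & (mu U < mu A + (e / 2)%:E)%E.
  have : (ereal_inf [set mu U | U in [set U : set G | open U /\ A `<=` U]] <
      mu A + (e / 2)%:E)%E.
    by rewrite -outer// lteDl// lte_fin.
  by move=> /ereal_inf_lt [_ [U [oU AU] <-] h]; exists U.
pose V := [set x | forall k, KxK K k -> U (k.1 * x * k.2)%g].
have oV : open V.
  rewrite openE => x Vx; have /compact_near_coveringP cKK := compact_KxK hK.
  apply: (cKK _ (nbhs x) (fun y k => U (k.1 * y * k.2)%g)) => k Kk.
  have cF : continuous (fun z : (G * G) * G => (z.1.1 * z.2 * z.1.2)%g).
    have c11 : continuous (fun z : (G * G) * G => z.1.1).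
      by move=> w; apply: continuous_comp; exact: cvg_fst.
    have c12 : continuous (fun z : (G * G) * G => z.1.2).
      by move=> w; apply: continuous_comp; [exact: cvg_fst|exact: cvg_snd].
    apply: continuous_mulg => //; apply: continuous_mulg => //.
    by move=> w; exact: cvg_snd.
  have := cF (k, x) U; apply; apply: open_nbhs_nbhs; split => //; exact: Vx.
have Vb x k k' : K k -> K k' -> V x -> V (k * x * k')%g.
  move=> Kk Kk' Vx [l l'] [/= Kl Kl'].
  have := Vx (l * k, k' * l')%g; rewrite /= !mulgA; apply.
  by split; exact: KM.
have AV : A `<=` V by move=> x Ax [k k'] [/= Kk Kk']; apply: AU; exact: Ab.
have VU : V `<=` U by move=> x /(_ (1, 1)%g); rewrite /= mul1g mulg1; apply.
have mV : measurable (V : set (borel G)) by exact: open_borel.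
have mU : measurable (U : set (borel G)) by exact: open_borel.
have VA : (mu V < mu A + (e / 2)%:E)%E.
  by apply: le_lt_trans UA; apply: le_measure; rewrite ?inE.
have Vfin : mu V \is a fin_num.
  by rewrite ge0_fin_numE// (lt_trans VA)// -(fineK Afin) -EFinD ltry.
have [C [cC CV] CVe] : exists2 C : set G, compact C /\ C `<=` V & (mu V - (e / 2)%:E < mu C)%E.
  have : (mu V - (e / 2)%:E < ereal_sup [set mu C | C in [set C : set G | compact C /\ C `<=` V]])%E.
    by rewrite -inner// lteBlDr// lteDl// lte_fin.
  by move=> /ereal_sup_gt [_ [C [cC CV] <-] h]; exists C.
have mC := compact_borel hG cC.
have [f [D [[cf f01] fC fb [cD fD] fV]]] := @biinv_urysohn R G hG lcG K hK C V cC oV CV Vb.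
exists (fun x => (f x)%:C); split.
  have h1 : ccontinuous (fun x => (f x)%:C) by exact: ccontinuous_real.
  have h2 x : ~ D x -> (f x)%:C = 0 by move=> Dx; rewrite fD.
  have h3 : biinvariant K (fun x => (f x)%:C) by move=> x k k' Kk Kk'; rewrite fb.
  exact: (Cc_biinv_of_support hG h1 cD h2 h3).
apply: (@le_trans _ _ (\int[mu]_x ((\1_(V `\` A) x)%:E + (\1_(V `\` C) x)%:E))%E).
  apply: ge0_le_integral => //.
  - by move=> x _; rewrite lee_fin sqr_ge0.
  - apply: measurable_normc2E; apply: cmeasurableB; apply: cmeasurable_real => //.
    exact: continuous_borel.
  - by apply: emeasurable_funD; apply/measurable_EFinP; apply: measurable_indic;
      exact: measurableD.
  move=> x _; rewrite -EFinD lee_fin -realCB normc_real !indicE !in_setD.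
  have /andP[fx0 fx1] := f01 x.
  have [Ax|Ax] := boolP (x \in A).
    have -> : x \in V by rewrite inE; apply: AV; rewrite inE in Ax.
    have [Cx|Cx] := boolP (x \in C); first by rewrite fC ?subrr ?normr0 ?expr0n//= ?addr0// -inE.
    by rewrite /= add0r expr_le1// ler_norml; apply/andP; split; lra.
  have [Vx|Vx] := boolP (x \in V).
    rewrite /= sub0r normrN ger0_norm//; apply: (@le_trans _ _ 1); first by rewrite expr_le1.
    by rewrite lerDl ler0n.
  rewrite fV; last by move=> Vx'; move/negP: Vx; apply; rewrite inE.
  by rewrite /= subrr normr0 expr0n addr0.
rewrite ge0_integralD//; try by apply/measurable_EFinP; apply: measurable_indic; exact: measurableD.
rewrite !integral_indic//; try exact: measurableD.
rewrite !setIT.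
have diff (B : set (borel G)) : measurable B -> B `<=` V -> (mu (V `\` B) = mu V - mu B)%E.
  by move=> mB BV; rewrite measureD// ?(setIidr BV)// ltey_eq Vfin.
rewrite !diff// [e%:E](_ : _ = (e / 2)%:E + (e / 2)%:E)%E; last by rewrite -EFinD -splitr.
have Cfin : mu C \is a fin_num by rewrite ge0_fin_numE// haar_compact.
apply: leeD; first by rewrite leeBlDr// addeC ltW.
by rewrite leeBlDr// addeC -leeBlDr// ltW.
Qed.

Lemma approximable_sum (I : Type) (r : seq I) (F : I -> borel G -> R[i]) :
  (forall i, cmeasurable (F i)) -> (forall i, approximable (F i)) ->
  approximable (fun x => \sum_(i <- r) F i x).
Proof.
move=> mF aF; elim: r => [|i r IHr].
  by under eq_fun do rewrite big_nil; exact: approximable0.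
under eq_fun do rewrite big_cons -[F i _]mul1r.
apply: approximable_lin => //; exact: cmeasurable_sum.
Qed.

(** The simple functions are built on the side of the values, as q_n applied to h,
    so that their level sets inherit the bi-invariance of h. *)
Lemma approximable_ge0 (h : borel G -> R) : measurable_fun setT h ->
  (forall x, 0 <= h x) -> (forall x k k', K k -> K k' -> h (k * x * k')%g = h x) ->
  (\int[mu]_x (h x ^+ 2)%:E < +oo)%E -> approximable (fun x => (h x)%:C).
Proof.
move=> mh h0 hb h2.
have mpos : measurable_fun setT (fun r : R => (Num.max r 0)%:E).
  by apply/measurable_EFinP; apply: measurable_maxr.
pose q := nnsfun_approx measurableT mpos.
have qcvg r : 0 <= r -> q n r @[n --> \oo] --> r.
  move=> r0; have := @cvg_nnsfun_approx _ _ _ _ measurableT _ mpos _ r I.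
  move=> /(_ _)/fine_cvg; rewrite /= (max_idPl r0); apply.
  by move=> x _; rewrite lee_fin le_max lexx orbT.
have qle n r : 0 <= r -> q n r <= r.
  move=> r0; rewrite -[leRHS](cvg_lim _ (qcvg r r0))//.
  apply: (nondecreasing_cvgn_le (u_ := fun n => q n r)).
    by move=> m m' mm'; have /lefP/(_ r) := nd_nnsfun_approx measurableT mpos mm'.
  by apply/cvg_ex; exists r; exact: qcvg.
have mq n : measurable_fun setT (fun x => q n (h x)).
  exact: (measurableT_comp (measurable_funPT (q n)) mh).
have nE n x : normc ((h x)%:C - (q n (h x))%:C) = `|h x - q n (h x)|.
  by rewrite -realCB normc_real.
have h2i : mu.-integrable setT (fun x => (h x ^+ 2)%:E).
  apply/integrableP; split; first by apply/measurable_EFinP; exact: measurable_funX.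
  by under eq_integral do rewrite abse_EFin ger0_norm ?sqr_ge0//.
apply: (@approximable_lim _ (fun n x => (q n (h x))%:C)).
- exact: cmeasurable_real.
- by move=> n; exact: cmeasurable_real.
- move=> n; pose s := finmap.enum_fset (fset_set (range (q n))).
  pose A i := [set x : borel G | q n (h x) = s`_i].
  have mA i : measurable (A i).
    have := mq n measurableT [set s`_i] (measurable_set1 _); rewrite setTI.
    by [].
  have -> : (fun x => (q n (h x))%:C) =
      (fun x => \sum_(i < size s) (s`_i)%:C * (\1_(A i) x)%:C).
    apply/funext => x; rewrite (fimfunEord (q n) (h x)) rmorph_sum/=.
    by apply: eq_bigr => i _; rewrite realCM !indicE; congr (_ * (_%:R)%:C).
  have mind i : cmeasurable (fun x : borel G => (\1_(A i) x : R)%:C).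
    by apply: cmeasurable_real; exact: measurable_indic.
  apply: approximable_sum => i.
    by apply: cmeasurableM => //; exact: cmeasurable_cst.
  have [si0|si0] := eqVneq (s`_i) 0.
    rewrite si0; under eq_fun do rewrite mul0r; exact: approximable0.
  suff ai : approximable (fun x => (\1_(A i) x)%:C).
    have := approximable_lin (s`_i)%:C (mind i) (cmeasurable_cst _ 0) ai approximable0.
    by under eq_fun do rewrite addr0.
  apply: approximable_indic => //; last first.
    by move=> x k k' Kk Kk'; rewrite /A/= hb.
  have : ((s`_i ^+ 2)%:E * mu (A i) < +oo)%E.
    apply: le_lt_trans h2; rewrite -integral_cst// integral_mkcond.
    apply: ge0_le_integral => //.
    + by move=> x _; rewrite patchE; case: ifP => // _; rewrite lee_fin sqr_ge0.
    + by apply/(measurable_restrictT _ (mA i)); exact: measurable_cst.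
    + by apply/measurable_EFinP; exact: measurable_funX.
    + move=> x _; rewrite patchE; case: ifPn => [/set_mem/= <-|_]; rewrite lee_fin ?sqr_ge0//.
      by rewrite lerXn2r ?nnegrE ?qle.
  rewrite !ltey; apply: contra_neq => ->; rewrite gt0_muley// lte_fin.
  by rewrite exprn_even_gt0.
- have := @dominated_cvg _ _ _ mu setT measurableT
    (fun n x => (normc ((h x)%:C - (q n (h x))%:C) ^+ 2)%:E) (fun=> 0%E)
    (fun x => (h x ^+ 2)%:E).
  rewrite integral0; apply => //.
  + move=> n; apply: measurable_normc2E; apply: cmeasurableB; exact: cmeasurable_real.
  + move=> x _; apply: cvg_EFin; first exact: nearW.
    have h1 : `|h x - q n (h x)| @[n --> \oo] --> (0 : R).
      apply/norm_cvg0P; rewrite -(subrr (h x)); apply: cvgB; first exact: cvg_cst.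
      exact: qcvg.
    have h3 : `|h x - q n (h x)| ^+ 2 @[n --> \oo] --> (0 : R).
      by rewrite -(mulr0 0); under eq_fun do rewrite expr2; exact: cvgM.
    by under eq_fun do rewrite nE.
  + move=> n x _; rewrite abse_EFin ger0_norm ?sqr_ge0// lee_fin nE.
    rewrite lerXn2r ?nnegrE// ger0_norm ?subr_ge0 ?qle//.
    by rewrite gerBl.
Qed.

(** Split f into the positive and negative parts of its real and imaginary parts. *)
Theorem Cc_biinv_dense (f : borel G -> R[i]) : Lp_biinv mu K 2%:E f -> approximable f.
Proof.
move=> [/cLp2P[[mr mi] f2] fb].
have mf : cmeasurable f by [].
have real (h : R[i] -> R) : measurable_fun setT (fun x => h (f x)) ->
    (forall z, `|h z| <= normc z) ->
    approximable (fun x => (h (f x))%:C) /\ cmeasurable (fun x => (h (f x))%:C).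
  move=> mh hz; split; last exact: cmeasurable_real.
  have part (g : R -> R) : measurable_fun setT g -> (forall r, 0 <= g r <= `|r|) ->
      approximable (fun x => (g (h (f x)))%:C).
    move=> mg gr; have mgh := measurableT_comp mg mh.
    apply: approximable_ge0 => //.
    - by move=> x; have /andP[] := gr (h (f x)).
    - by move=> x k k' Kk Kk'; rewrite fb.
    - apply: le_lt_trans f2; apply: ge0_le_integral => //.
      + by move=> x _; rewrite lee_fin sqr_ge0.
      + by apply/measurable_EFinP; exact: measurable_funX.
      + exact: measurable_normc2E.
      + move=> x _; have /andP[g0 gle] := gr (h (f x)).
        rewrite lee_fin lerXn2r ?nnegrE ?normc_ge0//.
        exact: le_trans gle (hz _).
  have mpos : measurable_fun setT (fun r : R => Num.max r 0) by apply: measurable_maxr.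
  have mneg : measurable_fun setT (fun r : R => Num.max (- r) 0) by apply: measurable_maxr.
  have := @approximable_lin (-1) (fun x => (Num.max (- h (f x)) 0)%:C)
     (fun x => (Num.max (h (f x)) 0)%:C).
  have -> : (fun x => -1 * (Num.max (- h (f x)) 0)%:C + (Num.max (h (f x)) 0)%:C) =
      (fun x => (h (f x))%:C).
    apply/funext => x; rewrite mulN1r addrC -realCB; congr (_%:C)%C.
    by rewrite /Num.max; case: ltP => h1; case: ltP => h2'; lra.
  apply.
  - by apply: cmeasurable_real; exact: (measurableT_comp mneg mh).
  - by apply: cmeasurable_real; exact: (measurableT_comp mpos mh).
  - apply: (part (fun r => Num.max (- r) 0)) => // r.
    by rewrite le_max lexx orbT/= ge_max normr_ge0 andbT -normrN ler_norm.
  - apply: (part (fun r => Num.max r 0)) => // r.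
    by rewrite le_max lexx orbT/= ge_max normr_ge0 andbT ler_norm.
have [ar mr'] := real _ mr (@ler_Re_normc R); have [ai mi'] := real _ mi (@ler_Im_normc R).
have := approximable_lin 'i%C mi' mr' ai ar.
rewrite (_ : (fun x => _) = f)//; apply/funext => x.
by rewrite addrC -complexE.
Qed.

End Density.

(** * Cauchy-Schwarz and the Fourier transform *)

Section CauchySchwarz.
Context (R : realType) d (T : measurableType d) (mu : {measure set T -> \bar R}).

Definition nrm2 (f : T -> R[i]) : R := Num.sqrt (fine (sqint mu f)).

Lemma nrm2_ge0 f : 0 <= nrm2 f.
Proof. exact: sqrtr_ge0. Qed.

Lemma nrm2_sq f : nrm2 f ^+ 2 = fine (sqint mu f).
Proof. by rewrite sqr_sqrtr// fine_ge0// sqint_ge0. Qed.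

Lemma nrm2E f : cLp mu 2%:E f -> sqint mu f = (nrm2 f ^+ 2)%:E.
Proof.
by move=> /cLp2P[_ h]; rewrite nrm2_sq fineK// ge0_fin_numE// sqint_ge0.
Qed.

Lemma nrm2_le f (c : R) : 0 <= c -> cLp mu 2%:E f ->
  (sqint mu f <= (c ^+ 2)%:E)%E -> nrm2 f <= c.
Proof.
move=> c0 fL h; rewrite -(ler_pXn2r (n := 2)) ?nnegrE ?nrm2_ge0//.
by rewrite -lee_fin -nrm2E.
Qed.

(** Hoelder's inequality with exponents 2 and 2. *)
Lemma cprod_le f g : cLp mu 2%:E f -> cLp mu 2%:E g ->
  normc (cprod mu f g) <= nrm2 f * nrm2 g.
Proof.
move=> fL gL; have iF := cprod_integrable fL gL.
have [mf _] := fL; have [mg _] := gL.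
rewrite -lee_fin; apply: le_trans (normc_cintegral iF) _.
have := hoelder mu (measurable_normc mf) (measurable_normc mg)
  (@ltr0n R 2) (@ltr0n R 2).
have -> : (2^-1 + 2^-1 : R) = 1 by rewrite -[2^-1]mul1r -splitr.
move=> /(_ erefl).
rewrite Lnorm1.
have -> : (\int[mu]_x `|(EFin \o (fun x => normc (f x) * normc (g x))%R) x| =
    L1norm mu (fun x => f x * (g x)^*)%R)%E.
  apply: eq_integral => x _; rewrite /= ger0_norm ?mulr_ge0 ?normc_ge0//.
  by rewrite normcM normc_conj.
have nE h : cLp mu 2%:E h -> ('N[mu]_2%:E[EFin \o (fun x => normc (h x))] = (nrm2 h)%:E)%E.
  move=> hL; rewrite -[LHS]/(clnorm mu 2%:E h) clnorm2E nrm2E// poweR_EFin.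
  by rewrite -powR_mulrn ?nrm2_ge0// -powRrM mulfV ?pnatr_eq0// powRr1 ?nrm2_ge0.
by rewrite (nE f fL) (nE g gL) -EFinM.
Qed.

Lemma sqint_bounded_mul (f g : T -> R[i]) (M : R) : cmeasurable f ->
  (forall x, normc (f x) <= M) -> cmeasurable g ->
  (sqint mu (fun x => f x * g x)%R <= (M ^+ 2)%:E * sqint mu g)%E.
Proof.
move=> mf fM mg; rewrite -ge0_integralZlR; last 3 first.
- by apply: measurable_funX; exact: measurable_normc.
- by move=> x; exact: sqr_ge0.
- exact: sqr_ge0.
apply: ge0_le_integral => //.
- by move=> x _; rewrite lee_fin sqr_ge0.
- by apply: measurable_normc2E; exact: cmeasurableM.
- apply/measurable_EFinP; apply: measurable_funM => //.
  by apply: measurable_funX; exact: measurable_normc.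
- move=> x _; rewrite lee_fin normcM exprMn ler_wpM2r ?sqr_ge0//.
  by rewrite lerXn2r ?nnegrE ?normc_ge0// (le_trans _ (fM x)) ?normc_ge0.
Qed.

Lemma cLp2_bounded_mul (f g : T -> R[i]) (M : R) : cmeasurable f ->
  (forall x, normc (f x) <= M) -> cLp mu 2%:E g -> cLp mu 2%:E (fun x => f x * g x).
Proof.
move=> mf fM /cLp2P[mg g2]; apply/cLp2P; split; first exact: cmeasurableM.
apply: le_lt_trans (sqint_bounded_mul mf fM mg) _.
by rewrite lte_mul_pinfty ?lee_fin ?sqr_ge0.
Qed.

Lemma cLp2J (f : T -> R[i]) : cLp mu 2%:E f -> cLp mu 2%:E (fun x => (f x)^*).
Proof.
move=> /cLp2P[mf f2]; apply/cLp2P; split; first exact: cmeasurableJ.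
by rewrite /sqint; under eq_integral do rewrite normc_conj.
Qed.

Lemma cLp2B (f g : T -> R[i]) : cLp mu 2%:E f -> cLp mu 2%:E g ->
  cLp mu 2%:E (fun x => f x - g x).
Proof.
move=> fL gL; have := cLp2_lin (-1) gL fL.
by under eq_fun do rewrite mulN1r addrC.
Qed.

Lemma cprodBl f g h : cLp mu 2%:E f -> cLp mu 2%:E g -> cLp mu 2%:E h ->
  cprod mu (fun x => f x - g x) h = cprod mu f h - cprod mu g h.
Proof.
move=> fL gL hL; have := cprod_linl (-1) gL fL hL.
by under eq_fun do rewrite mulN1r addrC; rewrite mulN1r addrC.
Qed.

Lemma cprodBr f g h : cLp mu 2%:E f -> cLp mu 2%:E g -> cLp mu 2%:E h ->
  cprod mu h (fun x => f x - g x) = cprod mu h f - cprod mu h g.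
Proof.
move=> fL gL hL; rewrite (cprodC (cLp2B fL gL) hL) cprodBl// conjCB.
by rewrite -(cprodC fL hL) -(cprodC gL hL).
Qed.

(** Cauchy-Schwarz applied to <f, f> = <f - g, f> + <g, f>. *)
Lemma nrm2_triangle (f g : T -> R[i]) : cLp mu 2%:E f -> cLp mu 2%:E g ->
  nrm2 f <= nrm2 (fun x => f x - g x) + nrm2 g.
Proof.
move=> fL gL; have [->|f0] := eqVneq (nrm2 f) 0.
  by rewrite addr_ge0 ?nrm2_ge0.
have fpos : 0 < nrm2 f by rewrite lt_def f0 nrm2_ge0.
rewrite -(ler_pM2r fpos) -expr2 mulrDl.
have -> : nrm2 f ^+ 2 = complex.Re (cprod mu f f) by rewrite cprod_self// -nrm2_sq.
have -> : cprod mu f f = cprod mu (fun x => f x - g x) f + cprod mu g f.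
  by rewrite cprodBl// subrK.
rewrite ReD; apply: lerD.
  apply: le_trans (cprod_le (cLp2B fL gL) fL).
  exact: le_trans (ler_norm _) (ler_Re_normc _).
apply: le_trans (cprod_le gL fL).
exact: le_trans (ler_norm _) (ler_Re_normc _).
Qed.

Lemma cmeasurable_comp d' (T' : measurableType d') (f : T -> R[i]) (g : T' -> T) :
  cmeasurable f -> measurable_fun setT g -> cmeasurable (fun x => f (g x)).
Proof.
by move=> [mr mi] mg; split; [exact: (measurableT_comp mr mg)|exact: (measurableT_comp mi mg)].
Qed.

End CauchySchwarz.

Section FourierTransform.
Context (R : realType) (G : topologicalGroupType).
Context (mu : {measure set (borel G) -> \bar R}) (K : set G) (phi0 : splus mu K).

(** The weak topology makes Fourier transforms continuous on S^+. *)
Lemma fourier_measurable (g : G -> R[i]) : Lp_biinv mu K 1%E g ->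
  cmeasurable (fun phi : borel (splus_at phi0) => fourier mu g (sval phi)).
Proof.
move=> gL; apply: (@ccontinuous_measurable R (splus_at phi0)).
pose s : {f | Lp_biinv mu K 1%E f} := exist _ g gL.
move=> phi; apply: (@continuous_comp _ _ _ (fun phi : splus_at phi0 => fourier_family phi)
  (fun F : {ptws {f | Lp_biinv mu K 1%E f} -> (R[i] : numFieldType)} => F s)).
  exact: initial_continuous.
move=> U hU.
have /cvg_sup/(_ s) h : fourier_family phi --> fourier_family phi by exact: cvg_id.
apply: h; exact: (@initial_continuous _ _ (fun F : {ptws {f | Lp_biinv mu K 1%E f} ->
  (R[i] : numFieldType)} => F s)).
Qed.

End FourierTransform.

Section ParameterIntegral.
Context (R : realType) (G : topologicalGroupType).
Hypothesis hG : hausdorff_space G.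
Context (mu : {measure set (borel G) -> \bar R}).
Hypothesis haar : left_haar mu.

(** By [uniform_tube] the integrands are uniformly close on D, which has finite
    measure. *)
Lemma continuous_integral (F : G * G -> R[i]) (D : set G) : ccontinuous F ->
  compact D -> (forall t x, ~ D x -> F (t, x) = 0) ->
  ccontinuous (fun t => cintegral mu (fun x => F (t, x))).
Proof.
move=> cF cD FD; apply/ccontinuousP => t0 e e0.
have Doo := haar_compact haar cD; have mD := compact_borel hG cD.
have Dfin : mu D \is a fin_num by rewrite ge0_fin_numE.
pose M := fine (mu D) + 1.
have M0 : 0 < M by rewrite ltr_wpDl// fine_ge0.
pose H (z : G * G) := normc (F (t0, z.2) + -1 * F z).
have csec t : ccontinuous (fun x => F (t, x)).
  apply: (@ccontinuous_comp R _ _ (fun x : G => (t, x)) F) => // x.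
  by apply: cvg_pair; [exact: cvg_cst|exact: cvg_id].
have cH : continuous H.
  apply: ccontinuous_normc; apply: ccontinuousD.
    apply: (@ccontinuous_comp R _ _ (fun z : G * G => z.2) (fun x => F (t0, x))).
      by move=> z; exact: cvg_snd.
    exact: csec.
  by apply: ccontinuousM; [exact: ccontinuous_cst|exact: cF].
have isec t : cintegrable mu (fun x => F (t, x)).
  by apply: (compact_support_cintegrable hG haar (csec t) cD) => x; exact: FD.
have eM : 0 < e / (2 * M) by rewrite divr_gt0// mulr_gt0.
have := uniform_tube cD cH t0 eM.
apply: filterS => t ht; rewrite -cintegralB// -lte_fin.
apply: le_lt_trans (normc_cintegral _) _; first exact: cintegrableB.
apply: (@le_lt_trans _ _ (\int[mu]_(x in D) (cst (e / (2 * M))%:E x))%E).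
  rewrite /L1norm [leRHS]integral_mkcond; apply: ge0_le_integral => //.
  - by move=> x _; rewrite lee_fin normc_ge0.
  - by apply: measurable_normcE; have /cintegrableP[] := cintegrableB (isec t0) (isec t).
  - by apply/(measurable_restrictT _ mD); exact: measurable_cst.
  - move=> x _; rewrite patchE; case: ifPn => [/set_mem Dx|/negP xD].
      have := ht x Dx; rewrite /H mulN1r subrr normc0 sub0r normrN mulN1r.
      by rewrite ger0_norm ?normc_ge0// lee_fin => /ltW.
    by rewrite !FD ?subrr ?normc0// => Dx; apply: xD; rewrite inE.
rewrite integral_cst// -(fineK Dfin) -EFinM lte_fin.
rewrite -mulrA gtr_pMr// invfM -mulrA.
have : fine (mu D) / M <= 1 by rewrite ler_pdivrMr// mul1r lerDl.
by rewrite (mulrC M^-1); lra.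
Qed.

End ParameterIntegral.

(** * The transform on square-integrable functions *)

Section Stockwell.
Context (R : realType) (G : topologicalGroupType).
Hypothesis hG : hausdorff_space G.
Hypothesis lcG : locally_compact [set: G].
Context (mu : {measure set (borel G) -> \bar R}).
Hypothesis haar : left_haar mu.
Context (K : set G).
Hypothesis gp : gelfand_pair mu K.
Hypothesis L2_sep : hilbert_separable (@L2_dot R G mu K).
Context (alpha : G -> G) (delta : R).
Hypothesis alpha_aut : topological_automorphism alpha.
Hypothesis alpha_delta : modulus mu alpha delta.
Local Notation "x %:C" := ((x%:C)%C).
Local Notation H := (L2 mu K).
Local Notation dot := (@L2_dot R G mu K).
Local Notation nrm := (hnorm dot).

Let hK : compact_subgroup K. Proof. by case: gp. Qed.
Let hH : hilbert_axioms dot. Proof. exact: L2_hilbert. Qed.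
Let calpha : continuous alpha. Proof. by case: alpha_aut. Qed.
Let delta0 : 0 < delta. Proof. by case: alpha_delta. Qed.

Definition shift (theta : borel G -> R[i]) (t : G) (x : borel G) : R[i] :=
  (Num.sqrt delta)%:C * theta (alpha (t^-1 * x)%g).

Lemma shift_measurable theta t : cmeasurable theta -> cmeasurable (shift theta t).
Proof.
move=> [mr mi]; apply: cmeasurableM; first exact: cmeasurable_cst.
have c : continuous (fun x : G => alpha (t^-1 * x)%g).
  by move=> x; apply: continuous_comp; [exact: continuous_mull|exact: calpha].
split; first exact: (measurable_continuous_comp c mr).
exact: (measurable_continuous_comp c mi).
Qed.

Lemma sqint_shift theta t : cmeasurable theta ->
  sqint mu (shift theta t) = sqint mu theta.
Proof.
move=> mt; have [_ amod] := alpha_delta.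
have mc (h : borel G -> R[i]) : cmeasurable h -> cmeasurable (fun x : borel G => h (alpha x)).
  move=> [mr mi]; split; first exact: (measurable_continuous_comp calpha mr).
  exact: (measurable_continuous_comp calpha mi).
have mct := mc _ mt.
have ms : measurable_fun setT (fun x : borel G => normc (theta (alpha x)) ^+ 2).
  by apply: measurable_funX; exact: measurable_normc.
transitivity (\int[mu]_x (delta * normc (theta (alpha (t^-1 * x)%g)) ^+ 2)%:E)%E.
  apply: eq_integral => x _; rewrite /shift normcM exprMn normc_real ger0_norm ?sqrtr_ge0//.
  by rewrite sqr_sqrtr ?ltW.
have -> : (\int[mu]_x (delta * normc (theta (alpha (t^-1 * x)%g)) ^+ 2)%:E)%E =
    (\int[mu]_x (delta * normc (theta (alpha x)) ^+ 2)%:E)%E.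
  apply: (haar_translate haar t^-1%g
    (f := fun x => (delta * normc (theta (alpha x)) ^+ 2)%:E)).
    by apply/measurable_EFinP; apply: measurable_funM.
  by move=> x; rewrite lee_fin mulr_ge0 ?sqr_ge0 ?ltW.
rewrite ge0_integralZlR//; [|by move=> x; exact: sqr_ge0|exact: ltW].
rewrite (amod (fun x => (normc (theta x) ^+ 2)%:E)).
- by rewrite muleA -EFinM mulfV ?gt_eqF// mul1e.
- exact: measurable_normc2E.
- by move=> x; rewrite lee_fin sqr_ge0.
Qed.

Lemma shift_Lp theta t : cLp mu 2%:E theta -> cLp mu 2%:E (shift theta t).
Proof.
move=> /cLp2P[mt t2]; apply/cLp2P; split; first exact: shift_measurable.
by rewrite sqint_shift.
Qed.

Lemma shiftB theta eta t x :
  shift (fun y => theta y - eta y) t x = shift theta t x - shift eta t x.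
Proof. by rewrite /shift mulrBr. Qed.

Context (phi0 : splus mu K).
Local Notation Z := (borel G * borel (splus_at phi0))%type.

(** The Stockwell transform with window theta, for functions rather than for
    classes of functions. *)
Definition windowed (f theta : borel G -> R[i]) (z : Z) : R[i] :=
  cprod mu f (fun x => sval z.2 x * shift theta z.1 x).

Lemma splus_measurable (phi : splus mu K) : cmeasurable (sval phi : borel G -> R[i]).
Proof. exact: (@ccontinuous_measurable R G _ (@splus_continuous R G mu K phi)). Qed.

Lemma atom_Lp theta (phi : splus mu K) t : cLp mu 2%:E theta ->
  cLp mu 2%:E (fun x => sval phi x * shift theta t x).
Proof.
move=> tL; apply: (cLp2_bounded_mul (M := 1)).
- exact: splus_measurable.
- exact: (splus_le1 hG lcG haar hK).
- exact: shift_Lp.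
Qed.

Lemma nrm2_atom theta (phi : splus mu K) t : cLp mu 2%:E theta ->
  nrm2 mu (fun x => sval phi x * shift theta t x) <= nrm2 mu theta.
Proof.
move=> tL; apply: nrm2_le; [exact: nrm2_ge0|exact: atom_Lp|].
rewrite -nrm2E// -(sqint_shift t tL.1).
have := sqint_bounded_mul mu (splus_measurable phi) (splus_le1 hG lcG haar hK phi)
  (shift_measurable t tL.1).
by rewrite expr1n mul1e.
Qed.

Lemma windowed_le f theta z : cLp mu 2%:E f -> cLp mu 2%:E theta ->
  normc (windowed f theta z) <= nrm2 mu f * nrm2 mu theta.
Proof.
move=> fL tL; apply: le_trans (cprod_le fL (atom_Lp z.2 z.1 tL)) _.
by rewrite ler_wpM2l ?nrm2_ge0// nrm2_atom.
Qed.

Lemma windowedB f g theta eta z : cLp mu 2%:E f -> cLp mu 2%:E g ->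
  cLp mu 2%:E theta -> cLp mu 2%:E eta ->
  windowed f theta z - windowed g eta z =
  windowed (fun x => f x - g x) theta z + windowed g (fun x => theta x - eta x) z.
Proof.
move=> fL gL tL eL; have a h := @atom_Lp h z.2 z.1.
rewrite /windowed cprodBl//; last exact: a.
rewrite (_ : (fun x => sval z.2 x * shift (fun y => theta y - eta y) z.1 x) =
   (fun x => sval z.2 x * shift theta z.1 x - sval z.2 x * shift eta z.1 x)); last first.
  by apply/funext => x; rewrite shiftB mulrBr.
by rewrite cprodBr//; [ring|exact: a|exact: a].
Qed.

(** The vector w is the orthogonal projection of s, which need not be
    bi-invariant, on the bi-invariant functions. *)
Lemma riesz_L2 (s : borel G -> R[i]) : cLp mu 2%:E s ->
  exists w : H, (forall v, cprod mu (L2_fun v) s = dot v w) /\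
  forall g, Lp_biinv mu K 2%:E g -> cprod mu g s = cprod mu g (L2_fun w).
Proof.
move=> sL; have [ms _] := sL.
have lin : linear (fun v : H => cprod mu (L2_fun v) s : (R[i])^o).
  move=> a v w; rewrite -[RHS](cprod_linl a (L2_fun_Lp v) (L2_fun_Lp w) sL).
  apply: (cprod_ae (L2_fun_measurable _) _ ms ms).
  - by apply: cmeasurable_lin; exact: L2_fun_measurable.
  - exact: L2_fun_lin.
  - exact: aeW.
have bnd v : normc (cprod mu (L2_fun v) s) <= nrm2 mu s * nrm v.
  rewrite mulrC (_ : nrm v = nrm2 mu (L2_fun v)); first by apply: cprod_le => //; exact: L2_fun_Lp.
  by rewrite /nrm2 L2_sqint/= sqrtr_sqr ger0_norm// (nrm_ge0 dot).
have [w hw] := riesz hH lin (nrm2_ge0 mu s) bnd.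
exists w; split => // g gL; have [v vg] := L2_exists gL.
have [[mg _] _] := gL.
rewrite -(cprod_ae (L2_fun_measurable v) mg ms ms vg (aeW _ (fun=> erefl))) hw.
by apply: cprod_ae => //; try exact: L2_fun_measurable; exact: aeW.
Qed.

Lemma Cc_biinv_Lp (h : borel G -> R[i]) : Cc_biinv K h -> Lp_biinv mu K 2%:E h.
Proof.
move=> hc; have [ch _ hb] := hc; have [D cD hD] := Cc_biinv_support hc.
by split => //; exact: (compact_support_L2 hG haar ch cD hD).
Qed.

Lemma Cc_biinv_bounded (h : borel G -> R[i]) : Cc_biinv K h ->
  exists2 M : R, 0 <= M & forall x, normc (h x) <= M.
Proof.
move=> hc; have [ch _ hb] := hc; have [D cD hD] := Cc_biinv_support hc.
exact: (compact_support_bounded ch cD hD).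
Qed.

Lemma Cc_biinv_approximation (f : borel G -> R[i]) : Lp_biinv mu K 2%:E f ->
  exists psi : nat -> borel G -> R[i], (forall k, Cc_biinv K (psi k)) /\
    forall k, nrm2 mu (fun x => f x - psi k x) <= k.+1%:R^-1.
Proof.
move=> fL; have e0 (k : nat) : 0 < (k.+1%:R^-1 : R) ^+ 2 by rewrite exprn_gt0// invr_gt0.
pose psi k := projT1 (cid (Cc_biinv_dense hG lcG haar hK fL (e0 k))).
have psic k : Cc_biinv K (psi k) by rewrite /psi; case: cid => ? [].
have psie k : (sqint mu (fun x => f x - psi k x)%R <= ((k.+1%:R^-1) ^+ 2)%:E)%E.
  by rewrite /psi; case: cid => ? [].
exists psi; split => // k; apply: nrm2_le => //.
by apply: cLp2B; [exact: fL.1|exact: (Cc_biinv_Lp (psic k)).1].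
Qed.

Lemma nrm2C (f g : borel G -> R[i]) :
  nrm2 mu (fun x => f x - g x) = nrm2 mu (fun x => g x - f x).
Proof.
by congr (Num.sqrt (fine _)); apply: eq_integral => x _; rewrite -normcN opprB.
Qed.

Section CompactlySupported.
Context (f theta : borel G -> R[i]).
Hypothesis fc : Cc_biinv K f.
Hypothesis tc : Cc_biinv K theta.

Lemma Cc_biinv_mul_Lp (g : borel G -> R[i]) : Lp_biinv mu K 2%:E g ->
  Lp_biinv mu K 1%E (fun x => f x * (g x)^*) /\
  Lp_biinv mu K 2%:E (fun x => f x * (g x)^*).
Proof.
move=> [gL gb]; have [fL fb] := Cc_biinv_Lp fc.
have [M M0 fM] := Cc_biinv_bounded fc.
have bi : biinvariant K (fun x => f x * (g x)^*).
  by move=> x k k' Kk Kk'; rewrite fb// gb.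
split; split => //.
- have /cintegrableP[mfg fg1] := cprod_integrable fL gL.
  by split => //; rewrite clnorm1E.
- by apply: cLp2_bounded_mul fM _; [case: fL|exact: cLp2J].
Qed.

Lemma modulated_Lp (phi : splus mu K) :
  Lp_biinv mu K 2%:E (fun x => f x * (sval phi x)^*).
Proof.
have [fL fb] := Cc_biinv_Lp fc; split; last first.
  by move=> x k k' Kk Kk'; rewrite fb// splus_biinv.
rewrite (_ : (fun x => _) = (fun x => (sval phi x)^* * f x)); last first.
  by apply/funext => x; rewrite mulrC.
apply: (cLp2_bounded_mul (M := 1)) => //.
- by apply: cmeasurableJ; exact: splus_measurable.
- by move=> x; rewrite normc_conj (splus_le1 hG lcG haar hK).
Qed.

(** Positive-definite functions satisfy phi(x^-1) = phi(x)^*. *)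
Lemma modulated_fourier (phi : splus mu K) (g : borel G -> R[i]) :
  cprod mu (fun x => f x * (sval phi x)^*) g = fourier mu (fun x => f x * (g x)^*) (sval phi).
Proof.
by apply: eq_cintegral => x; rewrite (splus_conj phi) mulrAC.
Qed.

Lemma windowed_modulated z :
  windowed f theta z = cprod mu (fun x => f x * (sval z.2 x)^*) (shift theta z.1).
Proof. by apply: eq_cintegral => x; rewrite conjCM mulrA. Qed.

Lemma continuous_shift : ccontinuous (fun z : G * G => shift theta z.1 z.2).
Proof.
have [ct _ _] := tc; apply: ccontinuousM; first exact: ccontinuous_cst.
apply: (@ccontinuous_comp R _ _ (fun z : G * G => alpha (z.1^-1 * z.2)%g) theta) => //.
move=> z; apply: (@continuous_comp _ _ _ (fun z : G * G => (z.1^-1 * z.2)%g) alpha); last exact: calpha.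
apply: continuous_mulg; last by move=> w; exact: cvg_snd.
by apply: continuous_invg => w; exact: cvg_fst.
Qed.

(** For a compactly supported g this is a continuous function of t; the general
    case is a uniform limit. *)
Lemma shift_coef_measurable (g : borel G -> R[i]) : Lp_biinv mu K 2%:E g ->
  cmeasurable (fun t : borel G => cprod mu g (shift theta t)).
Proof.
move=> gL; have [tL _] := Cc_biinv_Lp tc.
have [psi [psic psie]] := Cc_biinv_approximation gL.
have psiL k : cLp mu 2%:E (psi k) by have [] := Cc_biinv_Lp (psic k).
apply: (@cmeasurable_lim _ _ (borel G) (fun k t => cprod mu (psi k) (shift theta t))).
  move=> k; have [cp _ _] := psic k.
  have [D cD pD] := Cc_biinv_support (psic k).
  apply: (@ccontinuous_measurable R G).
  apply: (@continuous_integral R G hG mu haar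
    (fun z => psi k z.2 * (shift theta z.1 z.2)^*) D _ cD); last first.
    by move=> t x Dx; rewrite pD ?mul0r.
  apply: ccontinuousM.
    apply: (@ccontinuous_comp R _ _ (fun z : G * G => z.2) (psi k)) => //.
    by move=> z; exact: cvg_snd.
  by apply: ccontinuousJ; exact: continuous_shift.
move=> t; have sL := shift_Lp t tL; have [gL' _] := gL.
have lim0 : (nrm2 mu theta * k.+1%:R^-1) @[k --> \oo] --> (0 : R).
  by rewrite -(mulr0 (nrm2 mu theta)); apply: cvgM; [exact: cvg_cst|exact: cvg_harmonic].
apply: (squeeze_cvgr _ (cvg_cst 0) lim0); apply: nearW => k.
rewrite normc_ge0 andTb -cprodBl//.
apply: le_trans (cprod_le (cLp2B (psiL k) gL') sL) _.
rewrite mulrC ler_pM ?nrm2_ge0//.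
  by rewrite /nrm2 sqint_shift//; case: tL.
by rewrite nrm2C.
Qed.

Context (nu : {measure set (borel (splus_at phi0)) -> \bar R}).
Hypothesis nu_plancherel : plancherel_measure nu.

Lemma plancherel_fourier (h : borel G -> R[i]) :
  Lp_biinv mu K 1%E h -> Lp_biinv mu K 2%:E h ->
  sqint nu (fun phi => fourier mu h (sval phi)) = sqint mu h.
Proof.
move=> h1 h2; have [_ _ [F [F2 _ FE _]]] := nu_plancherel.
have [FL Fn] := F2 h h2; have hF := FE h h1 h2.
have mhat := fourier_measurable phi0 h1.
have [mF _] := FL.
rewrite -(sqint_ae mF mhat hF).
have [/cLp2P[_ fin1] /cLp2P[_ fin2]] := (FL, h2.1).
move: Fn; rewrite !clnorm2E => Fn.
have sq (x : \bar R) : (0 <= x)%E -> ((x `^ 2^-1) `^ 2 = x)%E.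
  by move=> x0; rewrite -poweRrM mulVf ?pnatr_eq0// poweRe1.
by rewrite -[LHS]sq ?sqint_ge0// Fn sq ?sqint_ge0.
Qed.

Lemma fourier_coef_measurable (g : borel G -> R[i]) : Lp_biinv mu K 2%:E g ->
  cmeasurable (fun phi : borel (splus_at phi0) =>
    cprod mu (fun x => f x * (sval phi x)^*) g).
Proof.
move=> gL; have [fg1 _] := Cc_biinv_mul_Lp gL.
have -> : (fun phi : borel (splus_at phi0) => cprod mu (fun x => f x * (sval phi x)^*) g) =
    (fun phi => fourier mu (fun x => f x * (g x)^*) (sval phi)).
  by apply/funext => phi; exact: modulated_fourier.
exact: fourier_measurable.
Qed.

Lemma fourier_coef_sqint (g : borel G -> R[i]) : Lp_biinv mu K 2%:E g ->
  sqint nu (fun phi : borel (splus_at phi0) =>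
    cprod mu (fun x => f x * (sval phi x)^*) g) = sqint mu (fun x => f x * (g x)^*).
Proof.
move=> gL; have [fg1 fg2] := Cc_biinv_mul_Lp gL.
rewrite -(plancherel_fourier fg1 fg2); apply: eq_integral => phi _.
by rewrite modulated_fourier.
Qed.

(** For fixed t, replacing the translate of the window by its projection w turns
    the transform into the Fourier transform of f w^*. Testing the projection on
    |f|^2 w compares f w with f times the translate. *)
Lemma windowed_section_sqint t :
  (sqint nu (fun phi : borel (splus_at phi0) => windowed f theta (t, phi)) <=
   sqint mu (fun x => f x * (shift theta t x)^*)%R)%E.
Proof.
have [tL _] := Cc_biinv_Lp tc; have sL := shift_Lp t tL.
have [w [_ hw]] := riesz_L2 sL.
have wL := L2_fun_biinv w.
rewrite (_ : sqint nu _ = sqint mu (fun x => f x * (L2_fun w x)^*)%R); last first.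
  rewrite -(fourier_coef_sqint wL); apply: eq_integral => phi _.
  by rewrite windowed_modulated (hw _ (modulated_Lp phi)).
have [fL fb] := Cc_biinv_Lp fc; have [M M0 fM] := Cc_biinv_bounded fc.
have mf : cmeasurable f by case: fL.
have mulL (a : borel G -> R[i]) : cLp mu 2%:E a -> cLp mu 2%:E (fun x => (f x)^* * a x).
  by apply: (cLp2_bounded_mul (M := M)); [exact: cmeasurableJ|move=> x; rewrite normc_conj].
have sqE (a : borel G -> R[i]) :
    sqint mu (fun x => f x * (a x)^*)%R = sqint mu (fun x => (f x)^* * a x)%R.
  by apply: eq_integral => x _; rewrite !normcM !normc_conj.
have [wL2 wb] := wL.
rewrite !sqE !nrm2E; try exact: mulL.
rewrite lee_fin lerXn2r ?nnegrE ?nrm2_ge0//.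
set a := (fun x => (f x)^* * L2_fun w x); set b := (fun x => (f x)^* * shift theta t x).
have [->|a0] := eqVneq (nrm2 mu a) 0; first exact: nrm2_ge0.
have apos : 0 < nrm2 mu a by rewrite lt_def a0 nrm2_ge0.
rewrite -(ler_pM2l apos) -expr2.
have -> : nrm2 mu a ^+ 2 = complex.Re (cprod mu a a).
  by rewrite cprod_self -?nrm2_sq//; exact: mulL.
have kL : Lp_biinv mu K 2%:E (fun x => f x * ((f x)^* * L2_fun w x)).
  split; last by move=> x k k' Kk Kk'; rewrite fb// wb.
  by apply: cLp2_bounded_mul fM _ => //; exact: mulL.
have -> : cprod mu a a = cprod mu a b.
  transitivity (cprod mu (fun x => f x * ((f x)^* * L2_fun w x)) (L2_fun w)).
    by apply: eq_cintegral => x; rewrite /a conjCM conjCK; ring.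
  rewrite -(hw _ kL); apply: eq_cintegral => x; rewrite /a /b [in RHS]conjCM conjCK; ring.
apply: le_trans (cprod_le (mulL _ wL2) (mulL _ sL)).
exact: le_trans (ler_norm _) (ler_Re_normc _).
Qed.

Lemma shift_support : exists2 E : set G, compact E &
  forall t x, ~ E t -> f x * shift theta t x = 0.
Proof.
have [D cD fD] := Cc_biinv_support fc; have [D' cD' tD] := Cc_biinv_support tc.
have [_ _ [beta [ab ba cb]]] := alpha_aut.
exists [set z.1 * z.2 | z in D `*` [set x^-1 | x in [set beta x | x in D']]]%g.
  by apply: compact_mulg => //; apply: compact_invg; exact: compact_image.
move=> t x Et; have [Dx|Dx] := pselect (D x); last by rewrite fD ?mul0r.
rewrite /shift; have [Dt|Dt] := pselect (D' (alpha (t^-1 * x)%g)); last by rewrite tD ?mulr0.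
exfalso; apply: Et; exists (x, (t^-1 * x)^-1)%g; last by rewrite /= invgM invgK mulgA mulgV mul1g.
split => //=; exists (t^-1 * x)%g => //.
by exists (alpha (t^-1 * x)%g).
Qed.

Let Q (z : G * G) : R := normc (f z.2 * shift theta z.1 z.2) ^+ 2.

Let cQ : continuous Q.
Proof.
have cn : continuous (fun z : G * G => normc (f z.2 * shift theta z.1 z.2)).
  apply: ccontinuous_normc; apply: ccontinuousM; last exact: continuous_shift.
  have [cf _ _] := fc.
  by apply: (@ccontinuous_comp R _ _ (fun z : G * G => z.2) f) => // z; exact: cvg_snd.
by move=> z; apply: (@continuous_comp _ _ _ _ (fun r : R => r ^+ 2)); [exact: cn|exact: exprn_continuous].
Qed.

Let Q_rectangle : exists C D : set G, [/\ compact C, compact D,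
  (forall t x, ~ C t -> Q (t, x) = 0) & (forall t x, ~ D x -> Q (t, x) = 0)].
Proof.
have [C cC hC] := shift_support; have [D cD hD] := Cc_biinv_support fc.
exists C, D; split => // t x h; first by rewrite /Q/= hC// normc0 expr0n.
by rewrite /Q/= hD// mul0r normc0 expr0n.
Qed.

Let mQ : measurable_fun setT (Q : borel G * borel G -> R).
Proof.
have [C [D [cC cD QC QD]]] := Q_rectangle.
exact: (measurable_compact_support hG cC cD cQ QC QD).
Qed.

Let Q0 z : 0 <= Q z. Proof. exact: sqr_ge0. Qed.

Lemma measurable_sqint_section :
  measurable_fun setT (fun t : borel G => sqint mu (fun x => f x * shift theta t x)%R).
Proof.
have [C [D [cC cD QC QD]]] := Q_rectangle.
exact: (measurable_section_integral1 (compact_borel hG cD) (haar_compact haar cD) mQ Q0 QD).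
Qed.

(** Tonelli on compact sets, then the substitution of [modulus_inverse] in t. *)
Lemma sqint_section_integral :
  (\int[mu]_t sqint mu (fun x => f x * shift theta t x)%R =
   sqint mu f * sqint mu theta)%E.
Proof.
have [C [D [cC cD QC QD]]] := Q_rectangle.
transitivity (\int[mu]_x \int[mu]_t (Q (t, x))%:E)%E.
  exact: (fubini_rectangle (compact_borel hG cC) (compact_borel hG cD)
    (haar_compact haar cC) (haar_compact haar cD) mQ Q0 QC QD).
have [ct _ tb] := tc; have [D' cD' tD] := Cc_biinv_support tc.
pose b x : R := normc (theta x) ^+ 2.
have b0 x : 0 <= b x by exact: sqr_ge0.
have cb : continuous b.
  move=> x; apply: (@continuous_comp _ _ _ _ (fun r : R => r ^+ 2)); last exact: exprn_continuous.
  exact: (ccontinuous_normc ct).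
have bc : Cc_biinv K (fun x => (b x)%:C).
  have h1 : ccontinuous (fun x => (b x)%:C) by exact: ccontinuous_real.
  have h2 x : ~ D' x -> (b x)%:C = 0 by move=> Dx; rewrite /b tD// normc0 expr0n.
  have h3 : biinvariant K (fun x => (b x)%:C) by move=> x k k' Kk Kk'; rewrite /b tb.
  exact: (Cc_biinv_of_support hG h1 cD' h2 h3).
have mE (h : G -> R) : continuous h -> measurable_fun setT (h : borel G -> R).
  exact: continuous_borel.
transitivity (\int[mu]_x ((normc (f x) ^+ 2)%:E * sqint mu theta))%E; last first.
  have [[tL _] [fL _]] := (Cc_biinv_Lp tc, Cc_biinv_Lp fc).
  rewrite (sqint_fin tL) ge0_integralZr//.
  - by apply: measurable_normc2E; case: fL.
  - by move=> x _; rewrite lee_fin sqr_ge0.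
  - by rewrite lee_fin fine_ge0// sqint_ge0.
apply: eq_integral => x _.
transitivity (\int[mu]_t ((normc (f x) ^+ 2 * delta) * b (alpha (t^-1 * x)%g))%:E)%E.
  apply: eq_integral => t _; congr (_%:E).
  rewrite /Q /shift /= !normcM normc_real ger0_norm ?sqrtr_ge0// !exprMn.
  by rewrite sqr_sqrtr ?ltW// mulrA.
rewrite ge0_integralZlR; last 3 first.
- apply: mE => t.
  apply: (@continuous_comp _ _ _ (fun t => alpha (t^-1 * x)%g) b); last exact: cb.
  apply: (@continuous_comp _ _ _ (fun t => (t^-1 * x)%g) alpha); last exact: calpha.
  by apply: continuous_mulg; [exact: invg_continuous|exact: continuous_cst_fun].
- by move=> t; exact: b0.
- by rewrite mulr_ge0 ?sqr_ge0 ?ltW.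
rewrite (modulus_inverse hG lcG haar hK x gp alpha_aut alpha_delta b0 bc).
by rewrite muleA -EFinM -mulrA mulfV ?gt_eqF// mulr1.
Qed.

Section Expansion.
Context (e : nat -> H).
Hypothesis e_basis : forall v, nrm (v - partial_proj dot e n v) @[n --> \oo] --> (0 : R).

Let a i (phi : borel (splus_at phi0)) :=
  cprod mu (fun x => f x * (sval phi x)^*) (L2_fun (e i)).
Let b i (t : borel G) := cprod mu (L2_fun (e i)) (shift theta t).

(** The scalar product of f phi^* with the translated window, computed in
    coordinates. Each term separates the two variables, which makes the transform
    measurable for the product sigma-algebra. *)
Lemma windowed_expansion (z : Z) :
  normc (\sum_(i < n) a i z.2 * b i z.1 - windowed f theta z) @[n --> \oo] --> (0 : R).
Proof.
have [tL _] := Cc_biinv_Lp tc; have sL := shift_Lp z.1 tL.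
have [w [hw hw']] := riesz_L2 sL; have [v hv] := L2_exists (modulated_Lp z.2).
have [[mg _] _] := modulated_Lp z.2.
have avE u : cprod mu (fun x => f x * (sval z.2 x)^*) (L2_fun u) = dot v u.
  apply/esym; apply: cprod_ae => //; try exact: L2_fun_measurable; exact: aeW.
rewrite windowed_modulated (hw' _ (modulated_Lp _)) avE.
have := @nrm_cvg_dot _ _ _ hH (fun n => partial_proj dot e n v) v w.
under eq_fun do rewrite (nrmBC hH); move=> /(_ (e_basis v)).
apply: cvg_trans; apply: near_eq_cvg; apply: nearW => n.
congr (normc (_ - _)); rewrite /partial_proj (dot_suml hH); apply: eq_bigr => i _.
by rewrite (dotZl hH) /a /b avE hw.
Qed.

Lemma measurable_windowed_partial n :
  cmeasurable (fun z : Z => \sum_(i < n) a i z.2 * b i z.1).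
Proof.
apply: cmeasurable_sum => i; apply: cmeasurableM.
  apply: (cmeasurable_comp (f := a i)); last exact: measurable_snd.
  by apply: fourier_coef_measurable; exact: L2_fun_biinv.
apply: (cmeasurable_comp (f := b i)); last exact: measurable_fst.
by apply: shift_coef_measurable; exact: L2_fun_biinv.
Qed.

Lemma windowed_measurable_Cc : cmeasurable (windowed f theta).
Proof.
exact: cmeasurable_lim measurable_windowed_partial windowed_expansion.
Qed.

(* The sets F m increase to the frequencies where some coefficient a_i is not 0,
   and have finite measure since each a_i is square-integrable. *)
Let A m (phi : borel (splus_at phi0)) : R := \sum_(i < m.+1) normc (a i phi) ^+ 2.
Let F m := [set phi | m.+1%:R^-1 <= A m phi].

Let mA m : measurable_fun setT (A m).
Proof.
apply: measurable_sum => i; apply: measurable_funX; apply: measurable_normc.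
by apply: fourier_coef_measurable; exact: L2_fun_biinv.
Qed.

Let mF m : measurable (F m).
Proof.
have := mA m measurableT (measurable_itv `[m.+1%:R^-1, +oo[).
by rewrite setTI; congr measurable; apply/seteqP; split => phi /=; rewrite in_itv/= andbT.
Qed.

Let Foo m : (nu (F m) < +oo)%E.
Proof.
have c0 : 0 < (m.+1%:R^-1 : R) by rewrite invr_gt0.
have A0 phi : 0 <= A m phi by apply: sumr_ge0 => i _; exact: sqr_ge0.
have h : (\int[nu]_phi (A m phi)%:E < +oo)%E.
  under eq_integral do rewrite -sumEFin.
  rewrite ge0_integral_sum//; last 2 first.
  - move=> i; apply: measurable_normc2E.
    by apply: fourier_coef_measurable; exact: L2_fun_biinv.
  - by move=> i phi _; rewrite lee_fin sqr_ge0.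
  apply: lte_sum_pinfty => i _.
  rewrite -/(sqint nu (a i)) fourier_coef_sqint; last exact: L2_fun_biinv.
  by have [_ [/cLp2P[_]]] := Cc_biinv_mul_Lp (L2_fun_biinv (e i)).
have : ((m.+1%:R^-1)%:E * nu (F m) < +oo)%E.
  apply: le_lt_trans h; rewrite -integral_cst// integral_mkcond.
  apply: ge0_le_integral => //.
  - by move=> phi _; rewrite patchE; case: ifP => // _; rewrite lee_fin ltW.
  - by apply/(measurable_restrictT _ (mF m)); exact: measurable_cst.
  - exact/measurable_EFinP.
  - move=> phi _; rewrite patchE; case: ifPn => [/set_mem/= ? |_]; rewrite lee_fin//.
by rewrite !ltey; apply: contra_neq => ->; rewrite gt0_muley// lte_fin.
Qed.

Lemma windowed_zero_off z : (forall i, a i z.2 = 0) -> windowed f theta z = 0.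
Proof.
move=> a0; have := windowed_expansion z.
under eq_fun => n.
  rewrite big1 ?sub0r ?normcN; last by move=> i _; rewrite a0 mul0r.
over.
move=> /(cvg_unique (@norm_hausdorff _ _) (cvg_cst _)) h.
exact: (eq0_normc h).
Qed.

Context (pi : {measure set Z -> \bar R}).
Hypothesis pi_prod : product_measure nu pi.

(** The integrand vanishes off a rectangle of finite measure, on which the integral
    is iterated and [windowed_section_sqint] applies. *)
Lemma windowed_truncated_sqint m :
  (\int[pi]_z (normc (windowed f theta z) ^+ 2 * \1_(F m) z.2)%:E <=
   sqint mu f * sqint mu theta)%E.
Proof.
have [E cE hE] := shift_support.
pose h (z : Z) := normc (windowed f theta z) ^+ 2 * \1_(F m) z.2.
have mh : measurable_fun setT h.
  apply: measurable_funM.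
    by apply: measurable_funX; apply: measurable_normc; exact: windowed_measurable_Cc.
  exact: (measurableT_comp (measurable_indic (mF m)) measurable_snd).
have h0 z : 0 <= h z by rewrite mulr_ge0 ?sqr_ge0.
have hE0 t phi : ~ E t -> h (t, phi) = 0.
  move=> Et; rewrite /h (_ : windowed f theta (t, phi) = 0) ?normc0 ?expr0n ?mul0r//.
  rewrite -(cintegral0 mu); apply: eq_cintegral => x.
  by apply: eq0_normc; rewrite normcM normc_conj normcM mulrCA -normcM hE// normc0 mulr0.
have hF0 t phi : ~ F m phi -> h (t, phi) = 0.
  by move=> Fphi; rewrite /h indicE/= memNset// mulr0.
have mE := compact_borel hG cE; have Eoo := haar_compact haar cE.
rewrite (product_rectangle mE (mF m) Eoo (Foo m) mh h0 hE0 hF0)//.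
rewrite -sqint_section_integral; apply: ge0_le_integral => //.
- by move=> t _; apply: integral_ge0 => phi _; rewrite lee_fin.
- exact: (measurable_section_integral1 (mF m) (Foo m) mh h0 hF0).
- exact: measurable_sqint_section.
- move=> t _; have := windowed_section_sqint t.
  rewrite (_ : sqint mu _ = sqint mu (fun x => f x * shift theta t x)%R); last first.
    by apply: eq_integral => x _; rewrite normcM normc_conj -normcM.
  apply: le_trans; apply: ge0_le_integral => //.
  + by move=> phi _; rewrite lee_fin.
  + apply/measurable_EFinP; exact: (measurableT_comp mh (measurable_pair1 t)).
  + apply: measurable_normc2E.
    exact: (cmeasurable_comp windowed_measurable_Cc (measurable_pair1 t)).
  + by move=> phi _; rewrite lee_fin ler_piMr ?sqr_ge0// indicE; case: (_ \in _).
Qed.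

(** Fatou along the sets F m, off whose union the transform vanishes. *)
Lemma windowed_sqint_basis : (sqint pi (windowed f theta) <= sqint mu f * sqint mu theta)%E.
Proof.
apply: (@fatou_cvg _ _ _ pi (fun m z => normc (windowed f theta z) ^+ 2 * \1_(F m) z.2) _
  (fun=> sqint mu f * sqint mu theta)%E).
- move=> m; apply: measurable_funM.
    by apply: measurable_funX; apply: measurable_normc; exact: windowed_measurable_Cc.
  exact: (measurableT_comp (measurable_indic (mF m)) measurable_snd).
- by apply: measurable_funX; apply: measurable_normc; exact: windowed_measurable_Cc.
- by move=> m z; rewrite mulr_ge0 ?sqr_ge0.
- apply: aeW => z; have [a0|] := pselect (forall i, a i z.2 = 0).
    rewrite windowed_zero_off// normc0 expr0n; under eq_fun do rewrite mul0r.
    exact: cvg_cst.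
  move=> /existsNP [i /eqP ai]; have c0 : 0 < normc (a i z.2) ^+ 2.
    rewrite exprn_gt0// lt_def normc_ge0 andbT.
    by apply: contra_neq ai; exact: eq0_normc.
  apply: cvg_near_cst; have := near_infty_natSinv_lt (PosNum c0).
  move=> [N _ hN]; exists (maxn N i) => // m /= Nm.
  rewrite indicE mem_set ?mulr1//= /F/=.
  have im : (i < m.+1)%N by rewrite ltnS; apply: leq_trans Nm; exact: leq_maxr.
  rewrite /A (bigD1 (Ordinal im))//=.
  apply: ler_wpDr; first by apply: sumr_ge0 => j _; exact: sqr_ge0.
  by apply: ltW; apply: hN => /=; apply: leq_trans Nm; exact: leq_maxl.
- exact: windowed_truncated_sqint.
- exact: cvg_cst.
Qed.

End Expansion.

Lemma windowed_Cc (pi : {measure set Z -> \bar R}) : product_measure nu pi ->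
  cmeasurable (windowed f theta) /\
  (sqint pi (windowed f theta) <= sqint mu f * sqint mu theta)%E.
Proof.
move=> pi_prod; have [e [_ eb]] := orthonormal_basis hH.
by split; [exact: windowed_measurable_Cc eb|exact: windowed_sqint_basis eb pi pi_prod].
Qed.

End CompactlySupported.

(** Approximate both arguments by compactly supported functions: the transforms
    converge pointwise, uniformly in fact, and Fatou's lemma applies. *)
Theorem windowed_sqint (nu : {measure set (borel (splus_at phi0)) -> \bar R})
    (pi : {measure set Z -> \bar R}) (f theta : borel G -> R[i]) :
  plancherel_measure nu -> product_measure nu pi ->
  Lp_biinv mu K 2%:E f -> Lp_biinv mu K 2%:E theta ->
  cmeasurable (windowed f theta) /\
  (sqint pi (windowed f theta) <= sqint mu f * sqint mu theta)%E.
Proof.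
move=> nuP pi_prod fL tL.
have [psi [psic psie]] := Cc_biinv_approximation fL.
have [eta [etac etae]] := Cc_biinv_approximation tL.
have [[fL2 _] [tL2 _]] := (fL, tL).
have psiL k : cLp mu 2%:E (psi k) by have [] := Cc_biinv_Lp (psic k).
have etaL k : cLp mu 2%:E (eta k) by have [] := Cc_biinv_Lp (etac k).
have harm0 (c : R) : (c * k.+1%:R^-1) @[k --> \oo] --> (0 : R).
  by rewrite -(mulr0 c); apply: cvgM; [exact: cvg_cst|exact: cvg_harmonic].
have psin k : nrm2 mu (psi k) <= nrm2 mu f + k.+1%:R^-1.
  rewrite addrC; apply: le_trans (nrm2_triangle (psiL k) fL2) _.
  by rewrite nrm2C lerD2r psie.
have etan k : nrm2 mu (eta k) <= nrm2 mu theta + k.+1%:R^-1.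
  rewrite addrC; apply: le_trans (nrm2_triangle (etaL k) tL2) _.
  by rewrite nrm2C lerD2r etae.
have wcvg z : normc (windowed (psi k) (eta k) z - windowed f theta z) @[k --> \oo] --> (0 : R).
  have lim0 := harm0 (nrm2 mu theta + 1 + nrm2 mu f).
  apply: (squeeze_cvgr _ (cvg_cst 0) lim0); apply: nearW => k.
  rewrite normc_ge0 andTb windowedB//.
  apply: le_trans (le_normcD _ _) _; rewrite mulrDl; apply: lerD.
    apply: le_trans (windowed_le z (cLp2B (psiL k) fL2) (etaL k)) _.
    rewrite mulrC ler_pM ?nrm2_ge0//; last by rewrite nrm2C.
    by apply: le_trans (etan k) _; rewrite lerD2l invf_le1// ler1n.
  apply: le_trans (windowed_le z fL2 (cLp2B (etaL k) tL2)) _.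
  by rewrite ler_wpM2l ?nrm2_ge0// nrm2C.
have wm k : cmeasurable (windowed (psi k) (eta k)).
  by have [] := windowed_Cc (psic k) (etac k) nuP pi_prod.
have mW : cmeasurable (windowed f theta) := cmeasurable_lim wm wcvg.
split => //; rewrite (nrm2E fL2) (nrm2E tL2) -EFinM.
apply: (@fatou_cvg _ _ _ pi (fun k z => normc (windowed (psi k) (eta k) z) ^+ 2) _
  (fun k => ((nrm2 mu f + k.+1%:R^-1) ^+ 2 * (nrm2 mu theta + k.+1%:R^-1) ^+ 2)%:E)).
- by move=> k; apply: measurable_funX; exact: measurable_normc.
- by apply: measurable_funX; exact: measurable_normc.
- by move=> k z; exact: sqr_ge0.
- apply: aeW => z.
  have h : normc (windowed (psi k) (eta k) z) @[k --> \oo] --> normc (windowed f theta z).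
    apply/cvgrPdist_le => e e0; have /cvgrPdist_le/(_ e e0) := wcvg z.
    apply: filterS => k; rewrite sub0r normrN ger0_norm ?normc_ge0//.
    apply: le_trans; rewrite distrC; exact: ler_normc_dist.
  by under eq_fun do rewrite expr2; rewrite expr2; exact: cvgM.
- move=> k; have [_] := windowed_Cc (psic k) (etac k) nuP pi_prod.
  move=> /le_trans; apply; rewrite (nrm2E (psiL k)) (nrm2E (etaL k)) -EFinM lee_fin.
  by rewrite ler_pM ?sqr_ge0// lerXn2r ?nnegrE ?addr_ge0 ?nrm2_ge0 ?invr_ge0.
- apply: cvg_EFin; first exact: nearW.
  have h (c : R) : ((c + k.+1%:R^-1) ^+ 2) @[k --> \oo] --> c ^+ 2.
    have hc : (c + k.+1%:R^-1) @[k --> \oo] --> c.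
      by rewrite -[X in _ --> X]addr0; apply: cvgD; [exact: cvg_cst|exact: cvg_harmonic].
    by under eq_fun do rewrite expr2; rewrite expr2; exact: cvgM.
  exact: cvgM.
Qed.

End Stockwell.

(** * Localization operators *)

Theorem theorem4p10 (R : realType) (G : topologicalGroupType)
    (G_hausdorff : hausdorff_space G) (G_lc : locally_compact [set: G])
    (mu : {measure set (borel G) -> \bar R}) (mu_haar : left_haar mu)
    (K : set G) (GK : gelfand_pair mu K)
    (L2_sep : hilbert_separable (@L2_dot R G mu K))
    (alpha : G -> G) (alpha_aut : topological_automorphism alpha)
    (delta : R) (alpha_delta : modulus mu alpha delta)
    (phi0 : splus mu K)
    (nu : {measure set (borel (splus_at phi0)) -> \bar R})
    (nu_plancherel : plancherel_measure nu)
    (pi : {measure set (borel G * borel (splus_at phi0))%type -> \bar R})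
    (pi_prod : product_measure nu pi)
    (theta : L2 mu K) (theta1 : hnorm (@L2_dot R G mu K) theta = 1)
    (p : \bar R) (p_ge1 : (1 <= p)%E)
    (u : borel G * borel (splus_at phi0) -> R[i]) (u_Lp : cLp pi p u) :
  exists T : {linear L2 mu K -> L2 mu K},
    [/\ is_localization alpha delta theta pi u T,
        schatten_class (@L2_dot R G mu K) p T &
        (schatten_norm (@L2_dot R G mu K) p T <= clnorm pi p u)%E].
Proof.
have hH := L2_hilbert L2_sep.
pose S (f : L2 mu K) (z : borel G * borel (splus_at phi0)) :=
  @stockwell R G mu K phi0 alpha delta theta f z.1 z.2.
have tL : Lp_biinv mu K 2%:E (L2_fun theta) := L2_fun_biinv theta.
have atomE t (phi : splus_at phi0) : stockwell_atom alpha delta theta t phi =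
    (fun x => sval phi x * shift alpha delta (L2_fun theta) t x).
  by apply/funext => x; rewrite /stockwell_atom /shift mulrA (mulrC (sval phi x)).
have atomL t (phi : splus_at phi0) : cLp mu 2%:E (stockwell_atom alpha delta theta t phi).
  by rewrite atomE; apply: (atom_Lp G_hausdorff G_lc mu_haar GK alpha_aut alpha_delta _ _ tL.1).
have SE f : S f = windowed alpha delta (L2_fun f) (L2_fun theta).
  by apply/funext => z; rewrite /S /stockwell atomE.
have hW f := windowed_sqint G_hausdorff G_lc mu_haar GK L2_sep alpha_aut alpha_delta
  nu_plancherel pi_prod (L2_fun_biinv f) tL.
have Smeas f : cmeasurable (S f) by rewrite SE; case: (hW f).
have Slin a f g z : S (a *: f + g) z = a * S f z + S g z.
  rewrite /S /stockwell -cprod_linl//; try exact: L2_fun_Lp.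
  apply: cprod_ae.
  - exact: L2_fun_measurable.
  - by apply: cmeasurable_lin; exact: L2_fun_measurable.
  - exact: (atomL _ _).1.
  - exact: (atomL _ _).1.
  - exact: L2_fun_lin.
  - exact: aeW.
have nrmE f : nrm2 mu (L2_fun f) = hnorm (@L2_dot R G mu K) f.
  by rewrite /nrm2 L2_sqint/= sqrtr_sqr ger0_norm// nrm_ge0.
have Sbound f z : normc (S f z) <= hnorm (@L2_dot R G mu K) f.
  rewrite SE; apply: le_trans (windowed_le G_hausdorff G_lc mu_haar GK alpha_aut alpha_delta
    z (L2_fun_Lp f) tL.1) _.
  by rewrite !nrmE theta1 mulr1.
have Ssqint f : (sqint pi (S f) <= ((hnorm (@L2_dot R G mu K) f) ^+ 2)%:E)%E.
  rewrite SE; apply: le_trans (hW f).2 _.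
  by rewrite !L2_sqint theta1 expr1n mule1.
have [T [Tform Tclass Tnorm]] :=
  frame_operator_schatten hH Smeas Slin Sbound Ssqint p_ge1 u_Lp.
exists T; split => // f g h.
have -> : h = form S u f g.
  by apply/funext => z; rewrite /h /form /S /stockwell (cprodC (L2_fun_Lp g)).
exact: Tform.
Qed.
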